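(* Let $K$ be a field with $\mathrm{char}\,K\ne 2$. Let $A$ be a super-commutative Hopf superalgebra over $K$ (not necessarily finitely generated) and let $\overline{A}=A/(A_1)$, which is a commutative Hopf algebra. Then $A$ is smooth over $K$ if and only if $\overline{A}$ is smooth over $K$. These equivalent conditions are satisfied if $\mathrm{char}\, K=0$ and $\overline{A}$ is finitely generated.
   Context: $\mathsf{SAlg}_K$ is the category of super-commutative superalgebras ($\mathbb{Z}_2$-graded algebras with $ab=(-1)^{|a||b|}ba$) over $K$. $(A_1)$ is the ideal of $A$ generated by the odd component $A_1$. An object $A\in \mathsf{SAlg}_K$ is smooth over $K$ if for every $B\in\mathsf{SAlg}_K$ and every nilpotent super-ideal $J\subset B$, the natural map $\mathsf{SAlg}_K(A,B)\to\mathsf{SAlg}_K(A,B/J)$ is surjective. A commutative algebra (such as $\overline{A}$) is smooth over $K$ if it has the same lifting property with respect to commutative algebras $B$ and nilpotent ideals $J\subset B$. *)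

(* Defs.v *)
From HB Require Import structures.
From mathcomp Require Import all_boot all_algebra.
From mathcomp Require Import boolp.

Set Implicit Arguments.
Unset Strict Implicit.
Unset Printing Implicit Defensive.

Import GRing.Theory.
Local Open Scope ring_scope.
Local Open Scope quotient_scope.

(** * Two-sided ideals and quotient algebras

MathComp quotients a ring by an ideal only in the commutative case.  As its
algebras are nonzero, ideals are required to be proper; in particular the zero
(super)algebra is not an object below.  For the lifting properties this loses
nothing: everything lifts along a quotient of the zero algebra, and a nilpotent
ideal of a nonzero algebra is proper ([nilpotent_proper]). *)

HB.mixin Record isTwoSidedIdeal (R : nzRingType) (I : R -> bool) := {
  tsideal1 : 1 \notin (I : {pred R});
  tsidealMl : forall a x : R, x \in (I : {pred R}) -> a * x \in (I : {pred R});
  tsidealMr : forall a x : R, x \in (I : {pred R}) -> x * a \in (I : {pred R})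
}.

#[short(type="tsideal")]
HB.structure Definition TwoSidedIdeal (R : nzRingType) :=
  {I of GRing.ZmodClosed R I & isTwoSidedIdeal R I}.

Definition nilpotent (R : nzRingType) (I : {pred R}) : Prop :=
  exists n : nat, forall s : seq R,
    size s = n -> {subset s <= I} -> \prod_(x <- s) x = 0.

Lemma nilpotent_proper (R : nzRingType) (I : {pred R}) :
  nilpotent I -> 1 \notin I.
Proof.
case=> n nilI; apply/negP => I1.
have := nilI (nseq n 1) (size_nseq _ _).
rewrite big_nseq iter_mulr_1 expr1n => h.
have /eqP : (1 : R) = 0 by apply: h => x /nseqP[-> _].
by rewrite oner_eq0.
Qed.

Section AlgebraQuotient.
Variables (K : fieldType) (B : algType K) (I : tsideal B).

Definition algquot : Type := Quotient.quot I.

HB.instance Definition _ := GRing.Zmodule.on algquot.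
HB.instance Definition _ := EqQuotient.on algquot.

Definition algproj (x : B) : algquot := \pi_(Quotient.quot I) x.

Lemma algproj_eq x y : (algproj x = algproj y) <-> (x - y \in I).
Proof.
by rewrite /algproj Quotient.idealrBE; split=> [->|/eqP].
Qed.

Lemma algproj_eq0 x : (algproj x = 0) <-> (x \in I).
Proof.
rewrite -[x in x \in I]subr0 -algproj_eq.
by suff -> : algproj 0 = 0 by []; rewrite /algproj piE.
Qed.

Lemma algproj_surj (y : algquot) : exists x, algproj x = y.
Proof. by exists (repr y); rewrite /algproj reprK. Qed.

Lemma algproj_is_zmod_morphism : zmod_morphism algproj.
Proof. by move=> x y; rewrite /algproj !piE. Qed.

HB.instance Definition _ :=
  GRing.isZmodMorphism.Build B algquot algproj algproj_is_zmod_morphism.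

Definition aq_one : algquot := algproj 1.
Definition aq_mul (x y : algquot) : algquot := algproj (repr x * repr y).
Definition aq_scale (a : K) (x : algquot) : algquot := algproj (a *: repr x).

Lemma aq_repr x : repr (algproj x) - x \in I.
Proof. by apply/algproj_eq; rewrite /algproj reprK. Qed.

Lemma aq_mulE x y : aq_mul (algproj x) (algproj y) = algproj (x * y).
Proof.
apply/algproj_eq; set x' := repr _; set y' := repr _.
have -> : x' * y' - x * y = x' * (y' - y) + (x' - x) * y.
  by rewrite mulrBr mulrBl addrA subrK.
by apply: rpredD; [apply: tsidealMl | apply: tsidealMr]; exact: aq_repr.
Qed.

Lemma aq_scaleE a x : aq_scale a (algproj x) = algproj (a *: x).
Proof.
apply/algproj_eq; rewrite -scalerBr -[_ - _]mul1r scalerAl tsidealMl //.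
exact: aq_repr.
Qed.

Let surj := algproj_surj.

Lemma aq_mulA : associative aq_mul.
Proof.
by move=> x y z; case: (surj x) (surj y) (surj z) => a <- [b <-] [c <-];
  rewrite !aq_mulE mulrA.
Qed.
Lemma aq_mul1 : left_id aq_one aq_mul.
Proof. by move=> x; case: (surj x) => a <-; rewrite aq_mulE mul1r. Qed.
Lemma aq_mulr1 : right_id aq_one aq_mul.
Proof. by move=> x; case: (surj x) => a <-; rewrite aq_mulE mulr1. Qed.
Lemma aq_mulDl : left_distributive aq_mul +%R.
Proof.
by move=> x y z; case: (surj x) (surj y) (surj z) => a <- [b <-] [c <-];
  rewrite -raddfD !aq_mulE mulrDl raddfD.
Qed.
Lemma aq_mulDr : right_distributive aq_mul +%R.
Proof.
by move=> x y z; case: (surj x) (surj y) (surj z) => a <- [b <-] [c <-];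
  rewrite -raddfD !aq_mulE mulrDr raddfD.
Qed.
Lemma aq_one_neq0 : aq_one != 0.
Proof. by apply/eqP => /algproj_eq0; apply/negP/tsideal1. Qed.

HB.instance Definition _ := GRing.Zmodule_isNzRing.Build algquot
  aq_mulA aq_mul1 aq_mulr1 aq_mulDl aq_mulDr aq_one_neq0.

Lemma aq_scalerA a b x : aq_scale a (aq_scale b x) = aq_scale (a * b) x.
Proof. by case: (surj x) => c <-; rewrite !aq_scaleE scalerA. Qed.
Lemma aq_scale1 : left_id 1 aq_scale.
Proof. by move=> x; case: (surj x) => c <-; rewrite aq_scaleE scale1r. Qed.
Lemma aq_scaleDr : right_distributive aq_scale +%R.
Proof.
by move=> a x y; case: (surj x) (surj y) => b <- [c <-];
  rewrite -raddfD !aq_scaleE scalerDr raddfD.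
Qed.
Lemma aq_scaleDl x : {morph aq_scale^~ x : a b / a + b}.
Proof.
by move=> a b; case: (surj x) => c <-; rewrite !aq_scaleE scalerDl raddfD.
Qed.

HB.instance Definition _ := GRing.Zmodule_isLmodule.Build K algquot
  aq_scalerA aq_scale1 aq_scaleDr aq_scaleDl.

Lemma aq_scalerAl a (x y : algquot) : a *: (x * y) = (a *: x) * y.
Proof.
case: (surj x) (surj y) => b <- [c <-].
rewrite /GRing.scale /GRing.mul /=.
by rewrite !(aq_mulE, aq_scaleE) scalerAl.
Qed.
Lemma aq_scalerAr a (x y : algquot) : a *: (x * y) = x * (a *: y).
Proof.
case: (surj x) (surj y) => b <- [c <-].
rewrite /GRing.scale /GRing.mul /=.
by rewrite !(aq_mulE, aq_scaleE) scalerAr.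
Qed.

HB.instance Definition _ := GRing.Lmodule_isLalgebra.Build K algquot aq_scalerAl.
HB.instance Definition _ := GRing.Lalgebra_isAlgebra.Build K algquot aq_scalerAr.

Lemma algproj_is_monoid_morphism : monoid_morphism algproj.
Proof. by split=> // x y; rewrite -aq_mulE. Qed.
Lemma algproj_is_scalable : scalable algproj.
Proof. by move=> a x; rewrite -aq_scaleE. Qed.

HB.instance Definition _ :=
  GRing.isMonoidMorphism.Build B algquot algproj algproj_is_monoid_morphism.
HB.instance Definition _ :=
  GRing.isScalable.Build K B algquot *:%R algproj algproj_is_scalable.

End AlgebraQuotient.

Section CommutativeQuotient.
Variables (K : fieldType) (B : comAlgType K) (I : tsideal B).

Lemma aq_mulC : commutative (@GRing.mul (algquot I)).
Proof.
move=> x y; case: (algproj_surj x) (algproj_surj y) => a <- [b <-].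
by rewrite -!rmorphM mulrC.
Qed.

HB.instance Definition _ :=
  GRing.PzRing_hasCommutativeMul.Build (algquot I) aq_mulC.

End CommutativeQuotient.

(** * Superalgebras *)

(* [deg i] is the homogeneous component of degree [i], where [false] and [true]
   stand for the classes of 0 and 1 in Z/2; addition in Z/2 is [addb], and the
   product of two degrees is [andb]. *)
HB.mixin Record isSuperAlgebra (K : fieldType) A of GRing.Algebra K A := {
  deg : bool -> {pred A};
  deg_submod : forall i, submod_closed (deg i);
  deg_decomp : forall a : A,
    exists x : A * A, [/\ x.1 \in deg false, x.2 \in deg true & a = x.1 + x.2];
  deg_disjoint : forall a : A, a \in deg false -> a \in deg true -> a = 0;
  deg_1 : 1 \in deg false;
  deg_M : forall i j (a b : A),
    a \in deg i -> b \in deg j -> a * b \in deg (i (+) j)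
}.

#[short(type="superAlgType")]
HB.structure Definition SuperAlgebra (K : fieldType) :=
  {A of GRing.Algebra K A & isSuperAlgebra K A}.

HB.mixin Record isSuperCommutative (K : fieldType) A of SuperAlgebra K A := {
  supermulC : forall i j (a b : A), a \in deg i -> b \in deg j ->
    a * b = (-1) ^+ (i && j) * (b * a)
}.

#[short(type="comSuperAlgType")]
HB.structure Definition ComSuperAlgebra (K : fieldType) :=
  {A of SuperAlgebra K A & isSuperCommutative K A}.

Definition even_map (K : fieldType) (A B : superAlgType K) (f : A -> B) : Prop :=
  forall i a, a \in deg i -> f a \in deg i.

Section Component.
Variables (K : fieldType) (A : superAlgType K).

Definition component (i : bool) (a : A) : A :=
  let x := sval (cid (deg_decomp a)) in if i then x.2 else x.1.

Lemma component_deg i a : component i a \in deg i.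
Proof. by rewrite /component; case: cid => x []; case: i. Qed.

Lemma componentD a : a = component false a + component true a.
Proof. by rewrite /component; case: cid => x []. Qed.

HB.instance Definition _ i :=
  GRing.isZmodClosed.Build A (deg i) (GRing.submod_closedB (deg_submod i)).

Lemma deg_Z i k (a : A) : a \in deg i -> k *: a \in deg i.
Proof.
by move=> ai; have [d0 dl] := deg_submod (s := A) i; rewrite -[_ *: _]addr0 dl.
Qed.

Lemma component_unique (a x y : A) : x \in deg false -> y \in deg true ->
  a = x + y -> component false a = x /\ component true a = y.
Proof.
move=> x0 y1 e; have e2 : component false a - x = y - component true a.
  by apply/eqP; rewrite subr_eq addrAC eq_sym subr_eq -componentD e addrC.
have z : component false a - x = 0.
  apply: deg_disjoint; first by rewrite rpredB ?component_deg.
  by rewrite e2 rpredB ?component_deg.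
split; apply/eqP; rewrite -subr_eq0 ?z //.
by rewrite -oppr_eq0 opprB -e2 z.
Qed.

End Component.

Arguments component {K A} i a : simpl never.

Section ComponentTheory.
Variables (K : fieldType) (A : superAlgType K).

Lemma component_id i j (a : A) :
  a \in deg i -> component j a = if j == i then a else 0.
Proof.
move=> ai; have [e0 e1] : component false a = (if i then 0 else a) /\
    component true a = (if i then a else 0).
  by apply: component_unique; case: i ai => // _; rewrite ?rpred0 ?addr0 ?add0r.
by case: i j {ai} e0 e1 => [] [].
Qed.

Lemma component_is_linear i : linear (@component K A i).
Proof.
move=> k a b; have [e0 e1] : component false (k *: a + b) =
      k *: component false a + component false b /\
    component true (k *: a + b) = k *: component true a + component true b.
  apply: component_unique; rewrite ?rpredD ?deg_Z ?component_deg //.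
  by rewrite addrACA -scalerDr -!componentD.
by case: i.
Qed.

HB.instance Definition _ i :=
  GRing.isLinear.Build K A A *:%R (@component K A i) (component_is_linear i).

End ComponentTheory.

HB.mixin Record isGraded (K : fieldType) (A : superAlgType K) (I : A -> bool) := {
  gradedP : forall i (x : A),
    x \in (I : {pred A}) -> component i x \in (I : {pred A})
}.

#[short(type="superideal")]
HB.structure Definition SuperIdeal (K : fieldType) (A : superAlgType K) :=
  {I of TwoSidedIdeal A I & isGraded K A I}.

Section SuperQuotient.
Variables (K : fieldType) (A : superAlgType K) (I : superideal A).
Local Notation Q := (algquot I).

Definition sq_deg (i : bool) : {pred Q} :=
  [pred y : Q | `[< exists2 x : A, x \in deg i & algproj I x = y >]].

Lemma sq_degP i y :
  reflect (exists2 x : A, x \in deg i & algproj I x = y) (y \in sq_deg i).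
Proof. exact: asboolP. Qed.

Lemma sq_deg_submod i : submod_closed (sq_deg i).
Proof.
split=> [|k _ _ /sq_degP[x xi <-] /sq_degP[y yi <-]]; apply/sq_degP.
  by exists 0; rewrite ?rpred0 ?raddf0.
by exists (k *: x + y); rewrite ?rpredD ?deg_Z // linearP.
Qed.

Lemma sq_decomp (a : Q) : exists x : Q * Q,
  [/\ x.1 \in sq_deg false, x.2 \in sq_deg true & a = x.1 + x.2].
Proof.
case: (algproj_surj a) => x <-.
exists (algproj I (component false x), algproj I (component true x)).
rewrite /= -raddfD -componentD.
by split=> //; apply/sq_degP; [exists (component false x)|exists (component true x)];
  rewrite ?component_deg.
Qed.

Lemma sq_disjoint (a : Q) : a \in sq_deg false -> a \in sq_deg true -> a = 0.
Proof.
move=> /sq_degP[x x0 <-] /sq_degP[y y1 /algproj_eq yxI].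
apply/algproj_eq0; have := gradedP false _ yxI.
by rewrite raddfB /= !(component_id _ x0, component_id _ y1) /= sub0r rpredN.
Qed.

Lemma sq_1 : 1 \in sq_deg false.
Proof. by apply/sq_degP; exists 1; rewrite ?deg_1 ?rmorph1. Qed.

Lemma sq_M i j (a b : Q) :
  a \in sq_deg i -> b \in sq_deg j -> a * b \in sq_deg (i (+) j).
Proof.
move=> /sq_degP[x xi <-] /sq_degP[y yj <-]; apply/sq_degP.
by exists (x * y); rewrite ?deg_M ?rmorphM.
Qed.

HB.instance Definition _ := isSuperAlgebra.Build K (algquot I)
  sq_deg_submod sq_decomp sq_disjoint sq_1 sq_M.

End SuperQuotient.

Section ComSuperQuotient.
Variables (K : fieldType) (A : comSuperAlgType K) (I : superideal A).

Lemma sq_supermulC i j (a b : algquot I) : a \in deg i -> b \in deg j ->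
  a * b = (-1) ^+ (i && j) * (b * a).
Proof.
move=> /sq_degP[x xi <-] /sq_degP[y yj <-].
by rewrite -!rmorphM (supermulC i j _ _ xi yj) [LHS]rmorphM rmorph_sign.
Qed.

HB.instance Definition _ :=
  isSuperCommutative.Build K (algquot I) sq_supermulC.

End ComSuperQuotient.

(** * Tensor products

The tensor product of [U] and [V] consists of formal sums of pairs, two sums
being identified when every bilinear map takes the same value on them. *)

Section Tensor.
Variables (K : fieldType) (U V : lmodType K).

Definition sum_along (W : lmodType K) (f : U -> V -> W) (s : seq (U * V)) : W :=
  \sum_(p <- s) f p.1 p.2.

Definition tensor_rel (s t : seq (U * V)) : bool :=
  `[< forall (W : lmodType K) (f : U -> V -> W),
        bilinear_for *:%R *:%R f -> sum_along f s = sum_along f t >].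

Lemma tensor_rel_equiv : equiv_class_of tensor_rel.
Proof.
split=> [s|s t|t s r].
- by apply/asboolP.
- by apply/asboolP/asboolP => h W f fP; rewrite h.
- by move=> /asboolP st /asboolP tr; apply/asboolP => W f fP; rewrite st ?tr.
Qed.

Canonical tensor_rel_equiv_rel := EquivRelPack tensor_rel_equiv.
Canonical tensor_rel_encModRel := defaultEncModRel tensor_rel.

Definition tensor : Type := {eq_quot tensor_rel}.

HB.instance Definition _ := Choice.on tensor.
HB.instance Definition _ := EqQuotient.on tensor.

Definition tens_of (s : seq (U * V)) : tensor := \pi_({eq_quot tensor_rel}) s.

Lemma tens_of_surj (t : tensor) : exists s, tens_of s = t.
Proof. by exists (repr t); rewrite /tens_of reprK. Qed.

Lemma tens_ofP s t :
  tens_of s = tens_of t <->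
  forall (W : lmodType K) (f : U -> V -> W),
    bilinear_for *:%R *:%R f -> sum_along f s = sum_along f t.
Proof.
rewrite /tens_of; split=> [/eqP|h].
  by rewrite piE => /asboolP.
by apply/eqP; rewrite piE; apply/asboolP.
Qed.

Lemma repr_tens_of s : tens_of (repr (tens_of s)) = tens_of s.
Proof. by rewrite /tens_of reprK. Qed.

Definition zscale (k : K) (s : seq (U * V)) := [seq (k *: p.1, p.2) | p <- s].

Lemma sum_along_cat (W : lmodType K) (f : U -> V -> W) s t :
  sum_along f (s ++ t) = sum_along f s + sum_along f t.
Proof. exact: big_cat. Qed.

Lemma sum_along_scale (W : lmodType K) (f : U -> V -> W) k s :
  bilinear_for *:%R *:%R f -> sum_along f (zscale k s) = k *: sum_along f s.
Proof.
move=> [fl _]; rewrite /sum_along big_map scaler_sumr; apply: eq_bigr => p _ /=.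
by have /= := scalable_linear (fl p.2) k p.1.
Qed.

Definition tadd (x y : tensor) := tens_of (repr x ++ repr y).
Definition tscale (k : K) (x : tensor) := tens_of (zscale k (repr x)).
Definition tzero := tens_of [::].

Lemma taddE s t : tadd (tens_of s) (tens_of t) = tens_of (s ++ t).
Proof.
apply/tens_ofP => W f fP; rewrite !sum_along_cat.
by congr (_ + _); move: W f fP; apply/tens_ofP/repr_tens_of.
Qed.

Lemma tscaleE k s : tscale k (tens_of s) = tens_of (zscale k s).
Proof.
apply/tens_ofP => W f fP; rewrite !sum_along_scale //; congr (_ *: _).
by move: W f fP; apply/tens_ofP/repr_tens_of.
Qed.

Lemma taddA : associative tadd.
Proof.
move=> x y z; case: (tens_of_surj x) (tens_of_surj y) (tens_of_surj z).
by move=> a <- [b <-] [c <-]; rewrite !taddE catA.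
Qed.
Lemma taddC : commutative tadd.
Proof.
move=> x y; case: (tens_of_surj x) (tens_of_surj y) => a <- [b <-].
by rewrite !taddE; apply/tens_ofP => W f _; rewrite !sum_along_cat addrC.
Qed.
Lemma tadd0 : left_id tzero tadd.
Proof. by move=> x; case: (tens_of_surj x) => a <-; rewrite taddE. Qed.
Lemma taddN : left_inverse tzero (tscale (-1)) tadd.
Proof.
move=> x; case: (tens_of_surj x) => a <-; rewrite tscaleE taddE.
apply/tens_ofP => W f fP; rewrite sum_along_cat sum_along_scale // scaleN1r.
by rewrite addNr /sum_along big_nil.
Qed.

HB.instance Definition _ := GRing.isZmodule.Build tensor taddA taddC tadd0 taddN.

Lemma tscaleA a b x : tscale a (tscale b x) = tscale (a * b) x.
Proof.
case: (tens_of_surj x) => s <-; rewrite !tscaleE.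
by apply/tens_ofP => W f fP; rewrite !sum_along_scale // scalerA.
Qed.
Lemma tscale1 : left_id 1 tscale.
Proof.
move=> x; case: (tens_of_surj x) => s <-; rewrite !tscaleE.
by apply/tens_ofP => W f fP; rewrite !sum_along_scale // scale1r.
Qed.
Lemma tscaleDr : right_distributive tscale +%R.
Proof.
move=> k x y; case: (tens_of_surj x) (tens_of_surj y) => s <- [t <-].
rewrite /GRing.add /= !(taddE, tscaleE); apply/tens_ofP => W f fP.
by rewrite !(sum_along_cat, sum_along_scale _ _ fP) scalerDr.
Qed.
Lemma tscaleDl x : {morph tscale^~ x : a b / a + b}.
Proof.
move=> a b; case: (tens_of_surj x) => s <-.
rewrite [in RHS]/GRing.add /= !(taddE, tscaleE); apply/tens_ofP => W f fP.
by rewrite !(sum_along_cat, sum_along_scale _ _ fP) scalerDl.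
Qed.

HB.instance Definition _ := GRing.Zmodule_isLmodule.Build K tensor
  tscaleA tscale1 tscaleDr tscaleDl.

Lemma tens_ofD s t : tens_of s + tens_of t = tens_of (s ++ t).
Proof. exact: taddE. Qed.

Lemma tens_ofZ k s : k *: tens_of s = tens_of (zscale k s).
Proof. exact: tscaleE. Qed.

Definition tens (u : U) (v : V) : tensor := tens_of [:: (u, v)].

Lemma tens_bilinear : bilinear_for *:%R *:%R tens.
Proof.
split=> [v k u u'|u k v v'] /=; rewrite tens_ofZ tens_ofD;
  apply/tens_ofP => W f fP;
  rewrite sum_along_cat sum_along_scale // /sum_along !big_seq1 /=;
  have [fl fr] := fP; first exact: (fl v k u u').
exact: (fr u k v v').
Qed.

Lemma tens_span (t : tensor) :
  exists s : seq (U * V), t = \sum_(p <- s) tens p.1 p.2.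
Proof.
case: (tens_of_surj t) => s <-; exists s; elim: s => [|[u v] s IHs].
  by rewrite big_nil.
by rewrite big_cons -IHs tens_ofD.
Qed.

(* The linear map induced by a bilinear map [f]; when [f] is not bilinear this
   depends on the chosen representatives. *)
Definition tlift (W : lmodType K) (f : U -> V -> W) (t : tensor) : W :=
  sum_along f (repr t).

Section Lift.
Variables (W : lmodType K) (f : U -> V -> W).
Hypothesis fP : bilinear_for *:%R *:%R f.

Lemma tlift_tens_of s : tlift f (tens_of s) = sum_along f s.
Proof. by move: W f fP; apply/tens_ofP/repr_tens_of. Qed.

Lemma tlift_tens u v : tlift f (tens u v) = f u v.
Proof. by rewrite tlift_tens_of /sum_along big_seq1. Qed.

Lemma tlift_linear : linear (tlift f).
Proof.
move=> k x y; case: (tens_of_surj x) (tens_of_surj y) => s <- [t <-].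
rewrite tens_ofZ tens_ofD.
by rewrite !tlift_tens_of sum_along_cat sum_along_scale.
Qed.

End Lift.

Lemma tensor_ext (W : lmodType K) (g h : {linear tensor -> W}) :
  (forall u v, g (tens u v) = h (tens u v)) -> g =1 h.
Proof.
move=> gh t; case: (tens_span t) => s ->; rewrite !linear_sum.
by apply: eq_bigr => p _; apply: gh.
Qed.

End Tensor.

Arguments tensor {K} (U V)%_type_scope.

Notation "U ⊗ V" := (tensor U V) (at level 40, left associativity) : type_scope.
Notation "u ⊗ v" := (tens u v) (at level 40, left associativity) : ring_scope.

Section LiftTheory.
Variables (K : fieldType) (U V W : lmodType K).
Implicit Types f g : U -> V -> W.

Lemma eq_tlift f g : (forall u v, f u v = g u v) -> tlift f =1 tlift g.
Proof. by move=> fg t; apply: eq_bigr => p _; apply: fg. Qed.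

Lemma tlift_lincomb k f g t :
  tlift (fun u v => k *: f u v + g u v) t = k *: tlift f t + tlift g t.
Proof. by rewrite /tlift /sum_along scaler_sumr -big_split. Qed.

End LiftTheory.

Definition tmap (K : fieldType) (U V U' V' : lmodType K)
    (f : U -> U') (g : V -> V') : U ⊗ V -> U' ⊗ V' :=
  tlift (fun u v => f u ⊗ g v).

Lemma tmap_tens (K : fieldType) (U V U' V' : lmodType K)
    (f : {linear U -> U'}) (g : {linear V -> V'}) u v :
  tmap f g (u ⊗ v) = f u ⊗ g v.
Proof.
have [tl tr] := @tens_bilinear K U' V'; apply: tlift_tens.
split=> [{}v k a b|{}u k a b] /=; rewrite linearP; first exact: (tl (g v)).
exact: (tr (f u)).
Qed.

Definition tassoc (K : fieldType) (U V W : lmodType K) :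
    (U ⊗ V) ⊗ W -> U ⊗ (V ⊗ W) :=
  tlift (fun t w => tlift (fun u v => u ⊗ (v ⊗ w)) t).

Lemma tassoc_tens (K : fieldType) (U V W : lmodType K)
    (u : U) (v : V) (w : W) :
  tassoc ((u ⊗ v) ⊗ w) = u ⊗ (v ⊗ w).
Proof.
have [tl tr] := @tens_bilinear K V W.
have [sl sr] := @tens_bilinear K U (V ⊗ W)%type.
have fP (c : W) : bilinear_for *:%R *:%R (fun (a : U) (b : V) => a ⊗ (b ⊗ c)).
  split=> [b k x y|a k x y] /=; first exact: (sl (b ⊗ c) k x y).
  by rewrite (tl c) (sr a).
rewrite /tassoc tlift_tens ?tlift_tens //.
split=> [c|t k x y] /=; first exact: tlift_linear (fP c).
rewrite -tlift_lincomb; apply: eq_tlift => a b.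
by rewrite (tr b) (sr a).
Qed.

Section SuperTensor.
Variables (K : fieldType) (A B : superAlgType K).

(* The product (a ⊗ b)(c ⊗ d) = (-1)^(|b||c|) ac ⊗ bd for homogeneous [b] and
   [c], see [tmul_tens]. *)
Definition tmul (x y : A ⊗ B) : A ⊗ B :=
  tlift (fun a b => tlift (fun c d =>
    \sum_(i : bool) \sum_(j : bool)
      (-1) ^+ (i && j) *: ((a * component j c) ⊗ (component i b * d))) y) x.

Lemma tmul_tens i j (a c : A) (b d : B) : b \in deg i -> c \in deg j ->
  tmul (a ⊗ b) (c ⊗ d) = (-1) ^+ (i && j) *: ((a * c) ⊗ (b * d)).
Proof.
move=> bi cj; have [tl tr] := @tens_bilinear K A B.
have sumP k (F G : bool -> bool -> A ⊗ B) :
    \sum_i \sum_j (-1) ^+ (i && j) *: (k *: F i j + G i j) =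
    k *: (\sum_i \sum_j (-1) ^+ (i && j) *: F i j) +
    \sum_i \sum_j (-1) ^+ (i && j) *: G i j.
  rewrite scaler_sumr -big_split; apply: eq_bigr => p _.
  rewrite scaler_sumr -big_split; apply: eq_bigr => q _.
  by rewrite scalerDr !scalerA mulrC.
rewrite /tmul tlift_tens; last first.
  split=> [z k x y|z k x y] /=; rewrite -tlift_lincomb; apply: eq_tlift => u v;
    rewrite -sumP; apply: eq_bigr => p _; apply: eq_bigr => q _; congr (_ *: _).
    by rewrite mulrDl -scalerAl (tl _).
  by rewrite linearP mulrDl -scalerAl (tr _).
rewrite tlift_tens; last first.
  split=> [z k x y|z k x y] /=;
    rewrite -sumP; apply: eq_bigr => p _; apply: eq_bigr => q _; congr (_ *: _).
    by rewrite linearP mulrDr -scalerAr (tl _).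
  by rewrite mulrDr -scalerAr (tr _).
have t0 (u : A) : u ⊗ (0 : B) = 0.
  by have := tr u (-1) 0 0; rewrite !scaleN1r !addNr.
have t0' (v : B) : (0 : A) ⊗ v = 0.
  by have := tl v (-1) 0 0; rewrite !scaleN1r !addNr.
rewrite (bigD1 i) //= [X in _ + X]big1 ?addr0 => [|p /negPf pi]; last first.
  by rewrite big1 // => q _; rewrite (component_id _ bi) pi mul0r t0 scaler0.
rewrite (bigD1 j) //= [X in _ + X]big1 ?addr0 => [|q /negPf qj]; last first.
  by rewrite (component_id _ cj) qj mulr0 t0' scaler0.
by rewrite (component_id _ bi) (component_id _ cj) !eqxx.
Qed.

Definition tdeg (k : bool) (t : A ⊗ B) : Prop :=
  exists2 s : seq (A * B),
    forall p, p \in s -> exists i, p.1 \in deg i /\ p.2 \in deg (i (+) k)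
    & t = \sum_(p <- s) p.1 ⊗ p.2.

End SuperTensor.

(** * Hopf superalgebras

A Hopf algebra object in super vector spaces: comultiplication and counit are
superalgebra maps and the antipode is an even linear convolution inverse of the
identity. *)

Record hopf_structure (K : fieldType) (A : superAlgType K) := HopfStructure {
  comul : {linear A -> (A ⊗ A)%type};
  comul1 : comul 1 = 1 ⊗ 1;
  comulM : forall a b : A, comul (a * b) = tmul (comul a) (comul b);
  comul_deg : forall i (a : A), a \in deg i -> tdeg i (comul a);
  counit : {lrmorphism A -> K^o};
  counit_odd : forall a : A, a \in deg true -> counit a = 0;
  coassoc : forall a : A,
    tassoc (tmap comul idfun (comul a)) = tmap idfun comul (comul a);
  counitl : forall a : A, tlift (fun x y : A => (counit x : K) *: y) (comul a) = a;
  counitr : forall a : A, tlift (fun x y : A => (counit y : K) *: x) (comul a) = a;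
  antipode : {linear A -> A};
  antipode_deg : forall i (a : A), a \in deg i -> antipode a \in deg i;
  antipodel : forall a : A,
    tlift (fun x y : A => antipode x * y) (comul a) = (counit a : K)%:A;
  antipoder : forall a : A,
    tlift (fun x y : A => x * antipode y) (comul a) = (counit a : K)%:A
}.

HB.mixin Record isHopfSuperAlgebra (K : fieldType) A of SuperAlgebra K A := {
  hopf : @hopf_structure K A
}.

#[short(type="hopfSuperAlgType")]
HB.structure Definition HopfSuperAlgebra (K : fieldType) :=
  {A of SuperAlgebra K A & isHopfSuperAlgebra K A}.

#[short(type="comHopfSuperAlgType")]
HB.structure Definition ComHopfSuperAlgebra (K : fieldType) :=
  {A of HopfSuperAlgebra K A & isSuperCommutative K A}.

(** * The ideal generated by the odd component, and its quotient *)

Section OddIdeal.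
Variables (K : fieldType) (A : superAlgType K).

Definition odd_ideal : {pred A} :=
  [pred x : A | `[< exists2 s : seq (A * A * A),
      forall t, t \in s -> t.1.2 \in deg true
      & x = \sum_(t <- s) t.1.1 * t.1.2 * t.2 >]].

Lemma odd_idealP x : reflect
  (exists2 s : seq (A * A * A), forall t, t \in s -> t.1.2 \in deg true
    & x = \sum_(t <- s) t.1.1 * t.1.2 * t.2) (x \in odd_ideal).
Proof. exact: asboolP. Qed.

Lemma odd_ideal_deg a : a \in deg true -> a \in odd_ideal.
Proof.
move=> a1; apply/odd_idealP; exists [:: (1, a, 1)].
  by move=> t; rewrite inE => /eqP ->.
by rewrite big_seq1 mul1r mulr1.
Qed.

Lemma odd_idealMl a x : x \in odd_ideal -> a * x \in odd_ideal.
Proof.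
case/odd_idealP=> s sP ->; apply/odd_idealP.
exists [seq (a * t.1.1, t.1.2, t.2) | t <- s] => [_ /mapP[t ts ->]|].
  exact: (sP t ts).
by rewrite big_map mulr_sumr; apply: eq_bigr => t _; rewrite !mulrA.
Qed.

Lemma odd_idealMr a x : x \in odd_ideal -> x * a \in odd_ideal.
Proof.
case/odd_idealP=> s sP ->; apply/odd_idealP.
exists [seq (t.1.1, t.1.2, t.2 * a) | t <- s] => [_ /mapP[t ts ->]|].
  exact: (sP t ts).
by rewrite big_map mulr_suml; apply: eq_bigr => t _; rewrite !mulrA.
Qed.

Lemma odd_ideal_zmod : zmod_closed odd_ideal.
Proof.
split=> [|x y xI yI].
  by apply/odd_idealP; exists [::] => //; rewrite big_nil.
have := odd_idealMl (-1) yI; rewrite mulN1r.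
case/odd_idealP: xI => s sP -> /odd_idealP[t tP ->].
apply/odd_idealP; exists (s ++ t); last by rewrite big_cat.
by move=> z; rewrite mem_cat => /orP[/sP|/tP].
Qed.

Lemma odd_ideal_min (I : {pred A}) : zmod_closed I ->
    (forall a b x, x \in I -> a * x * b \in I) -> {subset deg true <= I} ->
  {subset odd_ideal <= I}.
Proof.
move=> [I0 IB] IM I1 _ /odd_idealP[s sP ->].
have ID x y : x \in I -> y \in I -> x + y \in I.
  by move=> xI yI; rewrite -[y]opprK IB // -sub0r IB.
rewrite big_seq; apply: (big_ind (fun x => x \in I)) => // t ts.
by apply/IM/I1/sP.
Qed.

HB.instance Definition _ := GRing.isZmodClosed.Build A odd_ideal odd_ideal_zmod.

End OddIdeal.

Arguments odd_ideal {K} A _.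

Section HopfOddIdeal.
Variables (K : fieldType) (A : hopfSuperAlgType K).

Lemma odd_ideal1 : 1 \notin odd_ideal A.
Proof.
apply/odd_idealP => -[s sP /(congr1 (counit hopf))] /eqP.
rewrite rmorph1 rmorph_sum big_seq big1 ?oner_eq0 // => t ts /=.
have e : counit hopf t.1.2 = 0 by apply/counit_odd/(sP t ts).
by rewrite !rmorphM /= e mulr0 mul0r.
Qed.

HB.instance Definition _ := isTwoSidedIdeal.Build A (odd_ideal A)
  odd_ideal1 (@odd_idealMl K A) (@odd_idealMr K A).

End HopfOddIdeal.

Section BosonicQuotient.
Variables (K : fieldType) (A : comHopfSuperAlgType K).

Definition bosonic : Type := algquot (odd_ideal A).

HB.instance Definition _ := GRing.Algebra.on bosonic.

Lemma bosonic_mulC : commutative (@GRing.mul bosonic).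
Proof.
move=> x y; case: (algproj_surj x) (algproj_surj y) => a <- [b <-].
have even (c : A) : exists2 c', c' \in deg false &
    algproj (odd_ideal A) c' = algproj (odd_ideal A) c.
  exists (component false c); first exact: component_deg.
  apply/algproj_eq; rewrite {2}[c]componentD opprD addrA subrr sub0r rpredN.
  exact/odd_ideal_deg/component_deg.
have [a' a0 <-] := even a; have [b' b0 <-] := even b.
rewrite /GRing.mul /= !aq_mulE; congr algproj.
by rewrite (supermulC _ _ _ _ a0 b0) mul1r.
Qed.

HB.instance Definition _ :=
  GRing.PzRing_hasCommutativeMul.Build bosonic bosonic_mulC.

End BosonicQuotient.

(** * Smoothness *)

Definition super_smooth (K : fieldType) (A : comSuperAlgType K) : Prop :=
  forall (B : comSuperAlgType K) (J : superideal B), nilpotent J ->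
  forall f : {lrmorphism A -> algquot J}, even_map f ->
  exists2 g : {lrmorphism A -> B}, even_map g & forall a, algproj J (g a) = f a.

Definition smooth (K : fieldType) (R : comAlgType K) : Prop :=
  forall (B : comAlgType K) (J : tsideal B), nilpotent J ->
  forall f : {lrmorphism R -> algquot J},
  exists g : {lrmorphism R -> B}, forall x, algproj J (g x) = f x.

Definition finitely_generated (K : fieldType) (R : comAlgType K) : Prop :=
  exists s : seq R, forall S : {pred R},
    subalg_closed S -> {subset s <= S} -> forall x, x \in S.

(* Main.v *)
Require Import Defs.
From HB Require Import structures.
From mathcomp Require Import all_boot all_algebra.
From mathcomp Require Import boolp classical_sets.

(** Write A^+ for the augmentation ideal of A, and call a surjection p : E -> A
a trivial extension when ker p is annihilated by p^-1(A^+).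

Smoothness of A is a property at the unit point: it holds as soon as ker p meets
the square of p^-1(A^+) trivially for every trivial extension p.  Given a linear
lift g of f : A -> C along a square-zero extension B -> C, the failure of g to be
multiplicative, twisted by the antipode, is a cocycle on which A acts through
the counit.  It is the cocycle of a trivial extension, hence a coboundary, and
convolution with g turns the cochain into a correction of g.

Now let u in ker p be a sum of products of two elements of p^-1(A^+).  By the
finiteness of subcoalgebras, finitely many homogeneous letters in p^-1(A^+)
span a subalgebra of E that contains these elements and whose image in A is
stable enough for left invariant derivations; these lift to derivations of the
subalgebra that kill ker p.  In characteristic 0 a lift of the Euler derivation
shows that if u is a combination of words of length n >= 2, it is one of words
of length n + 1.  In characteristic not 2 the lifts of x d/dx, for odd
coordinates x, show the same for combinations of words with an odd letter, and
smoothness of A/(A_1) brings u into the ideal generated by the odd elements by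
splitting E/(E_1) -> A/(A_1).  In both cases u = 0 by Krull's intersection
theorem, the even letters being central and annihilating u. *)

Set Implicit Arguments.
Unset Strict Implicit.
Unset Printing Implicit Defensive.

Import GRing.Theory.
Local Open Scope ring_scope.

(** * Linear algebra over a field *)

(** [A] need not be finitely generated, so neither A^+ nor the kernel of an extension can be treated
    as a finite module. Smoothness at the unit is therefore phrased for single sums of products:
    each involves finitely many elements of E, and these are within reach of Noetherian arguments.

    The twist by the antipode moves the problem to the unit point. The kernel of a square-zero
    extension carries an action of A through f, about which nothing is known; after the twist the
    coefficients are trivial, and a cocycle with trivial coefficients is an algebra structure on A ×
    B.

    In a trivial extension an element of ker p times one of p^-1(A^+) vanishes. Hence a derivation
    at the unit of A lifts to the subalgebra by means of any suitable linear section: the failure of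
    the section to be multiplicative is annihilated. The lifts factor through p and so kill u, while
    on words of length n they are close to a known operator; comparing the two raises n. The
    comparison starts at n = 2, because an error term in ker p disappears only next to another
    letter. *)

Section Subspaces.
Variables (K : fieldType) (V : lmodType K).
Implicit Types (U T : V -> Prop).

Definition subspace U :=
  U 0 /\ forall k x y, U x -> U y -> U (k *: x + y).

Lemma subspaceD U x y : subspace U -> U x -> U y -> U (x + y).
Proof. by move=> [_ h] Ux Uy; rewrite -[x]scale1r; apply: h. Qed.

Lemma subspaceZ U k x : subspace U -> U x -> U (k *: x).
Proof. by move=> [U0 h] Ux; rewrite -[_ *: _]addr0; apply: h. Qed.

Lemma subspaceN U x : subspace U -> U x -> U (- x).
Proof. by move=> sU Ux; rewrite -scaleN1r; apply: subspaceZ. Qed.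

Lemma subspaceB U x y : subspace U -> U x -> U y -> U (x - y).
Proof. by move=> sU Ux Uy; apply: subspaceD => //; apply: subspaceN. Qed.

Lemma subspace_sum U (I : eqType) (r : seq I) (F : I -> V) :
  subspace U -> (forall i, i \in r -> U (F i)) -> U (\sum_(i <- r) F i).
Proof.
move=> sU h; rewrite big_seq; elim/big_ind: _ => //; first by case: sU.
by move=> x y; apply: subspaceD.
Qed.

Definition projects_onto (pi : V -> V) U T :=
  [/\ forall x, T (pi x), forall x, T x -> pi x = x & forall x, U x -> pi x = 0].

(** Zorn's lemma gives a subspace [C] that contains [U] and is maximal among those meeting [T] only
    in 0. It is a complement of [T], and the projection is taken along it. *)
Lemma exists_projection U T : subspace U -> subspace T ->
    (forall x, U x -> T x -> x = 0) ->
  exists pi : {linear V -> V}, projects_onto pi U T.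
Proof.
move=> sU sT UT.
pose good C := [/\ subspace C, forall x, U x -> C x &
                forall x, C x -> T x -> x = 0].
pose R (C D : {C : V -> Prop | good C}) : bool :=
  `[< forall x, sval C x -> sval D x >].
have gU : good U by split.
have [| | |[C [sC UC CT]] maxC] := @ZL_preorder _ (exist _ U gU) R.
- by move=> C; apply/asboolP.
- by move=> C D E /asboolP CD /asboolP DE; apply/asboolP => x /CD/DE.
- move=> F totF.
  have [[C0 FC0]|F0] := pselect (exists C, F C); last first.
    by exists (exist _ U gU) => C FC; case: F0; exists C.
  pose D x := exists2 C, F C & sval C x.
  have gD : good D; last first.
    by exists (exist _ D gD) => C FC; apply/asboolP => x Cx; exists C.
  split.
  + split; first by exists C0 => //; case: C0 {FC0} => C0 [] [].
    move=> k x y [C FC Cx] [E FE Ey].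
    have [/asboolP CE|/asboolP EC] := totF _ _ FC FE.
      exists E => //; case: E {FE} CE Ey => E [[_ h] ? ?] /= CE Ey.
      by apply: h => //; apply: CE.
    exists C => //; case: C {FC} EC Cx => C [[_ h] ? ?] /= EC Cx.
    by apply: h => //; apply: EC.
  + by move=> x Ux; exists C0 => //; case: C0 {FC0} => C0 [? h ?]; apply: h.
  + by move=> x [C _]; case: C => C [? ? h] /=; apply: h.
have [C0 CL] := sC.
have UsubC x : U x -> C x := UC x.
have disj x : C x -> T x -> x = 0 := CT x.
have dec x : exists t, T t /\ C (x - t).
  have [//|ndec] := pselect (exists t, T t /\ C (x - t)).
  (* [D'] is C + Kx. It still meets [T] trivially: a nonzero multiple of x in C + T would put x
     itself there. *)
  pose D' y := exists k, C (y - k *: x).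
  have gD : good D'.
    split.
    - split; first by exists 0; rewrite scale0r subr0; exact: C0.
      move=> k y z [a Ca] [b Cb]; exists (k * a + b).
      rewrite scalerDl -scalerA opprD addrACA -scalerBr.
      exact: CL.
    - by move=> y Uy; exists 0; rewrite scale0r subr0; exact: UsubC.
    - move=> y [k Ck] Ty; have [k0|k0] := eqVneq k 0.
        by apply: disj => //; move: Ck; rewrite k0 scale0r subr0.
      case: ndec; exists (k^-1 *: y); split; first exact: subspaceZ.
      rewrite -[x in x - _](scalerK k0) -scalerBr; apply: subspaceZ => //.
      by rewrite -opprB; apply: subspaceN.
  exists 0; split; first by case: sT.
  have /maxC/asboolP : R (exist _ C (And3 sC UC CT)) (exist _ D' gD).
    by apply/asboolP => y /= Cy; exists 0; rewrite scale0r subr0.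
  rewrite subr0; apply => /=.
  by exists 1; rewrite scale1r subrr; exact: C0.
pose f x := sval (cid (dec x)).
have fT x : T (f x) by rewrite /f; case: cid => t [].
have fC x : C (x - f x) by rewrite /f; case: cid => t [].
have fu x t : T t -> C (x - t) -> f x = t.
  move=> Tt Ct; apply/eqP; rewrite -subr_eq0; apply/eqP/CT; last exact: subspaceB.
  have -> : f x - t = (x - t) - (x - f x) by rewrite opprB [RHS]addrC addrA subrK.
  exact: subspaceB.
have flin : linear f.
  move=> k x y; apply: fu; first by case: sT => _; apply.
  by rewrite opprD addrACA -scalerBr; exact: CL.
pose fl : {linear V -> V} :=
  HB.pack f (GRing.isLinear.Build K V V *:%R f flin).
exists fl; split=> //= x.
  by move=> Tx; apply: fu; rewrite // subrr; exact: C0.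
by move=> Ux; apply: fu; [case: sT|rewrite subr0; apply: UsubC].
Qed.

Lemma subspace0 : subspace (fun x : V => x = 0).
Proof. by split=> // k x y -> ->; rewrite scaler0 addr0. Qed.

Lemma exists_functional U (v : V) : subspace U -> ~ U v ->
  exists2 phi : {linear V -> K^o}, phi v = 1 & forall u, U u -> phi u = 0.
Proof.
move=> sU Uv; have v0 : v != 0 by apply: contra_notN Uv => /eqP ->; case: sU.
have [||pi [piT pi1 pi0]] := @exists_projection U (fun x => exists k, x = k *: v) sU.
- split; first by exists 0; rewrite scale0r.
  by move=> k _ _ [a ->] [b ->]; exists (k * a + b); rewrite scalerDl scalerA.
- move=> x Ux [k def_x]; move: Ux; rewrite {}def_x => Ux.
  have [->|k0] := eqVneq k 0; first by rewrite scale0r.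
  by case: Uv; rewrite -(scalerK k0 v); apply: subspaceZ.
have inj a b : a *: v = b *: v -> a = b.
  move/eqP; rewrite -subr_eq0 -scalerBl scaler_eq0 (negPf v0) orbF subr_eq0.
  by move/eqP.
pose phi x : K^o := sval (cid (piT x)).
have phiE x : pi x = phi x *: v by rewrite /phi; case: cid.
have phi_lin : linear phi.
  by move=> k x y; apply: inj; rewrite -phiE linearP !phiE scalerDl scalerA.
exists (HB.pack phi (GRing.isLinear.Build K V K^o *:%R phi phi_lin) :
          {linear V -> K^o}) => /=.
  by apply: inj; rewrite -phiE scale1r pi1 //; exists 1; rewrite scale1r.
by move=> u Uu; apply: inj; rewrite -phiE scale0r pi0.
Qed.

End Subspaces.

Lemma subspace_ker (K : fieldType) (V W : lmodType K) (f : {linear V -> W}) :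
  subspace (fun x => f x = 0).
Proof.
by split=> [|k x y fx fy]; rewrite ?linear0 // linearP fx fy scaler0 addr0.
Qed.

Lemma subspace_preim (K : fieldType) (V W : lmodType K) (f : {linear V -> W})
  (U : W -> Prop) : subspace U -> subspace (fun x => U (f x)).
Proof.
by move=> [U0 UL]; split=> [|k x y fx fy]; rewrite ?linear0 // linearP; apply: UL.
Qed.

Lemma subspace_im (K : fieldType) (V W : lmodType K) (f : {linear V -> W})
  (U : V -> Prop) : subspace U -> subspace (fun y => exists2 x, U x & f x = y).
Proof.
move=> [U0 UL]; split=> [|k _ _ [x Ux <-] [y Uy <-]].
  by exists 0; rewrite ?linear0.
by exists (k *: x + y); rewrite ?linearP //; apply: UL.
Qed.

Lemma subspaceI (K : fieldType) (V : lmodType K) (U T : V -> Prop) :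
  subspace U -> subspace T -> subspace (fun x => U x /\ T x).
Proof. by move=> [U0 UL] [T0 TL]; split=> // k x y [? ?] [? ?]; split; auto. Qed.

(** A section of [f] restricted to [U], extended to [W] through a projection onto f(U). Two
    preimages in [U] of the same element differ by an element of the intersection of [U] and ker f;
    with [pi] a projection onto that intersection, v - pi v does not depend on the chosen preimage v
    and is therefore linear. *)
Lemma exists_linear_section (K : fieldType) (V W : lmodType K)
    (f : {linear V -> W}) (U : V -> Prop) : subspace U ->
  exists s : {linear W -> V}, (forall w, U (s w)) /\
    (forall u, U u -> f (s (f u)) = f u).
Proof.
move=> sU; pose F y := exists2 x, U x & f x = y.
have [||rho [rhoF rho1 _]] := @exists_projection K W _ F (subspace0 W).
- exact: subspace_im.
- by move=> _ ->.
have [||pi [piT pi1 _]] := @exists_projection K V _ (fun x => U x /\ f x = 0)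
    (subspace0 V).
- exact/subspaceI/subspace_ker.
- by move=> _ ->.
have g w : exists v, U v /\ f v = rho w.
  by have [v Uv fv] := rhoF w; exists v.
pose s w := let v := sval (cid (g w)) in v - pi v.
have sP w v : U v -> f v = rho w -> s w = v - pi v.
  rewrite /s; case: cid => v' [Uv' fv'] /= Uv fv.
  have : pi (v - v') = v - v'.
    by apply: pi1; split; [exact: subspaceB|rewrite linearB fv fv' subrr].
  rewrite linearB => /(canRL (subrK _)) ->.
  by rewrite opprD opprB addrA [v + _]addrC subrK.
have slin : linear s.
  move=> k x y; have [a [Ua fa]] := g x; have [b [Ub fb]] := g y.
  rewrite (sP _ _ Ua fa) (sP _ _ Ub fb) (sP _ (k *: a + b)).
  - by rewrite linearP opprD addrACA scalerBr.
  - by case: sU => _; apply.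
  - by rewrite !linearP fa fb.
exists (HB.pack s (GRing.isLinear.Build K W V *:%R s slin) : {linear W -> V}).
split=> /= w => [|Uw].
  have [v [Uv fv]] := g w; rewrite (sP _ _ Uv fv); apply: subspaceB => //.
  by case: (piT v).
rewrite (sP _ w) //; first by rewrite linearB (piT w).2 subr0.
by rewrite rho1 //; exists w.
Qed.

(** * Tensor products of superalgebras *)

Lemma sign_mulE (K : fieldType) (R : algType K) b (x : R) :
  (-1) ^+ b * x = (-1) ^+ b *: x.
Proof. by rewrite -(rmorph_sign (in_alg R)) mulr_algl. Qed.

Section TensorTheory.
Variables (K : fieldType) (U V : lmodType K).
Implicit Types (u : U) (v : V).

Lemma tens_is_linearl v : linear (fun u => u ⊗ v).
Proof. by move=> k x y; have /(_ v k x y) := (@tens_bilinear K U V).1. Qed.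

Lemma tens_is_linearr u : linear (fun v => u ⊗ v).
Proof. by move=> k x y; have /(_ u k x y) := (@tens_bilinear K U V).2. Qed.

Definition tensl v : U -> U ⊗ V := fun u => u ⊗ v.
Definition tensr u : V -> U ⊗ V := fun v => u ⊗ v.

HB.instance Definition _ v :=
  GRing.isLinear.Build K U (U ⊗ V)%type *:%R (tensl v) (tens_is_linearl v).
HB.instance Definition _ u :=
  GRing.isLinear.Build K V (U ⊗ V)%type *:%R (tensr u) (tens_is_linearr u).

Lemma tensDl u u' v : (u + u') ⊗ v = u ⊗ v + u' ⊗ v.
Proof. exact: (linearD (tensl v)). Qed.
Lemma tensDr u v v' : u ⊗ (v + v') = u ⊗ v + u ⊗ v'.
Proof. exact: (linearD (tensr u)). Qed.
Lemma tensBr u v v' : u ⊗ (v - v') = u ⊗ v - u ⊗ v'.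
Proof. exact: (linearB (tensr u)). Qed.
Lemma tens0l v : (0 : U) ⊗ v = 0.
Proof. exact: (linear0 (tensl v)). Qed.
Lemma tens0r u : u ⊗ (0 : V) = 0.
Proof. exact: (linear0 (tensr u)). Qed.
Lemma tensZl k u v : (k *: u) ⊗ v = k *: (u ⊗ v).
Proof. exact: (linearZ_LR (tensl v)). Qed.
Lemma tensZr k u v : u ⊗ (k *: v) = k *: (u ⊗ v).
Proof. exact: (linearZ_LR (tensr u)). Qed.
Lemma tens_suml I (r : seq I) (F : I -> U) v :
  (\sum_(i <- r) F i) ⊗ v = \sum_(i <- r) F i ⊗ v.
Proof. exact: (linear_sum (tensl v)). Qed.
Lemma tens_sumr I (r : seq I) u (F : I -> V) :
  u ⊗ (\sum_(i <- r) F i) = \sum_(i <- r) u ⊗ F i.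
Proof. exact: (linear_sum (tensr u)). Qed.

Lemma tens_ind (P : U ⊗ V -> Prop) :
  P 0 -> (forall x y, P x -> P y -> P (x + y)) -> (forall u v, P (u ⊗ v)) ->
  forall t, P t.
Proof.
by move=> P0 PD Pt t; have [s ->] := tens_span t; elim/big_ind: _.
Qed.

End TensorTheory.

Section LinearTmap.
Variables (K : fieldType) (U V U' V' : lmodType K).
Variables (f : {linear U -> U'}) (g : {linear V -> V'}).

Lemma tmap_is_linear : linear (tmap f g).
Proof.
apply: tlift_linear; split=> [v k x y|u k x y] /=; rewrite linearP.
  by rewrite tensDl tensZl.
by rewrite tensDr tensZr.
Qed.

HB.instance Definition _ := GRing.isLinear.Build K (U ⊗ V)%type (U' ⊗ V')%type
  *:%R (tmap f g) tmap_is_linear.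

End LinearTmap.

Section TensorPairing.
Variables (K : fieldType) (U V : lmodType K) (R : algType K).
Variables (f : {linear U -> R}) (g : {linear V -> R}).

Definition tpair : U ⊗ V -> R := tlift (fun u v => f u * g v).

Lemma tpair_bilinear : bilinear_for *:%R *:%R (fun u v => f u * g v).
Proof.
split=> [v k x y|u k x y] /=; rewrite linearP.
  by rewrite mulrDl scalerAl.
by rewrite mulrDr scalerAr.
Qed.

Lemma tpair_is_linear : linear tpair.
Proof. exact: tlift_linear tpair_bilinear. Qed.

HB.instance Definition _ := GRing.isLinear.Build K (U ⊗ V)%type R
  *:%R tpair tpair_is_linear.

Lemma tpair_tens u v : tpair (u ⊗ v) = f u * g v.
Proof. exact: tlift_tens tpair_bilinear _ _. Qed.

End TensorPairing.

Section Homogeneous.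
Variables (K : fieldType) (A B : superAlgType K).

Lemma super_ind (P : A -> Prop) : (forall x y, P x -> P y -> P (x + y)) ->
  (forall i x, x \in deg i -> P x) -> forall x, P x.
Proof.
move=> PD Ph x; rewrite [x]componentD; apply: PD; apply: Ph; exact: component_deg.
Qed.

Lemma tens_super_ind (P : A ⊗ B -> Prop) :
  P 0 -> (forall x y, P x -> P y -> P (x + y)) ->
  (forall i j a b, a \in deg i -> b \in deg j -> P (a ⊗ b)) ->
  forall t, P t.
Proof.
move=> P0 PD Pt; apply: tens_ind => // u v.
rewrite [u]componentD [v]componentD !(tensDl, tensDr).
have h i j : P (component i u ⊗ component j v) by apply: (Pt i j); apply: component_deg.
by apply: (PD); apply: (PD).
Qed.

Definition homogeneous (x : A) := exists i, x \in deg i.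

Definition all_homogeneous (l : seq A) := forall x, x \in l -> homogeneous x.

End Homogeneous.

Section SuperTensorAlgebra.
Variables (K : fieldType) (A B : superAlgType K).
Local Notation T := (A ⊗ B)%type.
Implicit Types (x y z : T).

Let sgnD (F G : bool -> bool -> T) k :
  \sum_i \sum_j (-1) ^+ (i && j) *: (k *: F i j + G i j) =
    k *: (\sum_i \sum_j (-1) ^+ (i && j) *: F i j) +
    \sum_i \sum_j (-1) ^+ (i && j) *: G i j.
Proof.
rewrite scaler_sumr -big_split; apply: eq_bigr => p _.
rewrite scaler_sumr -big_split; apply: eq_bigr => q _.
by rewrite scalerDr !scalerA mulrC.
Qed.

Let tmul_bil y : bilinear_for *:%R *:%R (fun a b => tlift (fun c d =>
    \sum_(i : bool) \sum_(j : bool)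
      (-1) ^+ (i && j) *: ((a * component j c) ⊗ (component i b * d))) y).
Proof.
split=> [z k a b|z k a b] /=; rewrite -tlift_lincomb; apply: eq_tlift => u v;
    rewrite -sgnD; apply: eq_bigr => p _; apply: eq_bigr => q _; congr (_ *: _).
  by rewrite mulrDl -scalerAl tensDl tensZl.
by rewrite linearP mulrDl -scalerAl tensDr tensZr.
Qed.

Let tmul_bilr a b : bilinear_for *:%R *:%R (fun (c : A) (d : B) =>
    \sum_(i : bool) \sum_(j : bool)
      (-1) ^+ (i && j) *: ((a * component j c) ⊗ (component i b * d))).
Proof.
split=> [z k c d|z k c d] /=;
    rewrite -sgnD; apply: eq_bigr => p _; apply: eq_bigr => q _; congr (_ *: _).
  by rewrite linearP mulrDr -scalerAr tensDl tensZl.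
by rewrite mulrDr -scalerAr tensDr tensZr.
Qed.

Lemma tmul_is_linearl y : linear ((@tmul K A B)^~ y).
Proof. exact: tlift_linear. Qed.

Lemma tmul_is_linearr x : linear (@tmul K A B x).
Proof.
move=> k y z; rewrite /tmul -tlift_lincomb; apply: eq_tlift => a b.
exact: tlift_linear.
Qed.

Let tmul_l y : {linear T -> T} := HB.pack ((@tmul K A B)^~ y)
  (GRing.isLinear.Build K T T *:%R _ (tmul_is_linearl y)).
Let tmul_r x : {linear T -> T} := HB.pack (@tmul K A B x)
  (GRing.isLinear.Build K T T *:%R _ (tmul_is_linearr x)).

Lemma tmulDl : left_distributive (@tmul K A B) +%R.
Proof. by move=> x y z; apply: (linearD (tmul_l z)). Qed.
Lemma tmulDr : right_distributive (@tmul K A B) +%R.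
Proof. by move=> x y z; apply: (linearD (tmul_r x)). Qed.
Lemma tmul0l y : tmul 0 y = 0. Proof. exact: (linear0 (tmul_l y)). Qed.
Lemma tmul0r x : tmul x 0 = 0. Proof. exact: (linear0 (tmul_r x)). Qed.
Lemma tmulZl k x y : tmul (k *: x) y = k *: tmul x y.
Proof. exact: (linearZ_LR (tmul_l y)). Qed.
Lemma tmulZr k x y : tmul x (k *: y) = k *: tmul x y.
Proof. exact: (linearZ_LR (tmul_r x)). Qed.

Lemma tmulA : associative (@tmul K A B).
Proof.
move=> x y z; move: x.
apply: tens_super_ind => [|x x' hx hx'|i j a b ai bj].
- by rewrite !tmul0l.
- by rewrite !tmulDl hx hx'.
move: y; apply: tens_super_ind => [|x x' hx hx'|i' j' a' b' ai' bj'].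
- by rewrite ?(tmul0l, tmul0r).
- by rewrite !(tmulDl, tmulDr) hx hx'.
move: z; apply: tens_super_ind => [|x x' hx hx'|i2 j2 a2 b2 ai2 bj2].
- by rewrite ?(tmul0l, tmul0r).
- by rewrite !(tmulDl, tmulDr) hx hx'.
rewrite (tmul_tens _ _ bj' ai2) (tmul_tens _ _ bj ai') tmulZl tmulZr.
rewrite (tmul_tens _ _ bj (deg_M _ _ _ _ ai' ai2)).
rewrite (tmul_tens _ _ (deg_M _ _ _ _ bj bj') ai2).
rewrite !scalerA -!signr_addb !mulrA; congr (_ *: _); congr (_ ^+ _).
by case: j j' i' i2 {bj bj' ai' ai2} => [] [] [] [].
Qed.

Lemma tmul1 : left_id (1 ⊗ 1) (@tmul K A B).
Proof.
apply: tens_super_ind => [|x x' hx hx'|i j a b ai bj]; first exact: tmul0r.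
  by rewrite tmulDr hx hx'.
by rewrite (tmul_tens _ _ deg_1 ai) scale1r !mul1r.
Qed.

Lemma tmulr1 : right_id (1 ⊗ 1) (@tmul K A B).
Proof.
apply: tens_super_ind => [|x x' hx hx'|i j a b ai bj]; first exact: tmul0l.
  by rewrite tmulDl hx hx'.
by rewrite (tmul_tens _ _ bj deg_1) andbF scale1r !mulr1.
Qed.

(** Two functionals with value 1 at 1 pair to a functional with value 1 at 1 ⊗ 1. *)
Lemma tens1_neq0 : (1 : A) ⊗ (1 : B) != 0.
Proof.
have neq0 (R : superAlgType K) : ~ (1 : R) = 0.
  by apply/eqP; apply: oner_neq0.
have [f f1 _] := exists_functional (subspace0 A) (neq0 A).
have [g g1 _] := exists_functional (subspace0 B) (neq0 B).
apply/eqP => /(congr1 (tpair f g)); rewrite tpair_tens f1 g1 linear0 mulr1.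
by apply/eqP; apply: oner_neq0.
Qed.

(* Locked, as unification would otherwise see sums inside of products. *)
Definition stmul : T -> T -> T := locked (@tmul K A B).

Lemma stmulE : stmul = @tmul K A B. Proof. by rewrite /stmul -lock. Qed.

Lemma stmulA : associative stmul. Proof. rewrite stmulE; exact: tmulA. Qed.
Lemma stmul1 : left_id (1 ⊗ 1) stmul. Proof. rewrite stmulE; exact: tmul1. Qed.
Lemma stmulr1 : right_id (1 ⊗ 1) stmul.
Proof. rewrite stmulE; exact: tmulr1. Qed.
Lemma stmulDl : left_distributive stmul +%R.
Proof. rewrite stmulE; exact: tmulDl. Qed.
Lemma stmulDr : right_distributive stmul +%R.
Proof. rewrite stmulE; exact: tmulDr. Qed.

HB.instance Definition _ := GRing.Zmodule_isNzRing.Build T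
  stmulA stmul1 stmulr1 stmulDl stmulDr tens1_neq0.

Lemma tens_mulE x y : x * y = tmul x y.
Proof. by rewrite /GRing.mul /= stmulE. Qed.

Lemma tens_scalerAl k x y : k *: (x * y) = (k *: x) * y.
Proof. by rewrite !tens_mulE tmulZl. Qed.
Lemma tens_scalerAr k x y : k *: (x * y) = x * (k *: y).
Proof. by rewrite !tens_mulE tmulZr. Qed.

HB.instance Definition _ := GRing.Lmodule_isLalgebra.Build K T tens_scalerAl.
HB.instance Definition _ := GRing.Lalgebra_isAlgebra.Build K T tens_scalerAr.

Lemma tens_one : (1 : T) = 1 ⊗ 1. Proof. by []. Qed.
Lemma tens_mul i j (a c : A) (b d : B) : b \in deg i -> c \in deg j ->
  (a ⊗ b) * (c ⊗ d) = (-1) ^+ (i && j) *: ((a * c) ⊗ (b * d)).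
Proof. by rewrite tens_mulE; exact: tmul_tens. Qed.

End SuperTensorAlgebra.

Section SuperTensorGrading.
Variables (K : fieldType) (A B : superAlgType K).
Local Notation T := (A ⊗ B)%type.
Implicit Types (x y z t : T).

(** The projection onto total degree k: the second factor has degree k next to an even first factor
    and k + 1 next to an odd one. *)
Definition tcomp (k : bool) t : T :=
  tmap (@component K A false) (@component K B k) t +
  tmap (@component K A true) (@component K B (~~ k)) t.

Lemma tcomp_is_linear k : linear (tcomp k).
Proof. by move=> a x y; rewrite /tcomp !linearP scalerDr addrACA. Qed.

HB.instance Definition _ k :=
  GRing.isLinear.Build K T T *:%R (tcomp k) (tcomp_is_linear k).

Lemma tcomp_tens k i j (a : A) (b : B) : a \in deg i -> b \in deg j ->
  tcomp k (a ⊗ b) = if k == i (+) j then a ⊗ b else 0.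
Proof.
move=> ai bj; rewrite /tcomp !tmap_tens /= !(component_id _ ai) !(component_id _ bj).
by case: k i j {ai bj} => [] [] []; rewrite /= ?(tens0l, tens0r) ?(addr0, add0r).
Qed.

Lemma tdegD k x y : tdeg k x -> tdeg k y -> tdeg k (x + y).
Proof.
move=> [s sP ->] [s' sP' ->]; exists (s ++ s'); last by rewrite big_cat.
by move=> p; rewrite mem_cat => /orP[/sP|/sP'].
Qed.

Lemma tdeg_tens i k (a : A) (b : B) :
  a \in deg i -> b \in deg (i (+) k) -> tdeg k (a ⊗ b).
Proof.
move=> ai bj; exists [:: (a, b)]; last by rewrite big_seq1.
by move=> p; rewrite inE => /eqP ->; exists i.
Qed.

Lemma tcomp_tdeg k t : tdeg k (tcomp k t).
Proof.
move: t; apply: tens_ind => [|x y hx hy|u v].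
- by rewrite linear0; exists [::]; rewrite // big_nil.
- by rewrite linearD; apply: tdegD.
by rewrite /tcomp !tmap_tens /=; apply: tdegD;
  [apply: (@tdeg_tens false)|apply: (@tdeg_tens true)]; exact: component_deg.
Qed.

Lemma tdegP k t : tdeg k t <-> tcomp k t = t.
Proof.
split=> [[s sP ->]|<-]; last exact: tcomp_tdeg.
rewrite linear_sum big_seq [RHS]big_seq; apply: eq_bigr => p /sP[i [pi pk]].
by rewrite /= (tcomp_tens _ pi pk) addKb eqxx.
Qed.

Lemma tcompD t : t = tcomp false t + tcomp true t.
Proof.
move: t; apply: tens_super_ind => [|x y hx hy|i j a b ai bj].
- by rewrite !linear0 addr0.
- by rewrite !linearD /= addrACA -hx -hy.
by rewrite !(tcomp_tens _ ai bj); case: (_ (+) _); rewrite /= ?addr0 ?add0r.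
Qed.

Lemma tcomp_id k l t : tcomp k (tcomp l t) = if k == l then tcomp l t else 0.
Proof.
move: t; apply: tens_super_ind => [|x y hx hy|i j a b ai bj].
- by rewrite !linear0 if_same.
- by rewrite !(linearD (tcomp l) x y) (linearD (tcomp k)) /= hx hy; case: ifP; rewrite ?addr0.
rewrite (tcomp_tens _ ai bj); have [->|ne] := eqVneq l.
  by rewrite (tcomp_tens _ ai bj).
by rewrite linear0 if_same.
Qed.

(** A boolean form of [tdeg], which asserts the existence of a decomposition. *)
Definition tens_deg i : {pred T} := [pred t : T | tcomp i t == t].

Lemma tens_degP i t : reflect (tdeg i t) (t \in tens_deg i).
Proof. by apply: (iffP eqP) => /tdegP. Qed.

Lemma tens_deg_submod i : submod_closed (tens_deg i).
Proof.
split=> [|k x y /eqP hx /eqP hy]; first by rewrite inE linear0.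
by rewrite inE linearP /= hx hy.
Qed.

Lemma tens_deg_decomp t : exists x : T * T,
  [/\ x.1 \in tens_deg false, x.2 \in tens_deg true & t = x.1 + x.2].
Proof.
exists (tcomp false t, tcomp true t).
by split; rewrite /= ?inE ?tcomp_id //; apply: tcompD.
Qed.

Lemma tens_deg_disjoint t : t \in tens_deg false -> t \in tens_deg true -> t = 0.
Proof. by move=> /eqP e0 /eqP e1; rewrite -e1 -e0 tcomp_id. Qed.

Lemma tens_deg_1 : 1 \in tens_deg false.
Proof. by rewrite inE tens_one (tcomp_tens _ deg_1 deg_1). Qed.

Lemma tens_deg_M i j x y :
  x \in tens_deg i -> y \in tens_deg j -> x * y \in tens_deg (i (+) j).
Proof.
move=> /tens_degP[s sP ->] /tens_degP[s' sP' ->].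
have [t0 tD] := tens_deg_submod (i (+) j).
have tadd a b : a \in tens_deg (i (+) j) -> b \in tens_deg (i (+) j) ->
    a + b \in tens_deg (i (+) j).
  by move=> ha hb; rewrite -[a]scale1r; apply: tD.
rewrite mulr_suml big_seq; apply: (big_ind (fun z => z \in _)) => // p.
move=> /sP[k [p1 p2]].
rewrite mulr_sumr big_seq; apply: (big_ind (fun z => z \in _)) => // q.
move=> /sP'[l [q1 q2]].
rewrite (tens_mul _ _ p2 q1) -[_ *: _]addr0 tD // inE.
rewrite (tcomp_tens _ (deg_M _ _ _ _ p1 q1) (deg_M _ _ _ _ p2 q2)).
by case: i j k l {p1 p2 q1 q2 sP sP' t0 tD tadd} => [] [] [] [] /=; rewrite eqxx.
Qed.

HB.instance Definition _ := isSuperAlgebra.Build K T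
  tens_deg_submod tens_deg_decomp tens_deg_disjoint tens_deg_1 tens_deg_M.

Lemma tens_in_deg i j (a : A) (b : B) :
  a \in deg i -> b \in deg j -> a ⊗ b \in deg (i (+) j).
Proof. by move=> ai bj; apply/tens_degP/(tdeg_tens ai); rewrite addKb. Qed.

End SuperTensorGrading.

Section ComSuperTensor.
Variables (K : fieldType) (A B : comSuperAlgType K).
Local Notation T := (A ⊗ B)%type.

Lemma tens_supermulC i j (x y : T) : x \in deg i -> y \in deg j ->
  x * y = (-1) ^+ (i && j) * (y * x).
Proof.
move=> /tens_degP[s sP ->] /tens_degP[s' sP' ->].
rewrite !(mulr_suml, mulr_sumr).
under [RHS]eq_bigr => q _ do rewrite !mulr_sumr.
rewrite [RHS]exchange_big /=; under eq_bigr => p _ do rewrite mulr_sumr.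
rewrite big_seq [RHS]big_seq; apply: eq_bigr => p /sP[k [p1 p2]].
rewrite big_seq [RHS]big_seq; apply: eq_bigr => q /sP'[l [q1 q2]].
rewrite (tens_mul _ _ p2 q1) (tens_mul _ _ q2 p1).
rewrite (supermulC _ _ _ _ p1 q1) (supermulC _ _ _ _ p2 q2).
rewrite -!(rmorph_sign (in_alg _)) !mulr_algl tensZl tensZr !scalerA -!signr_addb.
congr (_ *: _); congr (_ ^+ _).
by case: i j k l {p1 p2 q1 q2 sP sP'} => [] [] [] [].
Qed.

HB.instance Definition _ := isSuperCommutative.Build K T tens_supermulC.

End ComSuperTensor.

Section TensorInjections.
Variables (K : fieldType) (A B : superAlgType K).
Local Notation T := (A ⊗ B)%type.

Definition tinl (a : A) : T := a ⊗ 1.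
Definition tinr (b : B) : T := 1 ⊗ b.

Lemma tens1_mul (a : A) (b : B) : (a ⊗ 1) * (1 ⊗ b) = a ⊗ b.
Proof. by rewrite (tens_mul _ _ deg_1 deg_1) scale1r mulr1 mul1r. Qed.

Lemma tinl_is_linear : linear tinl.
Proof. by move=> k x y; rewrite /tinl tensDl tensZl. Qed.
Lemma tinr_is_linear : linear tinr.
Proof. by move=> k x y; rewrite /tinr tensDr tensZr. Qed.

Lemma tinl_is_monoid_morphism : monoid_morphism tinl.
Proof.
split=> // x y; rewrite /tinl; move: y; apply: super_ind => [y y' hy hy'|i y yi].
  by rewrite mulrDr !tensDl mulrDr hy hy'.
by rewrite (tens_mul _ _ deg_1 yi) scale1r mulr1.
Qed.
Lemma tinr_is_monoid_morphism : monoid_morphism tinr.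
Proof.
split=> // x y; rewrite /tinr; move: x; apply: super_ind => [x x' hx hx'|i x xi].
  by rewrite mulrDl !tensDr mulrDl hx hx'.
by rewrite (tens_mul _ _ xi deg_1) andbF scale1r mulr1.
Qed.

HB.instance Definition _ := GRing.isLinear.Build K A T *:%R tinl tinl_is_linear.
HB.instance Definition _ :=
  GRing.isMonoidMorphism.Build A T tinl tinl_is_monoid_morphism.
HB.instance Definition _ := GRing.isLinear.Build K B T *:%R tinr tinr_is_linear.
HB.instance Definition _ :=
  GRing.isMonoidMorphism.Build B T tinr tinr_is_monoid_morphism.

Lemma tinl_even : even_map tinl.
Proof. by move=> i a ai; rewrite -[i]addbF; apply: tens_in_deg; rewrite ?deg_1. Qed.
Lemma tinr_even : even_map tinr.
Proof. by move=> i a ai; apply: (@tens_in_deg _ _ _ false); rewrite ?deg_1. Qed.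

End TensorInjections.

Section EvenMaps.
Variable K : fieldType.

Lemma even_map_component (A B : superAlgType K) (f : {additive A -> B}) :
  even_map f -> forall i a, f (component i a) = component i (f a).
Proof.
move=> fe i a; have [e0 e1] : component false (f a) = f (component false a) /\
    component true (f a) = f (component true a).
  apply: component_unique; last by rewrite -raddfD -componentD.
    exact/fe/component_deg.
  exact/fe/component_deg.
by case: i.
Qed.

(* Averaging over the grading turns a linear map into an even one. *)
Section Evening.
Variables (A B : superAlgType K) (f : {linear A -> B}).

Definition evening (a : A) : B :=
  component false (f (component false a)) + component true (f (component true a)).

Lemma evening_is_linear : linear evening.
Proof. by move=> k x y; rewrite /evening !linearP scalerDr addrACA. Qed.

HB.instance Definition _ :=
  GRing.isLinear.Build K A B *:%R evening evening_is_linear.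

Lemma evening_hom i a : a \in deg i -> evening a = component i (f a).
Proof.
move=> ai; rewrite /evening !(component_id _ ai).
by case: i {ai}; rewrite /= ?(linear0, add0r, addr0).
Qed.

Lemma evening_even : even_map evening.
Proof. by move=> i a ai; rewrite (evening_hom ai) component_deg. Qed.

End Evening.

Section PairingOfEvenMaps.
Variables (A B : superAlgType K) (R : comSuperAlgType K).

Lemma tmap_even (A' B' : superAlgType K) (f : {linear A -> A'})
  (g : {linear B -> B'}) : even_map f -> even_map g -> even_map (tmap f g).
Proof.
move=> fe ge i t /tens_degP[s sP ->]; rewrite linear_sum big_seq.
apply: rpred_sum => p /sP[j [p1 p2]].
rewrite /= tmap_tens -(addKb j i); apply: tens_in_deg; [exact: fe|exact: ge].
Qed.

Lemma tpair_even (f : {linear A -> R}) (g : {linear B -> R}) :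
  even_map f -> even_map g -> even_map (tpair f g).
Proof.
move=> fe ge i t /tens_degP[s sP ->]; rewrite linear_sum big_seq.
apply: rpred_sum => p /sP[j [p1 p2]].
rewrite /= tpair_tens -(addKb j i); apply: deg_M; [exact: fe|exact: ge].
Qed.

(** The sign in (a ⊗ b)(c ⊗ d) is the one by which g b and f c commute in [R], as both maps preserve
    degrees. *)
Lemma tpair_monoid_morphism (f : {lrmorphism A -> R}) (g : {lrmorphism B -> R}) :
  even_map f -> even_map g -> monoid_morphism (tpair f g).
Proof.
move=> fe ge; split; first by rewrite tens_one tpair_tens !rmorph1 mulr1.
apply: tens_super_ind => [y|x x' hx hx' y|i j a b ai bj].
- by rewrite mul0r linear0 mul0r.
- by rewrite mulrDl !linearD /= mulrDl hx hx'.
apply: tens_super_ind => [|x x' hx hx'|i' j' c d ci dj].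
- by rewrite mulr0 linear0 mulr0.
- by rewrite mulrDr !linearD /= mulrDr hx hx'.
rewrite (tens_mul _ _ bj ci) linearZ_LR /= !tpair_tens !rmorphM.
rewrite mulrA -[RHS]mulrA [g b * _]mulrA.
rewrite (supermulC _ _ _ _ (ge _ _ bj) (fe _ _ ci)).
by rewrite -!(rmorph_sign (in_alg _)) !mulr_algl -!scalerAl -!scalerAr !mulrA.
Qed.

End PairingOfEvenMaps.

Definition talg (A B : superAlgType K) (R : comSuperAlgType K)
  (f : {lrmorphism A -> R}) (g : {lrmorphism B -> R})
  (fe : even_map f) (ge : even_map g) : {lrmorphism A ⊗ B -> R} :=
  HB.pack (tpair f g)
    (GRing.isLinear.Build K (A ⊗ B)%type R *:%R _ (tpair_is_linear f g))
    (GRing.isMonoidMorphism.Build (A ⊗ B)%type R _ (tpair_monoid_morphism fe ge)).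

End EvenMaps.

(** * Convolution and the antipode *)

Section LinearMaps.
Variable K : fieldType.

Lemma tassoc_is_linear (U V W : lmodType K) : linear (@tassoc K U V W).
Proof.
have fP (c : W) : bilinear_for *:%R *:%R (fun (a : U) (b : V) => a ⊗ (b ⊗ c)).
  split=> [b k x y|a k x y] /=; first by rewrite tensDl tensZl.
  by rewrite tensDl tensZl tensDr tensZr.
apply: tlift_linear; split=> [c|t k x y] /=; first exact: tlift_linear (fP c).
rewrite -tlift_lincomb; apply: eq_tlift => a b.
by rewrite !(tensDr, tensZr).
Qed.

HB.instance Definition _ (U V W : lmodType K) :=
  GRing.isLinear.Build K ((U ⊗ V) ⊗ W)%type (U ⊗ (V ⊗ W))%type *:%R
    (@tassoc K U V W) (@tassoc_is_linear U V W).

Lemma eq_tens (U V W : lmodType K) (g h : {linear (U ⊗ V)%type -> W}) :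
  (forall u v, g (u ⊗ v) = h (u ⊗ v)) -> forall t, g t = h t.
Proof. exact: tensor_ext. Qed.

Lemma tpair_tmap (U V U' V' : lmodType K) (R : algType K)
    (f : {linear U' -> R}) (g : {linear V' -> R})
    (f' : {linear U -> U'}) (g' : {linear V -> V'}) t :
  tpair f g (tmap f' g' t) = tpair (f \o f') (g \o g') t.
Proof.
move: t; apply: tens_ind => [|x y hx hy|u v]; first by rewrite !linear0.
  by rewrite !linearD /= hx hy.
by rewrite tmap_tens !tpair_tens.
Qed.

Lemma tmap_comp (U V U' V' U2 V2 : lmodType K)
    (f : {linear U' -> U2}) (g : {linear V' -> V2})
    (f' : {linear U -> U'}) (g' : {linear V -> V'}) t :
  tmap f g (tmap f' g' t) = tmap (f \o f') (g \o g') t.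
Proof.
move: t; apply: tens_ind => [|x y hx hy|u v]; first by rewrite !linear0.
  by rewrite !linearD /= hx hy.
by rewrite !tmap_tens.
Qed.

Lemma tpair_tassoc (U V W : lmodType K) (R : algType K)
    (f : {linear U -> R}) (g : {linear V -> R}) (h : {linear W -> R}) t :
  tpair f (tpair g h) (tassoc t) = tpair (tpair f g) h t.
Proof.
move: t; apply: tens_ind => [|x y hx hy|u w]; first by rewrite !linear0.
  by rewrite !linearD /= hx hy.
move: u; apply: tens_ind => [|x y hx hy|u v].
- by rewrite tens0l !linear0.
- by rewrite tensDl !linearD /= hx hy.
by rewrite tassoc_tens !tpair_tens /= !tpair_tens mulrA.
Qed.

End LinearMaps.

Section Convolution.
Variables (K : fieldType) (A : hopfSuperAlgType K).
Local Notation T := (A ⊗ A)%type.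

Definition Delta : A -> T := comul hopf.
HB.instance Definition _ := GRing.Linear.on Delta.

Lemma Delta_is_monoid_morphism : monoid_morphism Delta.
Proof.
by split=> [|a b]; [exact: comul1|rewrite tens_mulE; exact: comulM].
Qed.
HB.instance Definition _ :=
  GRing.isMonoidMorphism.Build A T Delta Delta_is_monoid_morphism.

Lemma Delta_even : even_map Delta.
Proof. by move=> i a ai; apply/tens_degP/comul_deg. Qed.

Definition eps (a : A) : K := counit hopf a.

Lemma eps_is_linear : scalar eps.
Proof. exact: (linearP (counit hopf)). Qed.
HB.instance Definition _ :=
  GRing.isLinear.Build K A K^o *:%R eps eps_is_linear.
Lemma eps_is_monoid_morphism : monoid_morphism eps.
Proof.
by split; [exact: (rmorph1 (counit hopf))|exact: (rmorphM (counit hopf))].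
Qed.
HB.instance Definition _ :=
  GRing.isMonoidMorphism.Build A K^o eps eps_is_monoid_morphism.

Lemma epsM a b : eps (a * b) = eps a * eps b.
Proof. exact: (rmorphM (counit hopf)). Qed.
Lemma epsD a b : eps (a + b) = eps a + eps b.
Proof. exact: (linearD (counit hopf)). Qed.
Lemma epsB a b : eps (a - b) = eps a - eps b.
Proof. exact: (linearB (counit hopf)). Qed.
Lemma epsZ k a : eps (k *: a) = k * eps a.
Proof. exact: (linearZ_LR (counit hopf)). Qed.
Lemma eps0 : eps 0 = 0.
Proof. exact: (linear0 (counit hopf)). Qed.
Lemma eps_sum I (r : seq I) (F : I -> A) :
  eps (\sum_(i <- r) F i) = \sum_(i <- r) eps (F i).
Proof. exact: (linear_sum (counit hopf)). Qed.
Lemma eps1 : eps 1 = 1.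
Proof. exact: (rmorph1 (counit hopf)). Qed.
Lemma eps_odd a : a \in deg true -> eps a = 0.
Proof. exact: counit_odd. Qed.

Definition antip : A -> A := antipode hopf.
HB.instance Definition _ := GRing.Linear.on antip.

Variable R : algType K.
Implicit Types f g h : {linear A -> R}.

Definition conv f g : A -> R := tpair f g \o Delta.
HB.instance Definition _ f g := GRing.Linear.on (conv f g).

Definition unitmap (a : A) : R := (eps a)%:A.
Lemma unitmap_is_linear : linear unitmap.
Proof. by move=> k x y; rewrite /unitmap linearP /= scalerDl scalerA. Qed.
HB.instance Definition _ := GRing.isLinear.Build K A R *:%R unitmap unitmap_is_linear.

Lemma unitmap_is_monoid_morphism : monoid_morphism unitmap.
Proof.
split=> [|x y]; first by rewrite /unitmap eps1 scale1r.
by rewrite /unitmap epsM -scalerAl mul1r scalerA.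
Qed.
HB.instance Definition _ :=
  GRing.isMonoidMorphism.Build A R unitmap unitmap_is_monoid_morphism.

Lemma convA f g h a : conv f (conv g h) a = conv (conv f g) h a.
Proof.
have := congr1 (tpair f (tpair g h)) (coassoc hopf a).
rewrite tpair_tassoc -/(Delta a).
by rewrite (tpair_tmap f (tpair g h) idfun Delta) (tpair_tmap (tpair f g) h Delta idfun).
Qed.

Lemma counit_left (V : lmodType K) (f : {linear A -> V}) a :
  tlift (fun x y => eps x *: f y) (Delta a) = f a.
Proof.
have bil (W : lmodType K) (h : {linear A -> W}) :
    bilinear_for *:%R *:%R (fun x y => eps x *: h y).
  split=> [v k x y|u k x y] /=; rewrite linearP /=.
    by rewrite scalerDl scalerA.
  by rewrite scalerDr !scalerA mulrC.
rewrite -{2}[a](counitl hopf) -/(Delta a); move: (Delta a).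
pose F (W : lmodType K) (h : {linear A -> W}) : {linear T -> W} := HB.pack (tlift _)
  (GRing.isLinear.Build K T W *:%R _ (tlift_linear (bil W h))).
apply: (@eq_tens _ _ _ _ (F V f) (f \o F A idfun)) => u v /=.
by rewrite !tlift_tens //= ?linearZ_LR //; first [exact: bil|exact: (bil _ idfun)].
Qed.

Lemma counit_right (V : lmodType K) (f : {linear A -> V}) a :
  tlift (fun x y => eps y *: f x) (Delta a) = f a.
Proof.
have bil (W : lmodType K) (h : {linear A -> W}) :
    bilinear_for *:%R *:%R (fun x y => eps y *: h x).
  split=> [v k x y|u k x y] /=; rewrite linearP /=.
    by rewrite scalerDr !scalerA mulrC.
  by rewrite scalerDl scalerA.
rewrite -{2}[a](counitr hopf) -/(Delta a); move: (Delta a).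
pose F (W : lmodType K) (h : {linear A -> W}) : {linear T -> W} := HB.pack (tlift _)
  (GRing.isLinear.Build K T W *:%R _ (tlift_linear (bil W h))).
apply: (@eq_tens _ _ _ _ (F V f) (f \o F A idfun)) => u v /=.
by rewrite !tlift_tens //= ?linearZ_LR //; first [exact: bil|exact: (bil _ idfun)].
Qed.

Lemma conv_unitl f a : conv (@unitmap) f a = f a.
Proof.
rewrite -(counit_left f a); apply: eq_tlift => x y.
by rewrite mulr_algl.
Qed.

Lemma conv_unitr f a : conv f (@unitmap) a = f a.
Proof.
rewrite -(counit_right f a); apply: eq_tlift => x y.
by rewrite mulr_algr.
Qed.

Lemma eq_conv f f' g g' : f =1 f' -> g =1 g' -> conv f g =1 conv f' g'.
Proof.
by move=> ff gg a; apply: eq_tlift => x y; rewrite ff gg.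
Qed.

End Convolution.

Arguments unitmap {K A} R a.

Lemma unitmap_even (K : fieldType) (A : hopfSuperAlgType K) (R : superAlgType K) :
  even_map (@unitmap K A R).
Proof.
move=> [] a ai; last by rewrite /unitmap deg_Z ?deg_1.
by rewrite /unitmap eps_odd // scale0r rpred0.
Qed.

Section Antipode.
Variables (K : fieldType) (A : hopfSuperAlgType K).

Lemma conv_antipl (a : A) : conv (@antip K A) idfun a = unitmap A a.
Proof. exact: antipodel. Qed.

Lemma conv_antipr (a : A) : conv idfun (@antip K A) a = unitmap A a.
Proof. exact: antipoder. Qed.

Lemma antip_even : even_map (@antip K A).
Proof. exact: antipode_deg. Qed.

(* Cancelling one variable at a time spares us the multiplicativity of the
   antipode. *)
Lemma antip_cancel (a b : A) :
  tpair (@antip K A) idfun (Delta a * (b ⊗ 1)) = eps a *: antip b.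
Proof.
pose M : {linear (A ⊗ A)%type -> A} := tpair (@antip K A) idfun.
have M1 t y : M (t * (1 ⊗ y)) = M t * y.
  move: t; apply: tens_super_ind => [|t t' ht ht'|i j c d ci dj].
  - by rewrite mul0r !linear0 mul0r.
  - by rewrite mulrDl !linearD /= ht ht' mulrDl.
  by rewrite (tens_mul _ _ dj deg_1) andbF scale1r /M /= !tpair_tens /= mulr1 mulrA.
have tens1 (x y : A) : (x ⊗ 1) * (1 ⊗ y) = x ⊗ y.
  by rewrite (tens_mul _ _ deg_1 deg_1) scale1r mulr1 mul1r.
pose L x := M (Delta a * (x ⊗ 1)).
have Llin : linear L.
  move=> k x y; rewrite /L tensDl tensZl mulrDr -scalerAr linearP /=.
  by [].
pose Ll : {linear A -> A} := HB.pack L (GRing.isLinear.Build K A A *:%R L Llin).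
(* Convolving with the identity completes x ⊗ 1 to Delta x, and Delta a * Delta x = Delta (a * x) is
   where the antipode axiom applies. Convolving with the antipode afterwards recovers [L]. *)
have convL x : conv Ll idfun x = eps a *: unitmap A x.
  have -> : conv Ll idfun x = M (Delta a * Delta x).
    rewrite /conv /=; move: (Delta x).
    apply: tens_ind => [|t t' ht ht'|u v].
    - rewrite mulr0; by rewrite !linear0.
    - by rewrite mulrDr !linearD /= ht ht'.
    by rewrite tpair_tens /= /L -M1 -mulrA tens1.
  by rewrite -rmorphM; rewrite [LHS]conv_antipl /unitmap epsM scalerA.
pose u : {linear A -> A} := @unitmap K A A.
rewrite -/M -/(L b) -[L b]/(Ll b) -(conv_unitr Ll b).
rewrite -(eq_conv (f := Ll) (fun=> erefl) conv_antipr) convA.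
pose cu : {linear A -> A} := eps a \*: u.
rewrite (eq_conv (f' := cu) (g' := @antip K A) convL) //.
have -> : conv cu (@antip K A) b = eps a *: conv u (@antip K A) b.
  rewrite /conv /=; move: (Delta b).
  apply: tens_ind => [|t t' ht ht'|c d].
  - by rewrite !linear0.
  - by rewrite !linearD /= ht ht'.
  by rewrite !tpair_tens /= scalerAl.
by rewrite conv_unitl.
Qed.

End Antipode.

Section TensorSpan.
Variables (K : fieldType) (A B : superAlgType K).

(** The image in A ⊗ B of A ⊗ ⟨P⟩, described by finite sums inside A ⊗ B. *)
Definition tspan (P : B -> Prop) (t : A ⊗ B) : Prop :=
  exists2 s : seq (A * B), forall p, p \in s -> P p.2
    & t = \sum_(p <- s) p.1 ⊗ p.2.

Lemma tspan0 P : tspan P 0.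
Proof. by exists [::]; rewrite // big_nil. Qed.

Lemma tspanD P t t' : tspan P t -> tspan P t' -> tspan P (t + t').
Proof.
move=> [s sP ->] [s' sP' ->]; exists (s ++ s'); last by rewrite big_cat.
by move=> p; rewrite mem_cat => /orP[/sP|/sP'].
Qed.

Lemma tspan_tens (P : B -> Prop) a b : P b -> tspan P (a ⊗ b).
Proof.
by move=> Pb; exists [:: (a, b)]; rewrite ?big_seq1 // => p; rewrite inE => /eqP->.
Qed.

Lemma tspan_ind (P : B -> Prop) (Q : A ⊗ B -> Prop) : Q 0 ->
  (forall t t', Q t -> Q t' -> Q (t + t')) -> (forall a b, P b -> Q (a ⊗ b)) ->
  forall t, tspan P t -> Q t.
Proof.
move=> Q0 QD QP _ [s sP ->]; rewrite big_seq; apply: big_ind => // p /sP.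
exact: QP.
Qed.

Lemma tspan_super_ind (P : B -> Prop) (Q : A ⊗ B -> Prop) :
  (forall i b, P b -> P (component i b)) -> Q 0 ->
  (forall t t', Q t -> Q t' -> Q (t + t')) ->
  (forall i j a b, a \in deg i -> b \in deg j -> P b -> Q (a ⊗ b)) ->
  forall t, tspan P t -> Q t.
Proof.
move=> Pc Q0 QD QP; apply: tspan_ind => // a b Pb.
have h i j : Q (component i a ⊗ component j b).
  by apply: (QP i j); rewrite ?component_deg //; apply: Pc.
rewrite [a]componentD [b]componentD !(tensDl, tensDr).
by apply: (QD); apply: (QD).
Qed.

End TensorSpan.

Section Defect.
Variables (K : fieldType) (A : superAlgType K) (R : superAlgType K).
Variables (g : {linear A -> R}) (ge : even_map g).

Lemma tmap_mul_defect (t t' : A ⊗ A) :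
  tspan (fun x => exists a b, x = g a * g b - g (a * b))
    (tmap idfun g t * tmap idfun g t' - tmap idfun g (t * t')).
Proof.
move: t; apply: tens_super_ind => [|t u ht hu|i j a b ai bj].
- by rewrite !(mul0r, linear0) ?subr0 ?addr0; apply: tspan0.
- by rewrite !(mulrDl, linearD) /= ?opprD addrACA; apply: tspanD.
move: t'; apply: tens_super_ind => [|t u ht hu|i' j' a' b' ai' bj'].
- by rewrite !(mulr0, linear0) ?subr0 ?addr0; apply: tspan0.
- by rewrite !(mulrDr, linearD) /= ?opprD addrACA; apply: tspanD.
rewrite (tens_mul _ _ bj ai') linearZ_LR /= !tmap_tens /=.
rewrite (tens_mul _ _ (ge bj) ai') -scalerBr -tensBr -tensZl.
by apply: tspan_tens; exists b, b'.
Qed.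

Lemma tmap_mul_tens1 (t : A ⊗ A) (x : A) :
  tmap idfun g (t * (x ⊗ 1)) = tmap idfun g t * (x ⊗ 1).
Proof.
move: t; apply: tens_super_ind => [|t u ht hu|i j a b ai bj].
- by rewrite !(mul0r, linear0).
- by rewrite !(mulrDl, linearD) /= ht hu.
move: x; apply: super_ind => [x y hx hy|k x xk].
  by rewrite !tensDl !(mulrDr, linearD) /= hx hy.
rewrite (tens_mul _ _ bj xk) linearZ_LR /= !tmap_tens /=.
by rewrite (tens_mul _ _ (ge bj) xk) !mulr1.
Qed.

End Defect.

(** * The cocycle of a linear lift, twisted by the antipode *)

(* The algebra map [a ⊗ b |-> \sum a1 ⊗ i a2 * j b]. *)
Section Shuffle.
Variables (K : fieldType) (A : comHopfSuperAlgType K) (B R : comSuperAlgType K).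
Variables (i : {lrmorphism A -> R}) (j : {lrmorphism B -> R}).
Hypotheses (i_even : even_map i) (j_even : even_map j).
Local Notation Y := (A ⊗ R)%type.

Let i' : {lrmorphism A -> Y} := @tinr K A R \o i.
Let i'_even : even_map i'.
Proof. by move=> k a ak; apply/tinr_even/i_even. Qed.

Let e3 : {lrmorphism (A ⊗ A)%type -> Y} := talg (@tinl_even K A R) i'_even.
Let e3_Delta : {lrmorphism A -> Y} := e3 \o @Delta K A.
Let e3_Delta_even : even_map e3_Delta.
Proof.
by move=> k a ak; apply: (tpair_even (@tinl_even K A R) i'_even); apply: Delta_even.
Qed.

Let j' : {lrmorphism B -> Y} := @tinr K A R \o j.
Let j'_even : even_map j'.
Proof. by move=> k a ak; apply/tinr_even/j_even. Qed.

Definition shuffle : (A ⊗ B)%type -> Y := talg e3_Delta_even j'_even.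
HB.instance Definition _ := GRing.LRMorphism.on shuffle.

Lemma shuffle_tens a b (f : {linear A -> R}) : (forall x, f x = i x * j b) ->
  shuffle (a ⊗ b) = tmap idfun f (Delta a).
Proof.
move=> fE; rewrite /shuffle /= tpair_tens /=; move: (Delta a).
apply: tens_ind => [|t t' ht ht'|x y].
- by rewrite !linear0 mul0r.
- by rewrite !linearD /= mulrDl ht ht'.
rewrite tmap_tens tpair_tens /= -mulrA -(rmorphM (@tinr K A R)).
by rewrite /tinl /tinr /= tens1_mul fE.
Qed.

End Shuffle.

Section Twist.
Variables (K : fieldType) (A : comHopfSuperAlgType K) (B C : comSuperAlgType K).
Variables (p : {lrmorphism B -> C}) (f : {lrmorphism A -> C}).
Hypothesis p_even : even_map p.
Hypothesis ker_sq : forall x y, p x = 0 -> p y = 0 -> x * y = 0.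
Variable g : {linear A -> B}.
Hypothesis g_even : even_map g.
Hypothesis pg : forall a, p (g a) = f a.
Hypothesis g1 : g 1 = 1.

Local Notation X := (A ⊗ B)%type.
Let J (b : B) := p b = 0.

Lemma ker_component i b : J b -> J (component i b).
Proof.
move=> Jb; have e : p (component i b) = component i (p b).
  exact: even_map_component.
by rewrite /J e Jb linear0.
Qed.

Lemma defect_ker a b : J (g a * g b - g (a * b)).
Proof. by rewrite /J rmorphB rmorphM /= !pg rmorphM subrr. Qed.

(** The defect of [g] lies in ker p, which has square zero. So ker p is an A-module through [g] even
    though [g] is not multiplicative. *)
Lemma lift_act a b j : J j -> g (a * b) * j = g a * (g b * j).
Proof.
move=> Jj; apply/eqP; rewrite eq_sym -subr_eq0 mulrA -mulrBl ker_sq //.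
exact: defect_ker.
Qed.

Lemma lift_pair (f' g' : {linear A -> A}) (j : B) t : J j ->
  tpair (g \o f') (g \o g') t * j = g (tpair f' g' t) * j.
Proof.
move=> Jj; move: t; apply: tens_ind => [|t t' ht ht'|b c].
- by rewrite !linear0.
- by rewrite !linearD /= !mulrDl ht ht'.
by rewrite !tpair_tens /= lift_act // mulrA.
Qed.

(** This would be an algebra map if [g] were one. Its own defect lies in A ⊗ ker p and keeps,
    besides the defect of [g], a first tensor factor on which the antipode can act. *)
Definition coact (a : A) : X := tmap idfun g (Delta a).
HB.instance Definition _ := GRing.Linear.copy coact (tmap idfun g \o @Delta K A).

Lemma coact1 : coact 1 = 1.
Proof. by rewrite /coact rmorph1 tens_one tmap_tens /= g1. Qed.

Lemma coact_even : even_map coact.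
Proof.
move=> i a ai; apply: (tmap_even (f := idfun)) => //; exact: Delta_even.
Qed.

Definition tker : X -> Prop := tspan J.

Lemma coact_defect a b : tker (coact a * coact b - coact (a * b)).
Proof.
rewrite /coact rmorphM.
have [s sP ->] := tmap_mul_defect g_even (Delta a) (Delta b).
by exists s => // q /sP[c [d ->]]; apply: defect_ker.
Qed.

Definition nu : X -> B := tpair (g \o @antip K A) idfun.
HB.instance Definition _ := GRing.Linear.on nu.

Lemma nu_tens a b : nu (a ⊗ b) = g (antip a) * b.
Proof. by rewrite /nu tpair_tens. Qed.

Lemma nu_even : even_map nu.
Proof.
apply: tpair_even => // i a ai; apply: g_even; exact: antip_even.
Qed.

Lemma nu_ker t : tker t -> J (nu t).
Proof.
move: t; apply: tspan_ind => [|t t' ht ht'|a b Jb].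
- by rewrite linear0 /J linear0.
- by rewrite linearD /J linearD /= ht ht' addr0.
by rewrite nu_tens /J rmorphM /= Jb mulr0.
Qed.

(** For t = x ⊗ j the left side is the sum of ± g(S(a1 x)) g(a2) j. On ker p the two values of [g]
    may be multiplied under [g], and [antip_cancel] leaves eps(a) g(S x) j. *)
Lemma nu_coactl a t : tker t -> nu (coact a * t) = eps a *: nu t.
Proof.
move: t; apply: tspan_ind => [|t t' ht ht'|x j Jj].
- by rewrite mulr0 linear0 scaler0.
- by rewrite mulrDr !linearD /= ht ht'.
have -> : x ⊗ j = (x ⊗ 1) * (1 ⊗ j) :> X.
  by rewrite (tens_mul _ _ deg_1 deg_1) scale1r mulr1 mul1r.
have nuM t : nu (t * (1 ⊗ j)) = nu t * j.
  move: t; apply: tens_super_ind => [|t t' ht ht'|i k b c bi ck].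
  - by rewrite mul0r linear0 mul0r.
  - by rewrite mulrDl !linearD /= mulrDl ht ht'.
  by rewrite (tens_mul _ _ ck deg_1) andbF scale1r mulr1 !nu_tens mulrA.
rewrite mulrA !nuM /coact -(tmap_mul_tens1 g_even) nu_tens mulr1 scalerAl.
rewrite [LHS](_ : _ = tpair (g \o @antip K A) (g \o idfun)
  (Delta a * (x ⊗ 1)) * j); last by rewrite /nu tpair_tmap.
rewrite lift_pair; last exact: Jj.
by rewrite antip_cancel linearZ_LR.
Qed.

(** Follows from the left action by super-commutativity; a sign can appear only for odd a, where the
    counit vanishes. *)
Lemma nu_coactr a t : tker t -> nu (t * coact a) = eps a *: nu t.
Proof.
move: t; apply: tspan_super_ind => [||t t' ht ht'|i k x j xi jk Jj].
- exact: ker_component.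
- by rewrite mul0r linear0 scaler0.
- by rewrite mulrDl !linearD /= ht ht'.
move: a; apply: super_ind => [a b ha hb|l a al].
  by rewrite epsD linearD /= mulrDr linearD scalerDl /= ha hb.
rewrite (supermulC _ _ _ _ (tens_in_deg xi jk) (coact_even al)).
rewrite sign_mulE linearZ_LR /= nu_coactl; last exact: tspan_tens.
case: l al => al; first by rewrite eps_odd // scale0r scaler0.
by rewrite andbF scale1r.
Qed.

(** The sum of ± g(S(a1 b1)) (g(a2) g(b2) - g(a2 b2)): the defect of [g], twisted by the
    antipode. *)
Definition tau a b : B := nu (coact a * coact b - coact (a * b)).

Lemma tau_ker a b : J (tau a b).
Proof. exact/nu_ker/coact_defect. Qed.

Lemma tau_linearl b : linear (tau^~ b).
Proof.
move=> k x y; rewrite /tau !mulrDl -scalerAl (linearP coact) mulrDl -scalerAl.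
by rewrite (linearP coact) /= opprD addrACA -scalerBr (linearP nu).
Qed.

Lemma tau_linearr a : linear (tau a).
Proof.
move=> k x y; rewrite /tau !mulrDr -scalerAr (linearP coact) mulrDr -scalerAr.
by rewrite (linearP coact) /= opprD addrACA -scalerBr (linearP nu).
Qed.

Lemma tau_deg i j a b : a \in deg i -> b \in deg j -> tau a b \in deg (i (+) j).
Proof.
move=> ai bj; apply: nu_even; apply: rpredB.
  by apply: deg_M; apply: coact_even.
by apply/coact_even/deg_M.
Qed.

Lemma tau_supersym i j a b : a \in deg i -> b \in deg j ->
  tau a b = (-1) ^+ (i && j) *: tau b a.
Proof.
move=> ai bj; rewrite /tau (supermulC _ _ _ _ (coact_even ai) (coact_even bj)).
rewrite (supermulC _ _ _ _ ai bj) !sign_mulE.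
by rewrite (linearZ_LR coact) -scalerBr (linearZ_LR nu).
Qed.

Lemma tau1l b : tau 1 b = 0.
Proof. by rewrite /tau coact1 !mul1r subrr linear0. Qed.

(** Let D be the defect of [coact]. Associativity in A ⊗ B gives D(ab, c) + D(a, b) coact(c) = D(a,
    bc) + coact(a) D(b, c), and [nu] turns both actions of [coact] into counits. *)
Lemma tau_cocycle a b c :
  tau (a * b) c + eps c *: tau a b = tau a (b * c) + eps a *: tau b c.
Proof.
rewrite /tau -(nu_coactr c (coact_defect a b)) -(nu_coactl a (coact_defect b c)).
rewrite -!linearD /=; congr nu.
rewrite mulrBl mulrBr !mulrA addrC addrA subrK.
by rewrite [RHS]addrC addrA subrK.
Qed.

(* The twisted cocycle determines the original one, by coassociativity. *)
Section Untwist.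
Variables (R : comSuperAlgType K).
Variables (i : {lrmorphism A -> R}) (j : {lrmorphism B -> R}).
Hypotheses (i_even : even_map i) (j_even : even_map j).
Variable n : {linear R -> B}.
Hypothesis nE : forall a b, n (i a * j b) = g (antip a) * b.
Variable c : {linear A -> R}.
Hypothesis c_even : even_map c.
Hypothesis cE : forall a, c a = tpair i (j \o g) (Delta a).
Hypothesis nc0 : forall a b, n (c a * c b - c (a * b)) = 0.

Local Notation sh := (shuffle i_even j_even).

Definition mulj b x := i x * j b.
Let mulj_lin b : linear (mulj b).
Proof. by move=> k x y; rewrite /mulj linearP mulrDl -scalerAl. Qed.
HB.instance Definition _ b := GRing.isLinear.Build K A R *:%R (mulj b) (mulj_lin b).

Let shE a b : sh (a ⊗ b) = tmap idfun (mulj b) (Delta a).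
Proof. exact: shuffle_tens. Qed.

Let shuffle_coact a : sh (coact a) = tmap idfun c (Delta a).
Proof.
have e t : (sh \o tmap idfun g) t =
  (tmap idfun (tpair i (j \o g)) \o (@tassoc K A A A \o tmap (@Delta K A) idfun)) t.
  move: t; apply: eq_tens => x y.
  transitivity (sh (x ⊗ g y)); first by rewrite /= tmap_tens.
  rewrite shE /= tmap_tens.
  have h u : tmap idfun (mulj (g y)) u =
      (tmap idfun (tpair i (j \o g)) \o (@tassoc K A A A \o tensl y)) u.
    move: u; apply: eq_tens => x1 x2.
    by rewrite /= /tensl tassoc_tens !tmap_tens /= tpair_tens /=.
  exact: h.
have {}e := e (Delta a); rewrite /= in e.
rewrite [LHS]e coassoc tmap_comp; apply: eq_tlift => x y.
by rewrite /= cE.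
Qed.

(** [R] stands for A ⊗ B, [i] and [j] for its two injections, [n] for [nu] and [c] for [coact]. By
    coassociativity the shuffle of coact(a) is the sum of a1 ⊗ c(a2), so on the shuffled defect [k]
    the map [kappa] sees only defects of [c] and vanishes by [nc0]. On A ⊗ ker p, however, the
    identity a1 S(a2) = eps(a) makes [kappa] after the shuffle equal to eps ⊗ id, which sends [k] to
    the defect of [g]. *)
Lemma untwist a b : g (a * b) = g a * g b.
Proof.
pose kappa : {linear (A ⊗ R)%type -> B} := tpair g n; pose k := coact a * coact b - coact (a * b).
have kappa0 : kappa (sh k) = 0.
  rewrite /k rmorphB rmorphM /= !shuffle_coact (rmorphM (@Delta K A)).
  have := tmap_mul_defect c_even (Delta a) (Delta b).
  move: (_ - _); apply: tspan_ind => [|t t' ht ht'|x _ [x1 [x2 ->]]].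
  - by rewrite linear0.
  - by rewrite linearD /= ht ht' addr0.
  by rewrite /kappa /= tpair_tens nc0 mulr0.
pose E : {linear X -> B} := tpair (unitmap B) idfun.
have kappaE t : tker t -> kappa (sh t) = E t.
  move: t; apply: tspan_ind => [|t t' ht ht'|x y Jy].
  - by rewrite !linear0.
  - by rewrite !linearD /= ht ht'.
  rewrite shE /kappa /= tpair_tmap /E /= tpair_tens /=.
  have -> : tpair (g \o idfun) (n \o mulj y) (Delta x) =
      tpair (g \o idfun) (g \o @antip K A) (Delta x) * y.
    move: (Delta x); apply: tens_ind => [|t t' ht ht'|x1 x2].
    - by rewrite !linear0 mul0r.
    - by rewrite !linearD /= mulrDl ht ht'.
    by rewrite !tpair_tens /= nE mulrA.
  rewrite lift_pair //; have := conv_antipr x; rewrite /conv /= => ->.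
  by rewrite /unitmap linearZ_LR /= g1.
have Ecoact x : E (coact x) = g x.
  by rewrite /E /= /coact tpair_tmap -[RHS]conv_unitl.
have /eqP : E k = 0 by rewrite -(kappaE k (coact_defect a b)).
have [_ EM] := tpair_monoid_morphism (@unitmap_even K A B)
  ((fun k b bk => bk) : even_map (@idfun B)).
rewrite /k linearB [E (_ * _)]EM !Ecoact subr_eq0 => /eqP.
by [].
Qed.

End Untwist.

Lemma tau0_morphism : (forall a b, tau a b = 0) -> forall a b, g (a * b) = g a * g b.
Proof.
move=> tau0; apply: (@untwist X _ _ (@tinl_even K A B) (@tinr_even K A B) nu _ coact) => //.
- by move=> a b; rewrite /tinl /tinr /= tens1_mul nu_tens.
- exact: coact_even.
move=> a; apply: eq_tlift => x y.
by rewrite /tinl /tinr /= tens1_mul.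
Qed.

End Twist.

(** * Cocycles and trivial extensions *)

(* Normalized supersymmetric Hochschild 2-cocycles with values in [B], on which
   [A] acts through the counit. *)
Record cocycle (K : fieldType) (A : comHopfSuperAlgType K) (B : superAlgType K) :=
  Cocycle {
    cocycle_fun :> A -> A -> B;
    cocycle_linearl : forall b, linear (cocycle_fun^~ b);
    cocycle_linearr : forall a, linear (cocycle_fun a);
    cocycle_deg : forall i j a b, a \in deg i -> b \in deg j ->
      cocycle_fun a b \in deg (i (+) j);
    cocycleC : forall i j a b, a \in deg i -> b \in deg j ->
      cocycle_fun a b = (-1) ^+ (i && j) *: cocycle_fun b a;
    cocycle1l : forall b, cocycle_fun 1 b = 0;
    cocycleP : forall a b c,
      cocycle_fun (a * b) c + eps c *: cocycle_fun a b =
      cocycle_fun a (b * c) + eps a *: cocycle_fun b c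
  }.

(** The cocycle is a parameter of the type, so that each one puts its own product on A × B. In this
    product B is an ideal of square zero, and associativity amounts to the cocycle identity. *)
Definition cocycle_ext (K : fieldType) (A : comHopfSuperAlgType K)
  (B : superAlgType K) (tau : cocycle A B) : Type := (A * B)%type.

Section CocycleExtension.
Variables (K : fieldType) (A : comHopfSuperAlgType K) (B : superAlgType K).
Variable tau : cocycle A B.

Local Notation cext := (cocycle_ext tau).
HB.instance Definition _ := GRing.Lmodule.copy cext (A * B)%type.
Implicit Types x y z : cext.

Lemma cocycleDl a a' b : tau (a + a') b = tau a b + tau a' b.
Proof. by have := cocycle_linearl tau b 1 a a'; rewrite /= !scale1r. Qed.
Lemma cocycleDr a b b' : tau a (b + b') = tau a b + tau a b'.
Proof. by have := cocycle_linearr tau a 1 b b'; rewrite /= !scale1r. Qed.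
Lemma cocycle0l b : tau 0 b = 0.
Proof. by apply: (addIr (tau 0 b)); rewrite -cocycleDl !add0r. Qed.
Lemma cocycle0r a : tau a 0 = 0.
Proof. by apply: (addIr (tau a 0)); rewrite -cocycleDr !add0r. Qed.
Lemma cocycleZl k a b : tau (k *: a) b = k *: tau a b.
Proof.
by have := cocycle_linearl tau b k a 0; rewrite /= addr0 cocycle0l addr0.
Qed.
Lemma cocycleZr k a b : tau a (k *: b) = k *: tau a b.
Proof.
by have := cocycle_linearr tau a k b 0; rewrite /= addr0 cocycle0r addr0.
Qed.
Lemma cocycle1r a : tau a 1 = 0.
Proof.
move: a; apply: super_ind => [a b ha hb|i a ai]; first by rewrite cocycleDl ha hb addr0.
by rewrite (cocycleC tau ai deg_1) cocycle1l scaler0.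
Qed.

Definition cext_mul x y : cext :=
  (x.1 * y.1, eps x.1 *: y.2 + eps y.1 *: x.2 + tau x.1 y.1).
Definition cext_one : cext := (1, 0).

Lemma cext_mulA : associative cext_mul.
Proof.
move=> [a x] [b y] [c z]; rewrite /cext_mul /= mulrA !epsM; congr (_, _).
rewrite !scalerDr !scalerA -!addrA; congr (_ + _).
rewrite [eps a * eps c]mulrC; congr (_ + _).
rewrite addrCA [eps b * _]mulrC; congr (_ + _).
by rewrite addrC -cocycleP addrC.
Qed.

Lemma cext_mul1 : left_id cext_one cext_mul.
Proof.
move=> [a x]; rewrite /cext_mul /= mul1r eps1 scale1r scaler0 addr0.
by rewrite cocycle1l addr0.
Qed.

Lemma cext_mulr1 : right_id cext_one cext_mul.
Proof.
move=> [a x]; rewrite /cext_mul /= mulr1 eps1 scale1r scaler0 add0r.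
by rewrite cocycle1r addr0.
Qed.

Lemma cext_mulDl : left_distributive cext_mul +%R.
Proof.
move=> [a x] [b y] [c z]; rewrite /cext_mul; congr (_, _); rewrite /=.
  by rewrite mulrDl.
by rewrite epsD cocycleDl scalerDl scalerDr [RHS]addrACA; congr (_ + _); rewrite [RHS]addrACA.
Qed.

Lemma cext_mulDr : right_distributive cext_mul +%R.
Proof.
move=> [a x] [b y] [c z]; rewrite /cext_mul; congr (_, _); rewrite /=.
  by rewrite mulrDr.
by rewrite epsD cocycleDr scalerDl scalerDr [RHS]addrACA; congr (_ + _); rewrite [RHS]addrACA.
Qed.

Lemma cext_one_neq0 : cext_one != 0.
Proof. by apply/eqP => -[] /eqP; rewrite oner_eq0. Qed.

HB.instance Definition _ := GRing.Zmodule_isNzRing.Build cext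
  cext_mulA cext_mul1 cext_mulr1 cext_mulDl cext_mulDr cext_one_neq0.

Lemma cext_mulE x y :
  x * y = (x.1 * y.1, eps x.1 *: y.2 + eps y.1 *: x.2 + tau x.1 y.1) :> cext.
Proof. by []. Qed.

Lemma cext_scalerAl k x y : k *: (x * y) = (k *: x : cext) * y.
Proof.
rewrite !cext_mulE; congr (_, _) => /=; first by rewrite scalerAl.
rewrite epsZ cocycleZl.
by rewrite !scalerDr !scalerA [eps _ * k]mulrC.
Qed.

Lemma cext_scalerAr k x y : k *: (x * y) = x * (k *: y : cext).
Proof.
rewrite !cext_mulE; congr (_, _) => /=; first by rewrite scalerAr.
rewrite epsZ cocycleZr.
by rewrite !scalerDr !scalerA [eps _ * k]mulrC.
Qed.

HB.instance Definition _ := GRing.Lmodule_isLalgebra.Build K cext cext_scalerAl.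
HB.instance Definition _ := GRing.Lalgebra_isAlgebra.Build K cext cext_scalerAr.

Definition cext_deg i : {pred cext} :=
  [pred x : cext | (x.1 \in deg i) && (x.2 \in deg i)].

Lemma cext_deg_submod i : submod_closed (cext_deg i).
Proof.
split=> [|k x y /andP[x1 x2] /andP[y1 y2]]; first by rewrite inE !rpred0.
by rewrite inE /= !rpredD ?deg_Z.
Qed.

Lemma cext_decomp x : exists y : cext * cext,
  [/\ y.1 \in cext_deg false, y.2 \in cext_deg true & x = y.1 + y.2].
Proof.
exists ((component false x.1, component false x.2),
        (component true x.1, component true x.2)).
split; rewrite ?inE /= ?component_deg //.
by case: x => a b; congr (_, _); apply: componentD.
Qed.

Lemma cext_disjoint x : x \in cext_deg false -> x \in cext_deg true -> x = 0.
Proof.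
case: x => a b /andP[/= a0 b0] /andP[/= a1 b1].
by congr (_, _); apply: deg_disjoint.
Qed.

Lemma cext_deg_1 : 1 \in cext_deg false.
Proof. by rewrite inE /= deg_1 rpred0. Qed.

Lemma eps_scale_deg i j (a : A) (b : B) :
  a \in deg i -> b \in deg j -> eps a *: b \in deg (i (+) j).
Proof.
case: i => ai bj; last exact: deg_Z.
by rewrite eps_odd // scale0r rpred0.
Qed.

Lemma cext_deg_M i j x y :
  x \in cext_deg i -> y \in cext_deg j -> x * y \in cext_deg (i (+) j).
Proof.
move=> /andP[x1 x2] /andP[y1 y2]; rewrite cext_mulE inE /= deg_M //.
rewrite !rpredD ?cocycle_deg //; first exact: eps_scale_deg.
by rewrite addbC; apply: eps_scale_deg.
Qed.

HB.instance Definition _ := isSuperAlgebra.Build K cext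
  cext_deg_submod cext_decomp cext_disjoint cext_deg_1 cext_deg_M.

Lemma cext_supermulC i j x y : x \in deg i -> y \in deg j ->
  x * y = (-1) ^+ (i && j) * (y * x).
Proof.
move=> /andP[x1 x2] /andP[y1 y2]; rewrite sign_mulE !cext_mulE; congr (_, _) => /=.
  by rewrite (supermulC _ _ _ _ x1 y1) sign_mulE.
rewrite (cocycleC tau x1 y1) !scalerDr; congr (_ + _).
rewrite addrC; congr (_ + _).
  case: i j x1 y1 {x2 y2} => [] [] x1 y1; rewrite ?scale1r //.
  by rewrite eps_odd // !scale0r scaler0.
case: i j x1 y1 {x2 y2} => [] [] x1 y1; rewrite ?scale1r //.
by rewrite eps_odd // !scale0r scaler0.
Qed.

HB.instance Definition _ := isSuperCommutative.Build K cext cext_supermulC.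

Definition cext_proj : cext -> A := fst.

Lemma cext_proj_is_linear : linear cext_proj.
Proof. by []. Qed.
Lemma cext_proj_is_monoid_morphism : monoid_morphism cext_proj.
Proof. by []. Qed.
HB.instance Definition _ :=
  GRing.isLinear.Build K cext A *:%R cext_proj cext_proj_is_linear.
HB.instance Definition _ :=
  GRing.isMonoidMorphism.Build cext A cext_proj cext_proj_is_monoid_morphism.

Lemma cext_proj_even : even_map cext_proj.
Proof. by move=> i x /andP[]. Qed.

End CocycleExtension.

(* The kernel of [p] is then an [A]-module on which [A] acts through the counit. *)
Definition trivial_extension (K : fieldType) (A : comHopfSuperAlgType K)
    (E : comSuperAlgType K) (p : {lrmorphism E -> A}) : Prop :=
  [/\ even_map p, forall a, exists e, p e = a &
      forall x y, p x = 0 -> eps (p y) = 0 -> x * y = 0].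

(* In other words, the extension [p] splits at the unit point of the supergroup:
   the cocycle of a linear section of [p] is a coboundary. *)
Definition smooth_at_identity (K : fieldType) (A : comHopfSuperAlgType K) : Prop :=
  forall (E : comSuperAlgType K) (p : {lrmorphism E -> A}),
  trivial_extension p ->
  forall s : seq (E * E),
    (forall t, t \in s -> eps (p t.1) = 0 /\ eps (p t.2) = 0) ->
    p (\sum_(t <- s) t.1 * t.2) = 0 -> \sum_(t <- s) t.1 * t.2 = 0.

Section Coboundary.
Variables (K : fieldType) (A : comHopfSuperAlgType K) (B : superAlgType K).
Variable tau : cocycle A B.
Hypothesis smA : smooth_at_identity A.

(** Smoothness at the unit for the extension defined by [tau], every factor a being lifted to (a,
    0). *)
Lemma cocycle_sum0 (s : seq (A * A)) :
  (forall t, t \in s -> eps t.1 = 0 /\ eps t.2 = 0) ->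
  \sum_(t <- s) t.1 * t.2 = 0 -> \sum_(t <- s) tau t.1 t.2 = 0.
Proof.
move=> seps s0; pose p : {lrmorphism cocycle_ext tau -> A} := cext_proj (tau := tau).
have tp : trivial_extension p.
  split=> [|a|]; first exact: cext_proj_even; first by exists (a, 0).
  move=> [a x] [b y] /= -> e0; rewrite cext_mulE /= eps0 e0 !scale0r mul0r.
  by rewrite cocycle0l !addr0.
pose s' := [seq ((t.1, 0) : cocycle_ext tau, (t.2, 0) : cocycle_ext tau) | t <- s].
have s'E : \sum_(t <- s') t.1 * t.2 =
    (\sum_(t <- s) t.1 * t.2, \sum_(t <- s) tau t.1 t.2).
  rewrite big_map /=; elim: (s) => [|t r IHr]; first by rewrite !big_nil.
  by rewrite !big_cons IHr cext_mulE /= !scaler0 !add0r.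
have := smA tp (s := s'); rewrite s'E => h.
suff [] : (\sum_(t <- s) t.1 * t.2, \sum_(t <- s) tau t.1 t.2) = 0 :> cocycle_ext tau by [].
apply: h => //; move=> _ /mapP[t ts ->] /=; exact: seps.
Qed.

(** The cochain has to vanish at 1 and to satisfy h (a * b) = tau a b on A^+. These prescriptions
    are consistent by [cocycle_sum0], and a linear map given consistently on a subspace extends. *)
Lemma cocycle_coboundary (J : B -> Prop) : subspace J ->
    (forall i b, J b -> J (component i b)) -> (forall a b, J (tau a b)) ->
  exists h : {linear A -> B}, [/\ even_map h, forall a, J (h a) &
    forall a b, tau a b = h (a * b) - eps a *: h b - eps b *: h a].
Proof.
move=> sJ Jc Jtau.
(* The graph of the prescribed values. It meets 0 × J trivially, so a projection onto 0 × J along it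
   exists and yields values in [J] without further choice. *)
pose U (x : (A * B)%type) := exists k, exists2 s : seq (A * A),
  forall t, t \in s -> eps t.1 = 0 /\ eps t.2 = 0 &
  x = (k *: 1 + \sum_(t <- s) t.1 * t.2, \sum_(t <- s) tau t.1 t.2).
pose T (x : (A * B)%type) := x.1 = 0 /\ J x.2.
have sU : subspace U.
  split; first by exists 0, [::]; rewrite // !big_nil scale0r addr0.
  move=> k _ _ [a [s sP ->]] [b [r rP ->]].
  exists (k * a + b), ([seq (k *: t.1, t.2) | t <- s] ++ r).
    move=> t; rewrite mem_cat => /orP[/mapP[q /sP[q1 q2] ->]|/rP //] /=.
    by rewrite epsZ q1 mulr0.
  rewrite !big_cat !big_map /=; congr (_, _) => /=.
    rewrite scalerDl -scalerA addrACA scalerDr; congr (_ + _ + _).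
    by rewrite scaler_sumr; apply: eq_bigr => t _; rewrite scalerAl.
  congr (_ + _); rewrite scaler_sumr; apply: eq_bigr => t _.
  by rewrite cocycleZl.
have sT : subspace T.
  split=> [|k x y [x1 x2] [y1 y2]]; first by split=> //; case: sJ.
  by split; rewrite /= ?x1 ?y1 ?scaler0 ?addr0 //; case: sJ => _; apply.
have UT x : U x -> T x -> x = 0.
  move=> [k [s sP ->]] [/= e _].
  have k0 : k = 0.
    move/(congr1 (@eps K A)): e; rewrite epsD epsZ eps1 mulr1 eps0 eps_sum.
    rewrite big_seq big1 ?addr0 // => t /sP[e1 _].
    by rewrite epsM e1 mul0r.
  move: e; rewrite k0 scale0r add0r => e; rewrite (cocycle_sum0 sP e).
  by rewrite e.
have [pi [piT pi1 pi0]] := exists_projection sU sT UT.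
(* For (a, b) in [U] with b in [J], the projection sends (a, 0) = (a, b) - (0, b) to - (0, b), hence
   the sign. *)
pose h0 (a : A) := - (pi (a, 0)).2.
have h0_lin : linear h0.
  move=> k x y; rewrite /h0 scalerN -opprD; congr (- _).
  have -> : (k *: x + y, 0) = k *: (x, 0) + (y, 0) :> (A * B)%type.
    by congr (_, _); rewrite /= scaler0 addr0.
  by rewrite linearP.
pose h1 : {linear A -> B} := HB.pack h0 (GRing.isLinear.Build K A B *:%R h0 h0_lin).
have h1U a b : U (a, b) -> J b -> h1 a = b.
  move=> Uab Jb; rewrite /= /h0.
  have Tb : T (0, b) by split.
  have := pi0 _ Uab.
  have -> : (a, b) = (a, 0) + (0, b) :> (A * B)%type.
    by congr (_, _); rewrite /= ?addr0 ?add0r.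
  by rewrite linearD (pi1 _ Tb) => /(congr1 snd) /= /eqP; rewrite addr_eq0 => /eqP ->; rewrite opprK.
have h1J a : J (h1 a) by apply: subspaceN => //; case: (piT (a, 0)).
exists (evening h1); split; first exact: evening_even.
  by move=> a; apply: subspaceD => //; apply: Jc.
have h11 : evening h1 1 = 0.
  rewrite (evening_hom _ deg_1) (h1U _ 0) ?linear0 //; last by case: sJ.
  by exists 1, [::] => //; rewrite !big_nil scale1r addr0.
have h1M a b : eps a = 0 -> eps b = 0 -> evening h1 (a * b) = tau a b.
  move=> a0 b0; have e c d : eps c = 0 -> eps d = 0 -> h1 (c * d) = tau c d.
    move=> c0 d0; apply: h1U => //; exists 0, [:: (c, d)].
      by move=> t; rewrite inE => /eqP ->.
    by rewrite !big_seq1 scale0r add0r.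
  have ec i c : eps c = 0 -> eps (component i c) = 0.
    case: i => c0; first exact/eps_odd/component_deg.
    move: c0; rewrite {1}[c]componentD epsD (eps_odd (component_deg true c)).
    by rewrite addr0.
  have hh i j : evening h1 (component i a * component j b) =
      tau (component i a) (component j b).
    have dj := deg_M _ _ _ _ (component_deg i a) (component_deg j b).
    rewrite (evening_hom _ dj) e ?ec //.
    by rewrite (component_id _ (cocycle_deg _ (component_deg i a) (component_deg j b))) eqxx.
  rewrite [a]componentD [b]componentD !(mulrDl, mulrDr, cocycleDl, cocycleDr).
  by rewrite !linearD -!hh.
(* [tau] is normalized, so it depends only on the parts of a and b in A^+. *)
move=> a b; pose a' := a - (eps a)%:A; pose b' := b - (eps b)%:A.
have ea : a = a' + (eps a)%:A by rewrite subrK.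
have eb : b = b' + (eps b)%:A by rewrite subrK.
have ea0 c : eps (c - (eps c)%:A) = 0 by rewrite epsB epsZ eps1 mulr1 subrr.
have tE : tau a b = tau a' b'.
  rewrite {1}ea {1}eb !(cocycleDl, cocycleDr, cocycleZl, cocycleZr).
  by rewrite !(cocycle1l, cocycle1r, scaler0, addr0).
rewrite tE -h1M ?ea0 // /a' /b' mulrBl !mulrBr !linearB /=.
rewrite -!scalerAl -!scalerAr !mulr1 !mul1r.
have hA c d : evening h1 (c *: d) = c *: evening h1 d by rewrite linearZ_LR.
rewrite !hA h11 !scaler0 ?(oppr0, subr0, addr0).
exact: addrAC.
Qed.

End Coboundary.

(** * Lifting along nilpotent extensions *)

Section SquareZeroLift.
Variables (K : fieldType) (A : comHopfSuperAlgType K) (B C : comSuperAlgType K).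
Hypothesis smA : smooth_at_identity A.
Variables (p : {lrmorphism B -> C}) (f : {lrmorphism A -> C}).
Hypothesis p_even : even_map p.
Hypothesis p_surj : forall c, exists b, p b = c.
Hypothesis ker_sq : forall x y, p x = 0 -> p y = 0 -> x * y = 0.
Hypothesis f_even : even_map f.

Let component_p i b : p (component i b) = component i (p b).
Proof. exact: even_map_component. Qed.

Lemma exists_even_linear_lift : exists g : {linear A -> B},
  [/\ even_map g, forall a, p (g a) = f a & g 1 = 1].
Proof.
have [s [_ ps]] := @exists_linear_section K B C p (fun=> True) (conj I (fun _ _ _ _ _ => I)).
have {}ps c : p (s c) = c by have [b <-] := p_surj c; apply: ps.
pose g0 : {linear A -> B} := evening (s \o f).
have g0_even : even_map g0 by apply: evening_even.
have pg0 a : p (g0 a) = f a.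
  move: a; apply: super_ind => [x y hx hy|i a ai].
    have [e1 e2] := (linearD p (g0 x) (g0 y), linearD f x y).
    by rewrite (linearD g0) [LHS]e1 [RHS]e2; congr (_ + _).
  rewrite /g0 /= (evening_hom _ ai) component_p /= ps.
  by rewrite (component_id _ (f_even ai)) eqxx.
(* Moves the value at 1 to 1. As g0 1 - 1 is even and lies in ker p, the map remains an even
   lift. *)
pose g1 a := g0 a - eps a *: (g0 1 - 1).
have g1_lin : linear g1.
  move=> k x y; rewrite /g1 [g0 _]linearP epsD epsZ scalerDl -scalerA.
  by rewrite opprD addrACA -scalerBr.
exists (HB.pack g1 (GRing.isLinear.Build K A B *:%R g1 g1_lin) : {linear A -> B}).
split=> [i a ai|a|]; rewrite /= /g1.
- apply: rpredB; first exact: g0_even.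
  case: i ai => ai; first by rewrite eps_odd // scale0r rpred0.
  by apply/deg_Z/rpredB; rewrite ?deg_1 //; apply/g0_even/deg_1.
- have e : p (g0 1 - 1) = 0 by rewrite rmorphB rmorph1 /= pg0 rmorph1 subrr.
  by rewrite rmorphB /= [X in _ - X]linearZ_LR /= e scaler0 subr0 pg0.
- by rewrite eps1 scale1r opprB addrC subrK.
Qed.

(** With G = g + g * h (convolution), [coact] grows by H(a), the sum of a1 ⊗ (g * h)(a2). Products
    of two values of [H] vanish and nu (H a) = h a, so [tau] changes by eps a *: h b + eps b *: h a
    - h (a * b), which is exactly - tau. *)
Lemma square_zero_lift : exists2 h : {lrmorphism A -> B},
  even_map h & forall a, p (h a) = f a.
Proof.
have [g [g_even pg g1]] := exists_even_linear_lift.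
pose tc : cocycle A B := Cocycle (tau_linearl g) (tau_linearr g)
  (tau_deg g_even) (tau_supersym g_even) (tau1l g1)
  (tau_cocycle p_even ker_sq g_even pg).
have [||h [h_even ph tauE]] := @cocycle_coboundary K A B tc smA (fun b => p b = 0) (subspace_ker p).
- by move=> i b pb; rewrite component_p pb linear0.
- exact: (tau_ker g_even pg).
have {}tauE a b : tau g a b = h (a * b) - eps a *: h b - eps b *: h a by apply: tauE.
have h1 : h 1 = 0.
  have := tauE 1 1; rewrite (tau1l g1) mulr1 eps1 scale1r subrr sub0r.
  by move/eqP; rewrite eq_sym oppr_eq0 => /eqP.
pose h' : {linear A -> B} := conv g h.
have ph' a : p (h' a) = 0.
  rewrite [h' a](_ : _ = tpair g h (Delta a)) //; move: (Delta a).
  apply: tens_ind => [|t t' ht ht'|x y]; first by rewrite !linear0.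
    by rewrite linearD [LHS]linearD /= ht ht' addr0.
  by rewrite tpair_tens rmorphM /= ph mulr0.
have h'_even : even_map h'.
  by move=> i a ai; apply: (tpair_even g_even h_even); apply: Delta_even.
pose G0 a := g a + h' a.
have G0_lin : linear G0.
  by move=> k x y; rewrite /G0 !linearP /= scalerDr addrACA.
pose G : {linear A -> B} := HB.pack G0 (GRing.isLinear.Build K A B *:%R G0 G0_lin).
have GE a : G a = g a + h' a by [].
have G_even : even_map G.
  by move=> i a ai; rewrite GE rpredD ?g_even ?h'_even.
have pG a : p (G a) = f a by rewrite GE rmorphD /= pg ph' addr0.
have G1 : G 1 = 1.
  rewrite GE g1 [h' 1](_ : _ = tpair g h (Delta 1)) //.
  by rewrite rmorph1 tens_one tpair_tens g1 h1 mulr0 addr0.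
pose H a : (A ⊗ B)%type := tmap idfun h' (Delta a).
have coactG a : coact G a = coact g a + H a.
  rewrite /coact /H; move: (Delta a).
  apply: tens_ind => [|t t' ht ht'|x y]; first by rewrite !linear0 addr0.
    by rewrite !linearD /= ht ht' addrACA.
  by rewrite !tmap_tens /= -tensDr.
have kerH a : tker p (H a).
  rewrite /H; move: (Delta a).
  apply: tens_ind => [|t t' ht ht'|x y]; first by rewrite linear0; apply: tspan0.
    by rewrite linearD; apply: tspanD.
  by rewrite tmap_tens; apply: tspan_tens.
have nuG t : tker p t -> nu G t = nu g t.
  move: t; apply: tspan_ind => [|t t' ht ht'|x j pj]; first by rewrite !linear0.
    by rewrite !linearD /= ht ht'.
  by rewrite !nu_tens GE mulrDl [h' _ * j]ker_sq ?addr0.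
have ker0 (t t' : (A ⊗ B)%type) : tker p t -> tker p t' -> t * t' = 0.
  have pc i b : p b = 0 -> p (component i b) = 0.
    by rewrite component_p => ->; rewrite linear0.
  move=> kt kt'; move: t kt; apply: tspan_super_ind => //.
  - by rewrite mul0r.
  - by move=> t1 t2 h1' h2'; rewrite mulrDl h1' h2' addr0.
  move=> i j x b xi bj pb; move: t' kt'; apply: tspan_super_ind => //.
  - by rewrite mulr0.
  - by move=> t1 t2 h1' h2'; rewrite mulrDr h1' h2' addr0.
  move=> k l y c yk cl pc0.
  by rewrite (tens_mul _ _ bj yk) [b * c]ker_sq // tens0r scaler0.
(* The left side is the sum of g(S a1) g(a2) h(a3); since h takes values in ker p, the first two
   factors contract to a counit. *)
have nuH a : nu g (H a) = h a.
  rewrite /H /nu tpair_tmap -[RHS]conv_unitl.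
  rewrite [LHS](_ : _ = conv (g \o @antip K A) (conv g h) a) // convA.
  rewrite /conv /=; move: (Delta a).
  apply: tens_ind => [|t t' ht ht'|x y]; first by rewrite !linear0.
    by rewrite !linearD /= ht ht'.
  rewrite !tpair_tens /=.
  rewrite [LHS](_ : _ = tpair (g \o @antip K A) (g \o idfun) (Delta x) * h y) //.
  rewrite (lift_pair ker_sq pg) ?ph //.
  have := conv_antipl x; rewrite /conv /= => ->.
  by rewrite /unitmap linearZ_LR /= g1.
have tauG a b : tau G a b = 0.
  have kD := coact_defect g_even pg a b.
  have -> : tau G a b = nu g (coact G a * coact G b - coact G (a * b)).
    exact/nuG/(coact_defect G_even pG).
  rewrite !coactG mulrDl !mulrDr (ker0 _ _ (kerH a) (kerH b)) addr0.
  rewrite opprD addrACA [X in X + _]addrAC.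
  rewrite 2!(linearD (nu g)) (linearB (nu g) (H a * _)) /=.
  rewrite (nu_coactl ker_sq g_even pg) //.
  rewrite (nu_coactr p_even ker_sq g_even pg) // !nuH.
  rewrite -/(tau g a b) tauE.
  by rewrite [_ - _ - _]addrAC subrK addrA subrK subrr.
have GM := tau0_morphism ker_sq G_even pG G1 tauG.
have G_mon : monoid_morphism G by split.
exists (HB.pack G0 (GRing.isLinear.Build K A B *:%R G0 G0_lin)
  (GRing.isMonoidMorphism.Build A B G0 G_mon) : {lrmorphism A -> B}) => //=.
Qed.

End SquareZeroLift.

Section QuotientFactorization.
Variables (K : fieldType) (B C : algType K) (I : tsideal B).
Variable f : {lrmorphism B -> C}.
Hypothesis fI : forall x, x \in I -> f x = 0.

Definition aq_factor (y : algquot I) : C := f (repr y).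

Lemma aq_factorE x : aq_factor (algproj I x) = f x.
Proof.
apply/eqP; rewrite -subr_eq0 -rmorphB; apply/eqP/fI; exact: aq_repr.
Qed.

Lemma aq_factor_is_linear : linear aq_factor.
Proof.
move=> k x y; have [a <-] := algproj_surj x; have [b <-] := algproj_surj y.
have <- : algproj I (k *: a + b) = k *: algproj I a + algproj I b.
  by rewrite linearP.
by rewrite !aq_factorE linearP.
Qed.

Lemma aq_factor_is_monoid_morphism : monoid_morphism aq_factor.
Proof.
split=> [|x y].
  have <- : algproj I 1 = 1 by rewrite rmorph1.
  by rewrite aq_factorE rmorph1.
have [a <-] := algproj_surj x; have [b <-] := algproj_surj y.
by rewrite -rmorphM !aq_factorE rmorphM.
Qed.

Definition aq_lift : {lrmorphism algquot I -> C} :=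
  HB.pack aq_factor
    (GRing.isLinear.Build K (algquot I) C *:%R aq_factor aq_factor_is_linear)
    (GRing.isMonoidMorphism.Build (algquot I) C aq_factor aq_factor_is_monoid_morphism).

Lemma aq_liftE x : aq_lift (algproj I x) = f x.
Proof. exact: aq_factorE. Qed.

End QuotientFactorization.

Lemma algproj_even (K : fieldType) (B : superAlgType K) (I : superideal B) :
  even_map (algproj I).
Proof. by move=> i x xi; apply/sq_degP; exists x. Qed.

Section Annihilator.
Variables (K : fieldType) (B C : superAlgType K) (p : {lrmorphism B -> C}).

Lemma component_mulr k j (x y : B) :
  y \in deg j -> component k (x * y) = component (k (+) j) x * y.
Proof.
move=> yj; rewrite {1}[x]componentD mulrDl linearD /=.
have h i : component i x * y \in deg (i (+) j) by rewrite deg_M ?component_deg.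
rewrite !(component_id _ (h _)).
by case: k j {yj h} => [] []; rewrite /= ?addr0 ?add0r.
Qed.

(** The elements of ker p that annihilate ker p. The evenness of [p] is an argument so that the
    graded ideal structure, which depends on it, can be attached to the predicate. *)
Definition ker_ann of even_map p : {pred B} :=
  [pred x | (p x == 0) && `[< forall y, p y = 0 -> x * y = 0 >]].

Variable p_even : even_map p.

Lemma ker_annP x : reflect (p x = 0 /\ forall y, p y = 0 -> x * y = 0)
  (x \in ker_ann p_even).
Proof.
by apply: (iffP andP) => [[/eqP px /asboolP h]|[px h]]; split=> //;
  [apply/eqP|apply/asboolP].
Qed.

Lemma ker_ann_zmod : zmod_closed (ker_ann p_even).
Proof.
split=> [|x y /ker_annP[px hx] /ker_annP[py hy]]; apply/ker_annP.
  by split=> [|y _]; rewrite ?linear0 ?mul0r.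
by split=> [|z pz]; rewrite ?rmorphB /= ?px ?py ?subrr // mulrBl hx ?hy ?subrr.
Qed.
HB.instance Definition _ :=
  GRing.isZmodClosed.Build B (ker_ann p_even) ker_ann_zmod.

Lemma ker_ann1 : 1 \notin ker_ann p_even.
Proof. by apply/ker_annP => -[/eqP]; rewrite rmorph1 oner_eq0. Qed.
Lemma ker_annMl (a x : B) : x \in ker_ann p_even -> a * x \in ker_ann p_even.
Proof.
move=> /ker_annP[px hx]; apply/ker_annP; split=> [|y py].
  by rewrite rmorphM /= px mulr0.
by rewrite -mulrA hx ?mulr0.
Qed.
Lemma ker_annMr (a x : B) : x \in ker_ann p_even -> x * a \in ker_ann p_even.
Proof.
move=> /ker_annP[px hx]; apply/ker_annP; split=> [|y py].
  by rewrite rmorphM /= px mul0r.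
by rewrite -mulrA hx // rmorphM /= py mulr0.
Qed.
HB.instance Definition _ :=
  isTwoSidedIdeal.Build B (ker_ann p_even) ker_ann1 ker_annMl ker_annMr.

Lemma ker_ann_graded i (x : B) :
  x \in ker_ann p_even -> component i x \in ker_ann p_even.
Proof.
move=> /ker_annP[px hx]; have pc j y : p (component j y) = component j (p y).
  exact: even_map_component.
apply/ker_annP; split=> [|y py]; first by rewrite pc px linear0.
have h j : component i x * component j y = 0.
  rewrite -[i](addbK j) -component_mulr ?component_deg //.
  by rewrite hx ?linear0 // pc py linear0.
by rewrite [y]componentD mulrDr !h addr0.
Qed.
HB.instance Definition _ :=
  isGraded.Build K B (ker_ann p_even) ker_ann_graded.

End Annihilator.

Section NilpotentLift.
Variables (K : fieldType) (A : comHopfSuperAlgType K).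
Hypothesis smA : smooth_at_identity A.

(** Dividing [B] by the elements of ker p that annihilate ker p lowers the order of nilpotency by
    one, because a product of n.+1 elements of the kernel is such an element; the quotient map
    itself has a kernel of square zero. *)
Lemma nilpotent_lift n (B C : comSuperAlgType K) (p : {lrmorphism B -> C})
    (f : {lrmorphism A -> C}) :
  even_map p -> (forall c, exists b, p b = c) -> even_map f ->
  (forall s : seq B, size s = n -> (forall x, x \in s -> p x = 0) ->
     \prod_(x <- s) x = 0) ->
  exists2 h : {lrmorphism A -> B}, even_map h & forall a, p (h a) = f a.
Proof.
elim: n B C p f => [|[|n] IHn] B C p f p_even p_surj f_even nil_p.
(* The empty product is 1, so order 0 is impossible. *)
- by have /eqP := nil_p [::] erefl (fun _ => ltac:(by []));
    rewrite big_nil oner_eq0.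
- apply: square_zero_lift => // x y px py.
  have := nil_p [:: x] erefl; rewrite big_seq1 => ->; first exact: mul0r.
  by move=> z; rewrite inE => /eqP ->.
pose I : superideal B := ker_ann p_even.
have pI x : x \in I -> p x = 0 by case/ker_annP.
pose q : {lrmorphism B -> algquot I} := algproj I; pose p' := aq_lift pI.
have p'E x : p' (q x) = p x by apply: aq_liftE.
have p'_even : even_map p'.
  by move=> i y /sq_degP[x xi <-]; rewrite p'E; exact: (p_even _ _ xi).
have p'_surj c : exists y, p' y = c.
  by have [b <-] := p_surj c; exists (q b); rewrite p'E.
have [|f' f'_even f'E] := IHn (algquot I) C p' f p'_even p'_surj f_even.
  move=> s sz kers; pose s' := [seq repr y | y <- s].
  have sE : s = [seq q x | x <- s'].
    rewrite -map_comp -[LHS]map_id; apply: eq_map => y.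
    by have [x <-] := algproj_surj y; rewrite /= /q /algproj reprK.
  have kers' x : x \in s' -> p x = 0.
    by move=> xs'; rewrite -p'E; apply: kers; rewrite sE map_f.
  have -> : \prod_(y <- s) y = q (\prod_(x <- s') x).
    by rewrite sE big_map rmorph_prod.
  apply/algproj_eq0/ker_annP; split=> [|y py].
    have sz' : size s' = n.+1 by rewrite size_map.
    rewrite rmorph_prod; case: (s') kers' sz' => [//|x r] h _.
    by rewrite big_cons /= h ?mem_head // mul0r.
  have <- : \prod_(x <- rcons s' y) x = (\prod_(x <- s') x) * y.
    by rewrite -cats1 big_cat big_seq1.
  apply: nil_p; first by rewrite size_rcons size_map sz.
  by move=> x; rewrite mem_rcons inE => /orP[/eqP -> //|/kers'].
have q_surj y : exists x, q x = y by apply: algproj_surj.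
have [|h h_even hE] := @square_zero_lift K A B (algquot I) smA q f'
  (@algproj_even K B I) q_surj _ f'_even.
  by move=> x y /algproj_eq0/ker_annP[_ hx] /algproj_eq0/ker_annP[py _]; apply: hx.
exists h => // a; rewrite -p'E -f'E; congr (p' _); exact: hE.
Qed.

Lemma smooth_at_identity_super_smooth : super_smooth A.
Proof.
move=> B J [n nilJ] f f_even.
apply: (@nilpotent_lift n _ _ (algproj J) f) => //.
- exact: algproj_even.
- exact: algproj_surj.
by move=> s sz kers; apply: nilJ => // x /kers /algproj_eq0.
Qed.

End NilpotentLift.

(** * Purely even superalgebras *)

Definition purely_even (K : fieldType) (B : comAlgType K) : Type := B.

Section PurelyEven.
Variables (K : fieldType) (B : comAlgType K).
Local Notation Be := (purely_even B).
HB.instance Definition _ := GRing.ComAlgebra.on Be.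

Definition even_deg (i : bool) : {pred Be} := [pred x : Be | ~~ i || (x == 0)].

Lemma even_deg_submod i : submod_closed (even_deg i).
Proof.
split=> [|k x y]; rewrite !inE ?eqxx ?orbT //.
by case: i => //= /eqP -> /eqP ->; rewrite scaler0 addr0.
Qed.
Lemma even_decomp (a : Be) : exists x : Be * Be,
  [/\ x.1 \in even_deg false, x.2 \in even_deg true & a = x.1 + x.2].
Proof. by exists (a, 0); split; rewrite ?inE /= ?eqxx ?addr0. Qed.
Lemma even_disjoint (a : Be) : a \in even_deg false -> a \in even_deg true -> a = 0.
Proof. by move=> _ /eqP. Qed.
Lemma even_1 : 1 \in even_deg false. Proof. by []. Qed.
Lemma even_M i j (a b : Be) :
  a \in even_deg i -> b \in even_deg j -> a * b \in even_deg (i (+) j).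
Proof.
rewrite !inE; case: i j => [] [] //= h1 h2.
  by rewrite (eqP h1) mul0r.
by rewrite (eqP h2) mulr0.
Qed.
HB.instance Definition _ := isSuperAlgebra.Build K Be
  even_deg_submod even_decomp even_disjoint even_1 even_M.

Lemma even_supermulC i j (a b : Be) : a \in deg i -> b \in deg j ->
  a * b = (-1) ^+ (i && j) * (b * a).
Proof.
case: i j => [] [] a0 b0; rewrite ?mul1r ?[a * b]mulrC //.
by rewrite (eqP a0) !(mul0r, mulr0).
Qed.
HB.instance Definition _ := isSuperCommutative.Build K Be even_supermulC.

Definition even_ideal (J : tsideal B) : {pred Be} := [pred x : Be | (x : B) \in J].

Section EvenIdeal.
Variable J : tsideal B.

Lemma even_ideal_zmod : zmod_closed (even_ideal J).
Proof.
split=> [|x y]; first by rewrite inE rpred0.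
by rewrite !inE => xJ yJ; apply: rpredB.
Qed.
HB.instance Definition _ :=
  GRing.isZmodClosed.Build Be (even_ideal J) even_ideal_zmod.

Lemma even_ideal1 : 1 \notin even_ideal J. Proof. exact: tsideal1. Qed.
Lemma even_idealMl (a x : Be) : x \in even_ideal J -> a * x \in even_ideal J.
Proof. exact: tsidealMl. Qed.
Lemma even_idealMr (a x : Be) : x \in even_ideal J -> x * a \in even_ideal J.
Proof. exact: tsidealMr. Qed.
HB.instance Definition _ := isTwoSidedIdeal.Build Be (even_ideal J)
  even_ideal1 even_idealMl even_idealMr.

Lemma even_ideal_graded i (x : Be) :
  x \in even_ideal J -> component i x \in even_ideal J.
Proof.
move=> xJ; have x0 : x \in deg false by [].
by rewrite (component_id _ x0); case: ifP => // _; rewrite rpred0.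
Qed.
HB.instance Definition _ := isGraded.Build K Be (even_ideal J) even_ideal_graded.

End EvenIdeal.
End PurelyEven.

(** A commutative algebra is a superalgebra without odd part. An even lift from [A] into it kills
    the odd elements and so factors through the quotient by the ideal that they generate. *)
Lemma super_smooth_smooth_bosonic (K : fieldType) (A : comHopfSuperAlgType K) :
  super_smooth A -> smooth (bosonic A).
Proof.
move=> smA B J nilJ f.
pose Je : superideal (purely_even B) := even_ideal J.
pose pe : {lrmorphism B -> algquot Je} := algproj Je.
have peJ x : x \in J -> pe x = 0 by move=> xJ; apply/algproj_eq0.
(* The quotient by [J] and the quotient by [J] as a graded ideal are different types; [q] compares
   them and is injective. *)
pose q : {lrmorphism algquot J -> algquot Je} := aq_lift peJ.
have q_inj x y : q x = q y -> x = y.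
  have [a <-] := algproj_surj x; have [b <-] := algproj_surj y.
  rewrite !aq_liftE => /algproj_eq h; apply/algproj_eq; exact: h.
pose pA : {lrmorphism A -> algquot (odd_ideal A)} := algproj (odd_ideal A).
pose f0 : {lrmorphism algquot (odd_ideal A) -> algquot J} := f.
pose F : {lrmorphism A -> algquot Je} := q \o (f0 \o pA).
have pA_odd a : a \in deg true -> pA a = 0.
  by move=> a1; apply/algproj_eq0/odd_ideal_deg.
have F_even : even_map F.
  move=> [] a ai.
    have -> : F a = 0 by rewrite [LHS](_ : _ = q (f0 (pA a))) // pA_odd // !rmorph0.
    exact: rpred0.
  have [b <-] : exists b, pe b = F a by apply: algproj_surj.
  by apply: algproj_even.
have [|g g_even gE] := smA (purely_even B) Je _ F F_even.
  by case: nilJ => n nilJ; exists n => s sz sJ; apply: nilJ.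
have g_odd x : x \in odd_ideal A -> g x = 0.
  case/odd_idealP => s sP ->; rewrite rmorph_sum big_seq big1 // => t /sP t1.
  rewrite !rmorphM /=; have /eqP -> := g_even true _ t1.
  by rewrite mulr0 mul0r.
pose h : {lrmorphism algquot (odd_ideal A) -> B} := aq_lift g_odd.
exists h => x; have [a <-] := algproj_surj x.
apply: q_inj; rewrite [h _]aq_liftE.
transitivity (pe (g a)); first exact: aq_liftE.
exact: gE.
Qed.

(** * Noetherianity and Krull's intersection theorem *)

Section Noetherian.
Variables (K : fieldType) (E : comSuperAlgType K).
Implicit Types (l w : seq E) (U N : E -> Prop).

Lemma even_central (b x : E) : b \in deg false -> b * x = x * b.
Proof.
move=> b0; move: x; apply: super_ind => [x y hx hy|i x xi].
  by rewrite mulrDr mulrDl hx hy.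
by rewrite (supermulC _ _ _ _ b0 xi) mul1r.
Qed.

Lemma subspace_sign U (b : bool) x : subspace U -> U x -> U ((-1) ^+ b * x).
Proof. by move=> sU Ux; rewrite mulr_sign; case: b => //; exact: subspaceN. Qed.

(** A module over the algebra generated by the even letters, expressed through the letters alone.
    Even letters are central and can play the part of polynomial variables. *)
Definition even_stable l U :=
  subspace U /\
  forall b, b \in l -> b \in deg false -> forall u, U u -> U (b * u).

Definition fin_generated l U := exists us : seq E, (forall u, u \in us -> U u) /\
  forall U', even_stable l U' -> (forall u, u \in us -> U' u) ->
  forall u, U u -> U' u.

Definition noetherian l N := forall U, even_stable l U -> (forall u, U u -> N u) ->
  fin_generated l U.

Lemma noetherian_chain l N (U : nat -> E -> Prop) : noetherian l N ->
    (forall n, even_stable l (U n)) -> (forall n u, U n u -> N u) ->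
    (forall n u, U n u -> U n.+1 u) ->
  exists d, forall n u, U n u -> U d u.
Proof.
move=> noeN stU UN Umono.
have mono m n u : (m <= n)%N -> U m u -> U n u.
  by move=> /subnK <-; elim: (n - m)%N => // k IHk /IHk; apply: Umono.
pose V u := exists n, U n u.
have [||us [Vus genV]] := noeN V.
- split=> [|b bl b0 u [n Un]]; last by exists n; apply: (stU n).2.
  split=> [|k x y [m Um] [n Un]]; first by exists 0%N; apply: (stU 0%N).1.1.
  exists (maxn m n); apply: (stU _).1.2.
    exact: mono (leq_maxl _ _) Um.
  exact: mono (leq_maxr _ _) Un.
- by move=> u [n Un]; apply: UN Un.
have [d dus] : exists d, forall u, u \in us -> U d u.
  elim: us Vus {genV} => [|u us IHus] Vus; first by exists 0%N.
  have [|d dus] := IHus; first by move=> v vus; apply: Vus; rewrite inE vus orbT.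
  have [n Un] := Vus u (mem_head _ _).
  exists (maxn n d) => v; rewrite inE => /orP[/eqP ->|/dus].
    exact: mono (leq_maxl _ _) Un.
  exact: mono (leq_maxr _ _).
by exists d => n u Un; apply: genV => //; exists n.
Qed.

(** The span of the ordered monomials in the letters, the head of the list standing last. For
    homogeneous letters it contains all words ([poly_span_word]). Its elements are values at one
    letter of polynomials whose coefficients come from the remaining letters, which is the shape
    that Hilbert's basis theorem works on. *)
Fixpoint poly_span l : E -> Prop :=
  if l is x :: l' then fun v => exists f : {poly E},
    (forall j, poly_span l' f`_j) /\ v = f.[x]
  else fun v => exists k : K, v = k%:A.

Lemma poly_span_subspace l : subspace (poly_span l).
Proof.
elim: l => [|x l [IH0 IHL]]; split.
- by exists 0; rewrite scale0r.
- by move=> k _ _ [a ->] [b ->]; exists (k * a + b); rewrite scalerDl scalerA.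
- by exists 0; split=> [j|]; rewrite ?coef0 ?horner0.
move=> k _ _ [f [fN ->]] [g [gN ->]].
exists ((k%:A)%:P * f + g); split=> [j|].
  by rewrite coefD coefCM -scalerAl mul1r; apply: IHL; [exact: fN|exact: gN].
by rewrite hornerD hornerCM -scalerAl mul1r.
Qed.

Lemma poly_span_cons x l v : poly_span l v -> poly_span (x :: l) v.
Proof.
move=> vN; exists v%:P; split=> [j|]; last by rewrite hornerC.
by rewrite coefC; case: ifP => // _; case: (poly_span_subspace l).
Qed.

Lemma poly_span1 l : poly_span l 1.
Proof.
elim: l => [|x l IHl]; first by exists 1; rewrite scale1r.
exact: poly_span_cons.
Qed.

Lemma supermulC_expr (x y : E) i k j : x \in deg i -> y \in deg k ->
  x ^+ j * y = (-1) ^+ (odd j && i && k) * (y * x ^+ j).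
Proof.
move=> xi yk; have : x ^+ j \in deg (odd j && i).
  elim: j => [|j IHj]; first by rewrite expr0 deg_1.
  rewrite exprS; have := deg_M _ _ _ _ xi IHj.
  by rewrite oddS; case: (i) (odd j) => [] [].
by move=> xj; rewrite (supermulC _ _ _ _ xj yk).
Qed.

Lemma poly_span_mulr l v y : all_homogeneous l -> y \in l ->
  poly_span l v -> poly_span l (v * y).
Proof.
elim: l v => // x l IHl v lh yl [f [fN ->]].
have [->|yx] := eqVneq y x.
  exists (f * 'X); split=> [j|]; last by rewrite hornerMX.
  by rewrite coefMX; case: j => [|j]; [exact: (poly_span_subspace l).1|exact: fN].
have {}yl : y \in l by move: yl; rewrite inE (negPf yx).
have [k yk] : homogeneous y by apply: lh; rewrite inE yl orbT.
have [i xi] : homogeneous x by apply: lh; rewrite mem_head.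
have lh' : all_homogeneous l by move=> z zl; apply: lh; rewrite inE zl orbT.
exists (\poly_(j < size f) ((-1) ^+ (odd j && i && k) * (f`_j * y))); split=> [j|].
  rewrite coef_poly; case: ifP => _; last exact: (poly_span_subspace l).1.
  by apply: subspace_sign; [exact: poly_span_subspace|exact: IHl (fN j)].
rewrite horner_poly horner_coef mulr_suml; apply: eq_bigr => j _.
rewrite -mulrA (supermulC_expr j xi yk) !mulr_sign.
by case: (_ && k); rewrite ?mulrN ?mulNr mulrA.
Qed.

Lemma poly_span_word l w : all_homogeneous l -> {subset w <= l} ->
  poly_span l (\prod_(y <- w) y).
Proof.
move=> lh; elim/last_ind: w => [|w y IHw] wl; first by rewrite big_nil; apply: poly_span1.
rewrite -cats1 big_cat big_seq1; apply: poly_span_mulr => //.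
  by apply: wl; rewrite mem_rcons mem_head.
by apply: IHw => z zw; apply: wl; rewrite mem_rcons inE zw orbT.
Qed.

Lemma poly_span_stable l : all_homogeneous l -> even_stable l (poly_span l).
Proof.
move=> lh; split=> [|b bl b0 u uN]; first exact: poly_span_subspace.
by rewrite even_central //; apply: poly_span_mulr.
Qed.

Hypothesis two_neq0 : 2%:R != 0 :> K.

Lemma odd_sq0 (x : E) : x \in deg true -> x * x = 0.
Proof.
move=> x1; have := supermulC _ _ _ _ x1 x1; rewrite mulN1r => /eqP.
rewrite -subr_eq0 opprK -mulr2n -scaler_nat scaler_eq0 (negPf two_neq0) /=.
by move/eqP.
Qed.

Section HilbertStep.
Variables (x : E) (l : seq E).
Hypothesis xlh : all_homogeneous (x :: l).
Hypothesis noel : noetherian l (poly_span l).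
Variable U : E -> Prop.
Hypothesis stU : even_stable (x :: l) U.
Hypothesis UN : forall u, U u -> poly_span (x :: l) u.

Let lh : all_homogeneous l.
Proof. by move=> z zl; apply: xlh; rewrite inE zl orbT. Qed.

(* The modules of leading coefficients in the proof of Hilbert's basis theorem. *)
Let lead T d c := poly_span l c /\ exists f : {poly E},
  [/\ forall j, poly_span l f`_j, (size f <= d.+1)%N, f`_d = c & T f.[x]].

Let lead_stable T d : even_stable (x :: l) T -> even_stable l (lead T d).
Proof.
move=> [[T0 TL] TM]; have [N0 NL] := poly_span_subspace l; split.
  split; first by split=> //; exists 0; split=> [j|||]; rewrite ?coef0 ?size_poly0 ?horner0.
  move=> k a b [aN [f [fN sf fa Tf]]] [bN [g [gN sg gb Tg]]].
  split; first exact: NL.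
  exists ((k%:A)%:P * f + g); split=> [j|||].
  - by rewrite coefD coefCM -scalerAl mul1r; apply: NL; [exact: fN|exact: gN].
  - rewrite (leq_trans (size_polyD _ _)) // geq_max sg andbT.
    rewrite mul_polyC (leq_trans (size_scale_leq _ _)) //.
  - by rewrite coefD coefCM -scalerAl mul1r fa gb.
  - by rewrite hornerD hornerCM -scalerAl mul1r; apply: TL.
move=> b bl b0 c [cN [f [fN sf fc Tf]]].
have stN := (poly_span_stable lh).2 b bl b0.
split; first exact: stN.
exists (b%:P * f); split=> [j|||].
- by rewrite coefCM; apply: stN.
- by rewrite mul_polyC (leq_trans (size_scale_leq _ _)).
- by rewrite coefCM fc.
by rewrite hornerCM; apply: TM; rewrite // inE bl orbT.
Qed.

(** The module of leading coefficients is finitely generated; each generator is replaced by an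
    element f(x) of [U] that realizes it. *)
Let lead_gens d : exists us : seq E, (forall u, u \in us -> U u) /\
  forall U', even_stable (x :: l) U' -> (forall u, u \in us -> U' u) ->
  forall c, lead U d c -> lead (fun u => U u /\ U' u) d c.
Proof.
have [||cs [csU csg]] := noel (U := lead U d); first exact: lead_stable.
  by move=> c [].
pose F c := exists f : {poly E},
  [/\ forall j, poly_span l f`_j, (size f <= d.+1)%N, f`_d = c & U f.[x]].
have Fc c : exists f : {poly E}, c \in cs ->
    [/\ forall j, poly_span l f`_j, (size f <= d.+1)%N, f`_d = c & U f.[x]].
  by case: (boolP (c \in cs)) => [/csU[_ [f fP]]|_]; [exists f|exists 0].
pose f c := sval (cid (Fc c)).
have fP c : c \in cs -> [/\ forall j, poly_span l (f c)`_j, (size (f c) <= d.+1)%N,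
    (f c)`_d = c & U (f c).[x]] by rewrite /f; case: cid.
exists [seq (f c).[x] | c <- cs]; split=> [_ /mapP[c ccs ->]|U' stU' usU'].
  by case: (fP c ccs).
apply: csg => [|c ccs].
  apply: lead_stable; split; first exact: subspaceI stU.1 stU'.1.
  by move=> b bl b0 u [Uu Uu']; split; [apply: stU.2|apply: stU'.2].
have [fN sf fc Uf] := fP c ccs; split; first by case: (csU c ccs).
exists (f c); split=> //; split=> //; apply: usU'; apply/mapP; by exists c.
Qed.

Let gens_upto D : exists us : seq E, (forall u, u \in us -> U u) /\
  forall U', even_stable (x :: l) U' -> (forall u, u \in us -> U' u) ->
  forall d, (d <= D)%N -> forall c, lead U d c -> lead (fun u => U u /\ U' u) d c.
Proof.
elim: D => [|D [us [usU IH]]].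
  have [us [usU h]] := lead_gens 0; exists us; split=> // U' stU' usU' d.
  by rewrite leqn0 => /eqP ->; apply: h.
have [vs [vsU h]] := lead_gens D.+1; exists (us ++ vs); split=> [u|U' stU' usU' d].
  by rewrite mem_cat => /orP[/usU|/vsU].
rewrite leq_eqVlt => /orP[/eqP ->|dD].
  by apply: h => // u uvs; apply: usU'; rewrite mem_cat uvs orbT.
by apply: IH => // u uus; apply: usU'; rewrite mem_cat uus.
Qed.

(** Subtract from f a polynomial with the same coefficient in degree n - 1 and with value in both
    [U] and [U']; the degree drops and the value stays in [U]. *)
Let descent U' n : even_stable (x :: l) U' ->
  (forall d, (d < n)%N -> forall c, lead U d c -> lead (fun u => U u /\ U' u) d c) ->
  forall f : {poly E}, (forall j, poly_span l f`_j) -> (size f <= n)%N ->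
    U f.[x] -> U' f.[x].
Proof.
move=> stU'; elim: n => [|n IHn] step f fN sf Uf.
  by move: sf; rewrite leqn0 size_poly_eq0 => /eqP ->; rewrite horner0; apply: stU'.1.1.
have [|_ [g [gN sg gc [Ug U'g]]]] := step n (ltnSn n) f`_n.
  by split=> //; exists f.
rewrite -[f](subrK g) hornerD; apply: subspaceD => //; first exact: stU'.1.
apply: IHn => [d dn|j||]; first by apply: step; apply: ltnW.
- by rewrite coefB; apply: subspaceB => //; apply: poly_span_subspace.
- apply/leq_sizeP => j; rewrite leq_eqVlt => /orP[/eqP <-|nj].
    by rewrite coefB gc subrr.
  by rewrite coefB !nth_default ?subrr //; apply: leq_trans nj.
by rewrite hornerD hornerN; apply: subspaceB => //; apply: stU.1.
Qed.

(** For odd x the square of x is zero and only degrees 0 and 1 occur. For even x the modules of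
    leading coefficients increase with the degree and become stationary at some [D], after which no
    new generators are needed. *)
Lemma hilbert_step : fin_generated (x :: l) U.
Proof.
have [k xk] : homogeneous x by apply: xlh; rewrite mem_head.
case: k xk => xk.
  have [us [usU h]] := gens_upto 1; exists us; split=> // U' stU' usU' u Uu.
  have [f [fN uE]] := UN Uu.
  pose g := \poly_(j < 2) f`_j.
  have gN j : poly_span l g`_j.
    by rewrite coef_poly; case: ifP => _; [exact: fN|exact: (poly_span_subspace l).1].
  have fg : f.[x] = g.[x].
    have xn j : x ^+ j.+2 = 0 by rewrite !exprS mulrA odd_sq0 // mul0r.
    rewrite horner_poly (horner_coef_wide x (leq_maxl (size f) 2)).
    rewrite (big_ord_widen_cond _ (fun=> true) (fun j => f`_j * x ^+ j) (leq_maxr (size f) 2)).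
    rewrite [LHS](bigID (fun j : 'I__ => j < 2)%N) /= [X in _ + X]big1 ?addr0 //.
    by move=> [[|[|j]] ?] //= _; rewrite xn mulr0.
  rewrite uE fg; apply: (descent (n := 2) stU') => //; last by rewrite -fg -uE.
    by move=> d d2 c; apply: h.
  exact: size_poly.
(* The value of f * 'X is f(x) x, which stays in [T] because x is an even letter. *)
have shift T d : even_stable (x :: l) T ->
    forall c, lead T d c -> lead T d.+1 c.
  move=> stT c [cN [f [fN sf fc Tf]]]; split=> //; exists (f * 'X); split=> [j|||].
  - by rewrite coefMX; case: j => [|j]; [exact: (poly_span_subspace l).1|exact: fN].
  - by rewrite (leq_trans (size_polyMleq _ _)) // size_polyX addn2.
  - by rewrite coefMX.
  by rewrite hornerMX -even_central //; apply: stT.2; rewrite ?mem_head.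
have [|||D DP] := @noetherian_chain l (poly_span l) (lead U) noel.
- by move=> d; apply: lead_stable.
- by move=> d c [].
- by move=> d; apply: shift.
have [us [usU h]] := gens_upto D; exists us; split=> // U' stU' usU' u Uu.
have [f [fN uE]] := UN Uu; rewrite uE.
apply: (descent (n := size f) stU' _ fN) => //; last by rewrite -uE.
move=> d _ c Uc; have [dD|Dd] := leqP d D; first exact: h Uc.
have stUU' : even_stable (x :: l) (fun u => U u /\ U' u).
  split; first exact: subspaceI stU.1 stU'.1.
  by move=> b bl b0 v [Uv U'v]; split; [apply: stU.2|apply: stU'.2].
have := h U' stU' usU' D (leqnn D) c (DP d c Uc).
rewrite -(subnK (ltnW Dd)); elim: (d - D)%N => // m IHm /IHm; exact: shift.
Qed.

End HilbertStep.

Lemma hilbert l : all_homogeneous l -> noetherian l (poly_span l).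
Proof.
elim: l => [|x l IHl] lh U stU UN; last first.
  by apply: hilbert_step => //; apply: IHl => z zl; apply: lh; rewrite inE zl orbT.
(* Without letters [U] lies in the line K 1, so any nonzero element generates it. *)
have [[u [Uu u0]]|noU] := pselect (exists u, U u /\ u != 0); last first.
  exists [::]; split=> // U' stU' _ u Uu.
  have [->|u0] := eqVneq u 0; first exact: stU'.1.1.
  by case: noU; exists u.
exists [:: u]; split=> [v|U' stU' usU' v Uv]; first by rewrite inE => /eqP ->.
have U'u := usU' u (mem_head _ _).
have [a uE] := UN u Uu; have [b vE] := UN v Uv.
have a0 : a != 0 by apply: contra u0 => /eqP a0; rewrite uE a0 scale0r.
have -> : v = (b / a) *: u by rewrite uE vE scalerA divfK.
by apply: subspaceZ => //; apply: stU'.1.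
Qed.

End Noetherian.

(** * Linear combinations of words in finitely many letters *)

Definition long (T : Type) n (w : seq T) : Prop := (n <= size w)%N.

Section WordSpan.
Variables (K : fieldType) (E : algType K) (G : seq E).
Implicit Types (P Q : seq E -> Prop).

(** For [P] = [long n] this is the n-th power of the ideal that the letters generate in the unital
    subalgebra generated by them; n = 0 gives the subalgebra. *)
Definition word_span P (u : E) : Prop := exists2 s : seq (K * seq E),
  forall t, t \in s -> {subset t.2 <= G} /\ P t.2
  & u = \sum_(t <- s) t.1 *: \prod_(y <- t.2) y.

Lemma word_span_subspace P : subspace (word_span P).
Proof.
split=> [|k _ _ [s sP ->] [r rP ->]]; first by exists [::]; rewrite // big_nil.
exists ([seq (k * t.1, t.2) | t <- s] ++ r) => [t|].
  by rewrite mem_cat => /orP[/mapP[q /sP qP ->]|/rP].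
rewrite big_cat big_map scaler_sumr /=; congr (_ + _).
by apply: eq_bigr => t _; rewrite scalerA.
Qed.

Lemma word_span_word P w : {subset w <= G} -> P w -> word_span P (\prod_(y <- w) y).
Proof.
move=> wG Pw; exists [:: (1, w)]; last by rewrite big_seq1 scale1r.
by move=> t; rewrite inE => /eqP ->.
Qed.

Lemma word_span_min P (U : E -> Prop) : subspace U ->
  (forall w, {subset w <= G} -> P w -> U (\prod_(y <- w) y)) ->
  forall u, word_span P u -> U u.
Proof.
move=> sU UP _ [s sP ->]; apply: subspace_sum => // t /sP[tG Pt].
by apply: subspaceZ => //; apply: UP.
Qed.

Lemma word_spanS P Q : (forall w, P w -> Q w) ->
  forall u, word_span P u -> word_span Q u.
Proof. by move=> PQ u [s sP ->]; exists s => // t /sP[? /PQ]. Qed.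

Lemma word_spanM P Q R : (forall v w, P v -> Q w -> R (v ++ w)) ->
  forall x y, word_span P x -> word_span Q y -> word_span R (x * y).
Proof.
move=> PQR x y Px Qy; have sR := word_span_subspace R.
apply: (word_span_min (P := P) (U := fun x => word_span R (x * y))) Px.
  split=> [|k a b]; first by rewrite mul0r; case: sR.
  by rewrite mulrDl -scalerAl; apply: sR.2.
move=> v vG Pv.
apply: (word_span_min (P := Q) (U := fun y => word_span R (_ * y))) Qy.
  split=> [|k a b]; first by rewrite mulr0; case: sR.
  by rewrite mulrDr -scalerAr; apply: sR.2.
move=> w wG Qw; rewrite -big_cat; apply: word_span_word; last exact: PQR.
by move=> z; rewrite mem_cat => /orP[/vG|/wG].
Qed.

Lemma word_span_letter y : y \in G -> word_span (long 1) y.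
Proof.
move=> yG; have := @word_span_word (long 1) [:: y]; rewrite big_seq1; apply=> //.
by move=> z; rewrite inE => /eqP ->.
Qed.

Lemma word_span1 : word_span (long 0) 1.
Proof.
have := @word_span_word (long 0) [::]; rewrite big_nil; apply=> //.
Qed.

Lemma word_spanMn m n x y : word_span (long m) x -> word_span (long n) y ->
  word_span (long (m + n)) (x * y).
Proof.
by apply: word_spanM => v w; rewrite /long size_cat; apply: leq_add.
Qed.

Lemma word_span_leq m n u : (m <= n)%N -> word_span (long n) u -> word_span (long m) u.
Proof. by move=> mn; apply: word_spanS => w; apply: leq_trans. Qed.

End WordSpan.

Section SuperWords.
Variables (K : fieldType) (E : comSuperAlgType K).
Implicit Types (y : E) (w : seq E).

Lemma prod_rem y w : all_homogeneous w -> y \in w ->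
  exists b : bool, \prod_(z <- w) z = (-1) ^+ b * (y * \prod_(z <- rem y w) z).
Proof.
elim: w => // x w IHw wh; rewrite inE => yw.
have [<-|xy] := eqVneq x y.
  by exists false; rewrite /= eqxx big_cons mul1r.
have {}yw : y \in w by move: yw; rewrite eq_sym (negPf xy).
have wh' : all_homogeneous w by move=> z zw; apply: wh; rewrite inE zw orbT.
have [b bE] := IHw wh' yw; rewrite /= (negPf xy) !big_cons bE.
have [i xi] : homogeneous x by apply: wh; rewrite mem_head.
have [j yj] : homogeneous y by apply: wh'.
exists (b (+) (i && j)).
rewrite signr_addb; set P := \prod_(z <- rem y w) z.
have e : x * (y * P) = (-1) ^+ (i && j) * (y * (x * P)).
  by rewrite mulrA (supermulC _ _ _ _ xi yj) -!mulrA.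
by rewrite -mulrA -e !(mulr_sign b); case: ifP; rewrite ?mulrN.
Qed.

Lemma prod_count y w e : all_homogeneous w -> (e <= count_mem y w)%N ->
  exists b : bool, exists2 r, {subset r <= w} &
    \prod_(z <- w) z = (-1) ^+ b * (y ^+ e * \prod_(z <- r) z).
Proof.
elim: e w => [|e IHe] w wh ew; first by exists false, w; rewrite // !mul1r.
have yw : y \in w by rewrite -has_pred1 has_count (leq_trans _ ew).
have [b ->] := prod_rem wh yw.
have [||c [r rw ->]] := IHe (rem y w).
- by move=> z /mem_rem; apply: wh.
- by rewrite count_mem_rem eqxx -(leq_add2r 1) subnK ?addn1 // (leq_trans _ ew).
exists (b (+) c), r; first by move=> z /rw/mem_rem.
rewrite signr_addb exprS -!mulrA; congr (_ * _).
by rewrite !(mulr_sign c); case: ifP; rewrite ?mulrN -?mulrA.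
Qed.

Lemma pigeonhole (G w : seq E) e : {subset w <= G} -> (size G * e < size w)%N ->
  exists2 y, y \in G & (e <= count_mem y w)%N.
Proof.
move=> wG; case: (boolP (has (fun y => e <= count_mem y w)%N G)) => [/hasP[y yG ey] _|].
  by exists y.
rewrite -all_predC => /allP h; rewrite ltnNge => /negP[].
have -> : size w = (\sum_(y <- undup G) count_mem y w)%N.
  transitivity (\sum_(z <- w) \sum_(y <- undup G) (z == y))%N.
    rewrite -sum1_size big_seq [RHS]big_seq; apply: eq_bigr => z zw.
    rewrite -big_mkcond /= sum1_count (eq_count (a2 := pred1 z)) => [|y]; last exact: eq_sym.
    rewrite count_uniq_mem ?undup_uniq // mem_undup.
    by rewrite wG.
  rewrite exchange_big /=; apply: eq_bigr => y _.
  by rewrite -sum1_count [RHS]big_mkcond.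
apply: (@leq_trans (\sum_(y <- undup G) e)%N).
  rewrite big_seq [X in (_ <= X)%N]big_seq; apply: leq_sum => y.
  by rewrite mem_undup => /h /=; rewrite -ltnNge => /ltnW.
by rewrite big_const_seq count_predT iter_addn_0 mulnC leq_mul2r size_undup orbT.
Qed.

End SuperWords.

Section Krull.
Variables (K : fieldType) (E : comSuperAlgType K) (G : seq E).
Hypothesis two_neq0 : 2%:R != 0 :> K.
Hypothesis Gh : all_homogeneous G.
Variable u : E.
Hypothesis u_ann : forall b, b \in G -> b \in deg false -> b * u = 0.

Let N := poly_span G.
Let stN : even_stable G N. Proof. exact: poly_span_stable. Qed.

Let Nexp b e v : b \in G -> b \in deg false -> N v -> N (b ^+ e * v).
Proof.
move=> bG b0 Nv; elim: e => [|e IHe]; first by rewrite mul1r.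
by rewrite exprS -mulrA; apply: stN.2.
Qed.

(** An argument in the style of Artin and Rees. [V] starts as 0 and is enlarged for one even letter
    b at a time to V + b^n N, with n so large that for v in [N], b^(n+1) v in [V] already forces b^n
    v in [V]. As b annihilates u, this keeps u outside. *)
Let chain (bs : seq E) : u != 0 -> {subset bs <= G} ->
  exists V : E -> Prop, [/\ even_stable G V, ~ V u &
    forall b, b \in bs -> b \in deg false ->
      exists e, forall f v, (e <= f)%N -> N v -> V (b ^+ f * v)].
Proof.
move=> u0; elim: bs => [|b bs IHbs] bsG.
  exists (fun x => x = 0); split=> //; last by apply/eqP.
  by split=> [|b _ _ _ ->]; [exact: subspace0|rewrite mulr0].
have [|V [stV Vu Vbs]] := IHbs; first by move=> z zbs; apply: bsG; rewrite inE zbs orbT.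
have bG : b \in G by apply: bsG; rewrite mem_head.
have [k bk] := Gh bG; case: k bk => bk.
  exists V; split=> // c; rewrite inE => /orP[/eqP ->|/Vbs //] c0.
  have b0 : b = 0 by apply: deg_disjoint.
  exists 1%N => -[//|f] v _ _; rewrite b0 expr0n mul0r; exact: stV.1.1.
(* An ascending chain of submodules of the Noetherian module [N]; n is where it becomes
   stationary. *)
pose U n v := N v /\ V (b ^+ n * v).
have comm c n v : c \in deg false -> b ^+ n * (c * v) = c * (b ^+ n * v).
  by move=> c0; rewrite !mulrA (even_central (b ^+ n) c0).
have [|||n nP] := @noetherian_chain K E G N U (hilbert two_neq0 Gh).
- move=> n; split=> [|c cG c0 v [Nv Vv]]; last first.
    by split; [exact: stN.2|rewrite comm //; apply: stV.2].
  split; first by split; [exact: stN.1.1|rewrite mulr0; exact: stV.1.1].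
  move=> a x y [Nx Vx] [Ny Vy]; split; first exact: stN.1.2.
  by rewrite mulrDr -scalerAr; apply: stV.1.2.
- by move=> n v [].
- by move=> n v [Nv Vv]; split=> //; rewrite exprS -mulrA; apply: stV.2.
pose V' v := exists c w, [/\ V c, N w & v = c + b ^+ n * w].
have VV' v : V v -> V' v.
  by move=> Vv; exists v, 0; split=> //; [exact: stN.1.1|rewrite mulr0 addr0].
exists V'; split.
- split=> [|c cG c0 v [x [w [Vx Nw ->]]]]; last first.
    exists (c * x), (c * w); split; [exact: stV.2|exact: stN.2|].
    by rewrite mulrDr comm.
  split; first by apply: VV'; exact: stV.1.1.
  move=> a _ _ [x [w [Vx Nw ->]]] [y [z [Vy Nz ->]]].
  exists (a *: x + y), (a *: w + z); split; [exact: stV.1.2|exact: stN.1.2|].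
  by rewrite mulrDr -scalerAr scalerDr addrACA.
- move=> [c [w [Vc Nw uE]]]; apply: Vu; rewrite uE; apply: subspaceD => //.
    exact: stV.1.
  (* From u = c + b^n w and b u = 0 one gets b^(n+1) w = - b c in [V]. Stationarity puts b^n w, and
     with it u, into [V]. *)
  have [_ //] : U n w; apply: (nP n.+1); split=> //.
  rewrite exprS -mulrA; have : b * u = 0 by apply: u_ann.
  rewrite uE mulrDr => /eqP; rewrite addrC addr_eq0 => /eqP ->.
  by apply: subspaceN; [exact: stV.1|apply: stV.2].
move=> c; rewrite inE => /orP[/eqP -> _|cbs c0]; last first.
  by have [e eP] := Vbs c cbs c0; exists e => f v ef Nv; apply/VV'/eP.
exists n => f v nf Nv; exists 0, (b ^+ (f - n) * v); split.
- exact: stV.1.1.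
- exact: Nexp.
by rewrite add0r mulrA -exprD subnKC.
Qed.

(** Otherwise take [V] from [chain] for all letters. Odd letters have square zero, so a common
    exponent e sends [N] into [V] for every letter. A word with more than size G * e letters repeats
    one of them e times and lies in [V]; hence so does u, a contradiction. *)
Lemma krull_intersection : (forall n, word_span G (long n) u) -> u = 0.
Proof.
move=> uW; apply/eqP; case: (boolP (u == 0)) => // u0; exfalso.
have [//|V [stV Vu VG]] := @chain G u0.
have eG y : y \in G -> exists e, forall f v, (e <= f)%N -> N v -> V (y ^+ f * v).
  move=> yG; have [k yk] := Gh yG; case: k yk => yk; last exact: VG.
  exists 2%N => -[|[|f]] // v _ _; rewrite !exprS mulrA (odd_sq0 two_neq0 yk) !mul0r.
  exact: stV.1.1.
have [e eP] : exists e, forall y, y \in G -> forall v, N v -> V (y ^+ e * v).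
  suff [e eP] : exists e, forall y, y \in G -> forall f v, (e <= f)%N -> N v -> V (y ^+ f * v).
    by exists e => y yG v; apply: eP.
  elim: (G) eG => [|y l IHl] lP; first by exists 0%N.
  have [e1 e1P] := lP y (mem_head _ _).
  have [|e2 e2P] := IHl; first by move=> z zl; apply: lP; rewrite inE zl orbT.
  exists (maxn e1 e2) => z; rewrite inE => /orP[/eqP ->|zl] f v;
    rewrite geq_max => /andP[? ?]; [exact: e1P|exact: e2P].
apply: Vu; have := uW (size G * e).+1; apply: word_span_min; first exact: stV.1.
move=> w wG /(pigeonhole wG)[y yG yw].
have wh : all_homogeneous w by move=> z /wG/Gh.
have [b [r rw ->]] := prod_count wh yw.
apply: subspace_sign; first exact: stV.1.
by apply: eP => //; apply: poly_span_word => // z /rw/wG.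
Qed.

End Krull.

(** * Finite subcoalgebras and words in finitely many letters *)

Definition in_span (K : fieldType) (V : lmodType K) (Z : seq V) (v : V) : Prop :=
  forall U : V -> Prop, subspace U -> (forall z, z \in Z -> U z) -> U v.

Section DualBasis.
Variables (K : fieldType) (V : lmodType K) (U : V -> Prop).
Hypothesis sU : subspace U.

(** A basis of the span of [s] modulo [U], with its coordinate functionals extended to all of [V]
    and zero on [U]. A vector is added only if its remainder [r v] is outside [U], and that
    remainder becomes the new basis element. *)
Lemma exists_dual_basis (s : seq V) :
  exists n (x : 'I_n -> V) (phi : 'I_n -> {linear V -> K^o}),
  [/\ forall i j, phi i (x j) = (i == j)%:R,
      forall i u, U u -> phi i u = 0,
      forall i, in_span s (x i) &
      forall v, v \in s -> U (v - \sum_i phi i v *: x i)].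
Proof.
elim: s => [|v s [n [x [phi [phix phiU xs sP]]]]].
  by exists 0%N, (fun=> 0), (fun=> \0); split=> // -[].
have xs' i : in_span (v :: s) (x i).
  by move=> T sT Ts; apply: (xs i) => // z zs; apply: Ts; rewrite inE zs orbT.
pose r w := w - \sum_i phi i w *: x i.
have rx j : r (x j) = 0.
  rewrite /r (bigD1 j) //= phix eqxx scale1r big1 ?addr0 ?subrr // => i ij.
  by rewrite phix (negPf ij) scale0r.
have r_lin : linear r.
  move=> k a b; rewrite /r; under eq_bigr => i _ do rewrite linearP scalerDl.
  rewrite big_split opprD addrACA /= scalerBr scaler_sumr; congr (_ - _ + _).
  by apply: eq_bigr => i _; rewrite scalerA.
pose rl : {linear V -> V} := HB.pack r (GRing.isLinear.Build K V V *:%R r r_lin).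
have [Uv|Uv] := pselect (U (r v)).
  exists n, x, phi; split=> // w; rewrite inE => /orP[/eqP -> //|]; exact: sP.
have phir j w : phi j (r w) = 0.
  rewrite /r linearB linear_sum (bigD1 j) //= linearZ_LR /= phix eqxx.
  rewrite big1 ?addr0; first by rewrite [_ *: _]mulr1 subrr.
  by move=> i ij; rewrite linearZ_LR /= phix eq_sym (negPf ij) scaler0.
have [psi psi1 psi0] := exists_functional (subspace_preim rl sU)
  (v := r v) (fun h => Uv (ltac:(by move: h; rewrite /= {1}/r; under eq_bigr => i _ do
     rewrite phir scale0r; rewrite big1 // subr0))).
pose x' (i : 'I_n.+1) := if unlift ord0 i is Some j then x j else r v.
pose phi' (i : 'I_n.+1) := if unlift ord0 i is Some j then phi j else psi.
exists n.+1, x', phi'; split.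
- move=> i j; rewrite /x' /phi'.
  case: unliftP => [i' ->|->]; case: unliftP => [j' ->|->].
  + by rewrite phix (inj_eq lift_inj).
  + by rewrite phir.
  + by rewrite psi0 //= rx; case: sU.
  + by rewrite psi1 eqxx.
- move=> i u Uu; rewrite /phi'; case: unliftP => [i' _|_]; first exact: phiU.
  apply: psi0; rewrite /= /r big1 ?subr0 // => i' _.
  by rewrite phiU ?scale0r.
- move=> i; rewrite /x'; case: unliftP => [i' _|_] //.
  move=> T sT Ts; apply: subspaceB => //; first by apply: Ts; rewrite mem_head.
  by apply: subspace_sum => // j _; apply: subspaceZ => //; apply: xs'.
move=> w ws; rewrite big_ord_recl.
have -> : \sum_(i < n) phi' (lift ord0 i) w *: x' (lift ord0 i) = \sum_i phi i w *: x i.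
  by apply: eq_bigr => i _; rewrite /phi' /x' liftK.
rewrite /phi' /x' unlift_none opprD addrCA addrC.
move: ws; rewrite inE => /orP[/eqP -> | ws].
  have -> : psi v = 1.
    rewrite -psi1 -[v in psi v](subrK (\sum_i phi i v *: x i)) linearD /= -/(r v).
    rewrite linear_sum big1 ?addr0 // => i _.
    by rewrite linearZ_LR /= psi0 ?scaler0 //= rx; case: sU.
  by rewrite scale1r subrr; case: sU.
have rw : U (r w) by apply: sP.
have -> : psi w = 0.
  rewrite -[w](subrK (\sum_i phi i w *: x i)) linearD /= -/(r w).
  rewrite linear_sum big1 ?addr0 => [|i _].
    rewrite psi0 //= {1}/r big1 ?subr0 // => i _.
    by rewrite phir scale0r.
  by rewrite linearZ_LR /= psi0 ?scaler0 //= rx; case: sU.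
by rewrite scale0r subr0; apply: sP.
Qed.

End DualBasis.

Section FiniteSubcoalgebra.
Variables (K : fieldType) (A : hopfSuperAlgType K).

Section Contraction.
Variables (V : lmodType K) (phi : {linear A -> K^o}).

Lemma lcontr_bilinear : bilinear_for *:%R *:%R (fun (x : A) (v : V) => phi x *: v).
Proof.
split=> [v k x y|u k x y] /=; first by rewrite linearP /= scalerDl scalerA.
by rewrite scalerDr !scalerA mulrC.
Qed.
Definition lcontr : A ⊗ V -> V := tlift (fun x v => phi x *: v).
HB.instance Definition _ := GRing.isLinear.Build K (A ⊗ V)%type V *:%R lcontr
  (tlift_linear lcontr_bilinear).
Lemma lcontr_tens a v : lcontr (a ⊗ v) = phi a *: v.
Proof. exact: tlift_tens lcontr_bilinear _ _. Qed.

Lemma rcontr_bilinear : bilinear_for *:%R *:%R (fun (v : V) (x : A) => phi x *: v).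
Proof.
split=> [v k x y|u k x y] /=; first by rewrite scalerDr !scalerA mulrC.
by rewrite linearP /= scalerDl scalerA.
Qed.
Definition rcontr : V ⊗ A -> V := tlift (fun v x => phi x *: v).
HB.instance Definition _ := GRing.isLinear.Build K (V ⊗ A)%type V *:%R rcontr
  (tlift_linear rcontr_bilinear).
Lemma rcontr_tens v a : rcontr (v ⊗ a) = phi a *: v.
Proof. exact: tlift_tens rcontr_bilinear _ _. Qed.

End Contraction.

Lemma counit_left_sum (V : lmodType K) (f : {linear A -> V}) (a : A) s :
  Delta a = \sum_(q <- s) q.1 ⊗ q.2 -> f a = \sum_(q <- s) eps q.1 *: f q.2.
Proof.
move=> aE; have := @counit_left K A A idfun a; rewrite aE /= => <-.
rewrite [tlift _ _](_ : _ = lcontr (@eps K A : {linear A -> K^o}) (\sum_(q <- s) q.1 ⊗ q.2)) //.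
rewrite (linear_sum (lcontr _)) linear_sum; apply: eq_bigr => q _.
by rewrite /= lcontr_tens linearZ_LR.
Qed.

Lemma counit_right_sum (V : lmodType K) (f : {linear A -> V}) (a : A) s :
  Delta a = \sum_(q <- s) q.1 ⊗ q.2 -> f a = \sum_(q <- s) eps q.2 *: f q.1.
Proof.
move=> aE; have := @counit_right K A A idfun a; rewrite aE /= => <-.
rewrite [tlift _ _](_ : _ = rcontr (@eps K A : {linear A -> K^o}) (\sum_(q <- s) q.1 ⊗ q.2)) //.
rewrite (linear_sum (rcontr _)) linear_sum; apply: eq_bigr => q _.
by rewrite /= rcontr_tens linearZ_LR.
Qed.

Lemma Delta_component k (a : A) : Delta (component k a) = tcomp k (Delta a).
Proof.
have h i : tcomp k (Delta (component i a)) = if k == i then Delta (component i a) else 0.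
  have /tens_degP/tdegP <- := Delta_even (component_deg i a).
  exact: tcomp_id.
by rewrite {2}[a]componentD !linearD /= !h; case: k {h}; rewrite /= ?addr0 ?add0r.
Qed.

Lemma coassoc_rcontr (phi : {linear A -> K^o}) (a : A) :
  rcontr phi (tmap (@Delta K A) idfun (Delta a)) =
  tmap idfun (@rcontr A phi \o @Delta K A) (Delta a).
Proof.
have e (t : ((A ⊗ A) ⊗ A)%type) :
    rcontr phi t = (tmap idfun (@rcontr A phi) \o @tassoc K A A A) t.
  move: t; apply: eq_tens => u v; rewrite /= rcontr_tens.
  move: u; apply: tens_ind => [|x y hx hy|b c].
  - by rewrite tens0l !linear0 ?scaler0.
  - by rewrite tensDl !linearD /= ?scalerDr hx hy.
  by rewrite tassoc_tens tmap_tens /= rcontr_tens tensZr.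
by rewrite e /= coassoc tmap_comp.
Qed.

Lemma coassoc_lcontr (phi : {linear A -> K^o}) (a : A) :
  tmap (@lcontr A phi \o @Delta K A) idfun (Delta a) =
  lcontr phi (tmap idfun (@Delta K A) (Delta a)).
Proof.
have e (t : ((A ⊗ A) ⊗ A)%type) :
    tmap (@lcontr A phi) idfun t = (@lcontr (A ⊗ A)%type phi \o @tassoc K A A A) t.
  move: t; apply: eq_tens => u v; rewrite /= tmap_tens.
  move: u; apply: tens_ind => [|x y hx hy|b c].
  - by rewrite !linear0 !tens0l !linear0.
  - by rewrite tensDl !linearD /= tensDl hx hy.
  by rewrite tassoc_tens /= !lcontr_tens tensZl.
rewrite -[RHS](congr1 (@lcontr (A ⊗ A)%type phi) (coassoc hopf a)).
by have := e (tmap (@Delta K A) idfun (Delta a)); rewrite /= tmap_comp.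
Qed.

Lemma lcontr_Delta (phi : {linear A -> K^o}) (a : A) :
  lcontr phi (tmap idfun (@Delta K A) (Delta a)) = Delta (lcontr phi (Delta a)).
Proof.
have e t : (@lcontr (A ⊗ A)%type phi \o tmap idfun (@Delta K A)) t =
    (@Delta K A \o @lcontr A phi) t.
  move: t; apply: eq_tens => b c; rewrite /= tmap_tens !lcontr_tens /=.
  by rewrite linearZ_LR.
exact: e.
Qed.

(** The fundamental theorem of coalgebras: a lies in a finite-dimensional right coideal, whose
    matrix coefficients span a subcoalgebra. Since the comultiplication is even, the homogeneous
    components of these coefficients span one as well; the counit axioms show that it contains a. *)
Lemma finite_subcoalgebra (a : A) : exists Z : seq A,
  [/\ all_homogeneous Z, in_span Z a & forall z, z \in Z -> exists2 s : seq (A * A),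
    forall q, q \in s -> q.1 \in Z /\ q.2 \in Z
    & Delta z = \sum_(q <- s) q.1 ⊗ q.2].
Proof.
have [s sE] := tens_span (Delta a).
have [n [y [eta [etay _ _ etaP]]]] := exists_dual_basis (subspace0 A) [seq q.2 | q <- s].
(* The coefficients of Delta a with respect to the independent elements y i in the second factor.
   Comparing coefficients of y k in the coassociativity identity shows that the x i span a right
   coideal. *)
pose x i : A := \sum_(q <- s) eta i q.2 *: q.1.
have DaE : Delta a = \sum_i x i ⊗ y i.
  rewrite sE; transitivity (\sum_(q <- s) \sum_i (eta i q.2 : K) *: (q.1 ⊗ y i)).
    rewrite big_seq [RHS]big_seq; apply: eq_bigr => q qs.
    have /eqP := etaP q.2 (map_f _ qs); rewrite subr_eq0 => /eqP {1}->.
    by rewrite tens_sumr; apply: eq_bigr => i _; rewrite tensZr.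
  rewrite exchange_big; apply: eq_bigr => i _ /=; rewrite /x tens_suml.
  by apply: eq_bigr => q _; rewrite tensZl.
have Dx k : Delta (x k) = \sum_i x i ⊗ rcontr (eta k) (Delta (y i)).
  have := coassoc_rcontr (eta k) a; rewrite DaE.
  rewrite (linear_sum (tmap (@Delta K A) idfun)) (linear_sum (rcontr (eta k))).
  rewrite (linear_sum (tmap idfun _)).
  rewrite (bigD1 k) //= tmap_tens rcontr_tens etay eqxx scale1r big1 ?addr0 => [->|i ik].
    by apply: eq_bigr => i _; rewrite tmap_tens.
  by rewrite tmap_tens rcontr_tens etay eq_sym (negPf ik) scale0r.
have [m [x' [xi [xix _ x's xiP]]]] := exists_dual_basis (subspace0 A) (codom x).
have xE k : x k = \sum_j xi j (x k) *: x' j.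
  by apply/eqP; rewrite -subr_eq0; apply/eqP/xiP/codom_f.
pose R j : {linear A -> A} := @lcontr A (xi j) \o @Delta K A.
pose good v := Delta v = \sum_j x' j ⊗ R j v.
have good_sub : subspace good.
  split=> [|k u v gu gv]; rewrite /good.
    by rewrite (linear0 (@Delta K A)) big1 // => j _; rewrite (linear0 (R j)) tens0r.
  have -> : Delta (k *: u + v) = k *: Delta u + Delta v by rewrite linearP.
  rewrite gu gv scaler_sumr -big_split; apply: eq_bigr => j _.
  by rewrite (linearP (R j)) tensDr tensZr.
have good_x k : good (x k).
  rewrite /good Dx; transitivity (\sum_i \sum_j (xi j (x i) : K) *:
      (x' j ⊗ rcontr (eta k) (Delta (y i)))).
    apply: eq_bigr => i _; rewrite {1}xE tens_suml.
    by apply: eq_bigr => j _; rewrite tensZl.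
  rewrite exchange_big; apply: eq_bigr => j _ /=.
  rewrite Dx (linear_sum (lcontr (xi j))) tens_sumr; apply: eq_bigr => i _ /=.
  by rewrite lcontr_tens tensZr.
have good_x' j : good (x' j).
  by apply: (x's j) => // _ /codomP[k ->].
(* The matrix coefficients of the coaction in the basis x'. *)
pose z j k := R j (x' k).
have Dz j k : Delta (z j k) = \sum_i z j i ⊗ z i k.
  rewrite -[LHS](lcontr_Delta (xi j)) -coassoc_lcontr (good_x' k) (linear_sum (tmap _ idfun)).
  by apply: eq_bigr => i _; rewrite /= tmap_tens.
pose Z := [seq component c (z jk.1 jk.2) | c <- [:: false; true], jk <- enum predT].
have Zmem c j k : component c (z j k) \in Z.
  by apply/allpairsP; exists (c, (j, k)); rewrite mem_enum; case: c.
exists Z; split.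
- by move=> _ /allpairsP[[c jk] [_ _ ->]]; exists c; apply: component_deg.
- move=> T sT ZT.
  have zT j k : T (z j k).
    by rewrite [z j k]componentD; apply: subspaceD => //; apply: ZT.
  have x'T k : T (x' k).
    have := @counit_left K A A idfun (x' k); rewrite /= => <-.
    have ->: tlift (fun u v => eps u *: v) (Delta (x' k)) = \sum_j eps (x' j) *: z j k.
      rewrite [Delta _](good_x' k).
      rewrite [LHS](_ : _ = lcontr (@eps K A : {linear A -> K^o}) (\sum_j x' j ⊗ z j k)) //.
      by rewrite (linear_sum (lcontr _)); apply: eq_bigr => j _; rewrite /= lcontr_tens.
    by apply: subspace_sum => // j _; apply: subspaceZ.
  have xT k : T (x k).
    by rewrite xE; apply: subspace_sum => // j _; apply: subspaceZ.
  have := @counit_right K A A idfun a; rewrite /= => <-; rewrite DaE.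
  rewrite [tlift _ _](_ : _ = rcontr (@eps K A : {linear A -> K^o}) (\sum_i x i ⊗ y i)) //.
  rewrite (linear_sum (rcontr _)); apply: subspace_sum => // i _ /=.
  by rewrite rcontr_tens; apply: subspaceZ.
move=> _ /allpairsP[[c [j k]] [_ _ ->]] /=.
exists ([seq (component false (z j i), component c (z i k)) | i <- index_enum 'I_m] ++
        [seq (component true (z j i), component (~~ c) (z i k)) | i <- index_enum 'I_m]).
  by move=> q; rewrite mem_cat => /orP[] /mapP[i _ ->] /=; split; apply: Zmem.
rewrite Delta_component Dz (linear_sum (tcomp c)) big_cat !big_map /= -big_split.
by apply: eq_bigr => i _; rewrite /= /tcomp !tmap_tens.
Qed.

End FiniteSubcoalgebra.

Section GradedWords.
Variables (K : fieldType) (E : superAlgType K) (G : seq E).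
Hypothesis Gh : all_homogeneous G.

Lemma word_homogeneous w : {subset w <= G} -> homogeneous (\prod_(y <- w) y).
Proof.
elim: w => [|y w IHw] wG; first by exists false; rewrite big_nil deg_1.
have [i yi] : homogeneous y by apply/Gh/wG/mem_head.
have [|j wj] := IHw; first by move=> z zw; apply: wG; rewrite inE zw orbT.
by exists (i (+) j); rewrite big_cons deg_M.
Qed.

Lemma word_span_component P i u :
  word_span G P u -> word_span G P (component i u).
Proof.
have sP := word_span_subspace G P.
apply: (word_span_min (U := fun u => word_span G P (component i u))).
  exact: (subspace_preim (@component K E i)).
move=> w wG Pw; have [j wj] := word_homogeneous wG.
rewrite (component_id _ wj); case: ifP => _; [exact: word_span_word|exact: sP.1].
Qed.

Definition long_odd n (w : seq E) : Prop :=
  long n w /\ exists2 y, y \in w & y \in deg true.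

(** A word of odd degree has an odd letter, and a word of even degree has no odd component. *)
Lemma word_span_odd n u :
  word_span G (long n) u -> word_span G (long_odd n) (component true u).
Proof.
have sP := word_span_subspace G (long_odd n).
apply: (word_span_min (U := fun u => word_span G (long_odd n) (component true u))).
  exact: (subspace_preim (@component K E true)).
move=> w wG wn; have [j wj] := word_homogeneous wG.
rewrite (component_id _ wj); case: ifP => [/eqP jt|_]; last exact: sP.1.
have [/hasP[y yw /asboolP y1]|/hasPn noodd] :=
    boolP (has (fun y => `[< y \in deg true >]) w).
  by apply: word_span_word => //; split=> //; exists y.
suff -> : \prod_(y <- w) y = 0 by exact: sP.1.
apply: deg_disjoint; last by move: wj; rewrite -jt.
rewrite big_seq; apply: (big_ind (fun x => x \in deg false)) => [|x y x0 y0|y yw].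
- exact: deg_1.
- exact: (deg_M false false).
have [[] y1] := Gh (wG _ yw); last by [].
by case/negP: (noodd y yw); apply/asboolP.
Qed.

End GradedWords.

(** * Trivial extensions and admissible letters *)

Section TrivialExtensionTheory.
Variables (K : fieldType) (A : comHopfSuperAlgType K) (E : comSuperAlgType K).
Variable p : {lrmorphism E -> A}.
Hypothesis tp : trivial_extension p.

Lemma trivial_extension_component i x : p (component i x) = component i (p x).
Proof. by case: tp => pe _ _; apply: even_map_component. Qed.

Lemma eps_component i (a : A) : eps a = 0 -> eps (component i a) = 0.
Proof.
case: i => a0; first exact/eps_odd/component_deg.
by move: a0; rewrite {1}[a]componentD epsD (eps_odd (component_deg true a)) addr0.
Qed.

Lemma trivial_extension_mull x y : p x = 0 -> eps (p y) = 0 -> x * y = 0.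
Proof. by case: tp => _ _; apply. Qed.

(** Super-commutativity moves the annihilation to the other side, one pair of homogeneous components
    at a time. *)
Lemma trivial_extension_mulr x y : p x = 0 -> eps (p y) = 0 -> y * x = 0.
Proof.
move=> px py; rewrite [x]componentD [y]componentD.
have h i j : component i y * component j x = 0.
  rewrite (supermulC _ _ _ _ (component_deg i y) (component_deg j x)).
  rewrite [component j x * _]trivial_extension_mull ?mulr0 //;
    rewrite trivial_extension_component.
    by rewrite px linear0.
  exact: eps_component.
by rewrite mulrDl !mulrDr !h !addr0.
Qed.

Section Image.
Variable G : seq E.

Definition letter_image (a : A) : Prop := exists2 v, word_span G (long 0) v & p v = a.

Lemma image_subspace : subspace letter_image.
Proof. exact: (subspace_im p (word_span_subspace G (long 0))). Qed.

Lemma imageM a b : letter_image a -> letter_image b -> letter_image (a * b).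
Proof.
move=> [u uW <-] [v vW <-]; exists (u * v); last exact: rmorphM.
exact: (word_spanMn uW vW).
Qed.

Lemma image1 : letter_image 1.
Proof. by exists 1; [exact: word_span1|exact: rmorph1]. Qed.

(** The factors are homogeneous so that the product of two such tensors is given by a single sign
    per pair of terms. *)
Definition image_tensor (t : A ⊗ A) : Prop := exists2 s : seq (A * A),
  forall q, q \in s ->
    [/\ letter_image q.1, letter_image q.2, homogeneous q.1 & homogeneous q.2]
  & t = \sum_(q <- s) q.1 ⊗ q.2.

Lemma image_tensor_subspace : subspace image_tensor.
Proof.
split=> [|k _ _ [s sP ->] [r rP ->]]; first by exists [::]; rewrite // big_nil.
exists ([seq (k *: q.1, q.2) | q <- s] ++ r) => [q|].
  rewrite mem_cat => /orP[/mapP[x /sP[x1 x2 [i xi] h] ->]|/rP //].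
  split=> //=; first by apply: subspaceZ => //; apply: image_subspace.
  by exists i; apply: deg_Z.
rewrite big_cat big_map scaler_sumr /=; congr (_ + _).
by apply: eq_bigr => q _; rewrite tensZl.
Qed.

Lemma image_tensor_tens a b : letter_image a -> letter_image b -> homogeneous a -> homogeneous b ->
  image_tensor (a ⊗ b).
Proof.
by move=> ha hb ha' hb'; exists [:: (a, b)]; rewrite ?big_seq1 // => q;
  rewrite inE => /eqP ->.
Qed.

Lemma image_tensorM t t' : image_tensor t -> image_tensor t' -> image_tensor (t * t').
Proof.
have sI := image_tensor_subspace.
move=> [s sP ->] [r rP ->]; rewrite mulr_suml; apply: subspace_sum => // a /sP.
move=> [a1 a2 [i ai] [j aj]].
rewrite mulr_sumr; apply: subspace_sum => // b /rP[b1 b2 [k bk] [l bl]].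
rewrite (tens_mul _ _ aj bk); apply: subspaceZ => //.
apply: image_tensor_tens; [exact: imageM|exact: imageM| |].
  by exists (i (+) k); apply: deg_M.
by exists (j (+) l); apply: deg_M.
Qed.

(** The image in A of the algebra generated by such letters is stable under comultiplication
    ([Delta_image]), so left invariant derivations can be computed within it. *)
Definition admissible := [/\ all_homogeneous G, forall y, y \in G -> eps (p y) = 0
  & forall y, y \in G -> image_tensor (Delta (p y))].

End Image.

(** Put the images of the given letters into a finite-dimensional subcoalgebra with homogeneous
    spanning set [Z], and adjoin homogeneous lifts of the elements z - eps(z). Subtracting the
    counit places the new letters in the preimage of A^+ and leaves z in the image of the generated
    algebra. *)
Lemma exists_admissible (G0 : seq E) : all_homogeneous G0 ->
    (forall y, y \in G0 -> eps (p y) = 0) ->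
  exists2 G, {subset G0 <= G} & admissible G.
Proof.
move=> G0h G0e.
have [Z [Zh ZG0 ZD]] : exists Z : seq A, [/\ all_homogeneous Z,
    forall y, y \in G0 -> in_span Z (p y) &
    forall z, z \in Z -> exists2 s : seq (A * A),
      forall q, q \in s -> q.1 \in Z /\ q.2 \in Z & Delta z = \sum_(q <- s) q.1 ⊗ q.2].
  elim: (G0) => [|y l [Z [Zh Zl ZD]]]; first by exists [::].
  have [T [Th Ty TD]] := finite_subcoalgebra (p y).
  exists (T ++ Z); split=> [z|z|z].
  - by rewrite mem_cat => /orP[/Th|/Zh].
  - rewrite inE => /orP[/eqP ->|/Zl zZ] U sU hU.
      by apply: Ty => // x xT; apply: hU; rewrite mem_cat xT.
    by apply: zZ => // x xZ; apply: hU; rewrite mem_cat xZ orbT.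
  - rewrite mem_cat => /orP[/TD[s sP sE]|/ZD[s sP sE]]; exists s => // q /sP[q1 q2];
      by rewrite !mem_cat q1 q2 ?orbT.
have lift z : exists e, homogeneous z -> homogeneous e /\ p e = z - (eps z)%:A.
  have [[i zi]|nz] := pselect (homogeneous z); last by exists 0 => /nz.
  have z'i : z - (eps z)%:A \in deg i.
    case: i zi => zi; first by rewrite eps_odd // scale0r subr0.
    by rewrite rpredB ?deg_Z ?deg_1.
  have [_ p_surj _] := tp; have [e pe] := p_surj (z - (eps z)%:A).
  exists (component i e) => _; split; first by exists i; apply: component_deg.
  by rewrite trivial_extension_component pe (component_id _ z'i) eqxx.
pose l z := sval (cid (lift z)).
have lP z : z \in Z -> homogeneous (l z) /\ p (l z) = z - (eps z)%:A.
  by move=> zZ; rewrite /l; case: cid => e; apply; apply: Zh.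
pose G := G0 ++ [seq l z | z <- Z].
have GZ z : z \in Z -> letter_image G z.
  move=> zZ; have [_ plz] := lP z zZ.
  rewrite -[z](subrK (eps z)%:A) -plz; apply: subspaceD; first exact: image_subspace.
    exists (l z) => //; apply: (@word_span_leq _ _ _ 0 1) => //.
    by apply: word_span_letter; rewrite mem_cat map_f ?orbT.
  by apply: subspaceZ; [exact: image_subspace|exact: image1].
have DZ z : z \in Z -> image_tensor G (Delta z).
  move=> zZ; have [s sP ->] := ZD z zZ; apply: subspace_sum; first exact: image_tensor_subspace.
  by move=> q /sP[q1 q2]; apply: image_tensor_tens; [exact: GZ|exact: GZ|exact: Zh|exact: Zh].
exists G; first by move=> y yG0; rewrite mem_cat yG0.
split=> y; rewrite mem_cat => /orP[yG0|/mapP[z zZ ->]].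
- exact: G0h.
- by case: (lP z zZ).
- exact: G0e.
- by case: (lP z zZ) => _ ->; rewrite epsB epsZ eps1 mulr1 subrr.
- have := subspace_preim (@Delta K A) (image_tensor_subspace G).
  by move=> sD; apply: (ZG0 y yG0 _ sD).
case: (lP z zZ) => _ ->; rewrite linearB linearZ_LR /=.
have sI := image_tensor_subspace G.
apply: subspaceB => //; first exact: DZ.
apply: subspaceZ => //; rewrite rmorph1.
by apply: image_tensor_tens; try exact: image1; exists false; exact: deg_1.
Qed.

Section Admissible.
Variable G : seq E.
Hypothesis adG : admissible G.
Local Notation W n := (word_span G (long n)).

Let Gh : all_homogeneous G. Proof. by case: adG. Qed.

Lemma word_aug v : W 1 v -> eps (p v) = 0.
Proof.
apply: (word_span_min (U := fun v => eps (p v) = 0)).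
  exact: (subspace_ker (@eps K A \o p : {linear E -> K^o})).
case=> [//|y w] wG _; rewrite big_cons rmorphM /= epsM.
by case: adG => _ -> //; rewrite ?mul0r //; apply: wG; apply: mem_head.
Qed.

Lemma word_augB v : W 0 v -> W 1 (v - (eps (p v))%:A).
Proof.
have sW := word_span_subspace G (long 1).
pose f (v : E) := v - (eps (p v))%:A.
have f_lin : linear f.
  move=> k x y; rewrite /f linearP epsD epsZ scalerDl -scalerA opprD addrACA.
  by rewrite -scalerBr.
pose fl : {linear E -> E} := HB.pack f (GRing.isLinear.Build K E E *:%R f f_lin).
apply: (word_span_min (U := fun v => W 1 (fl v))); first exact: (subspace_preim fl).
case=> [|y w] wG _; rewrite /= /f.
  by rewrite big_nil rmorph1 eps1 scale1r subrr; apply: sW.1.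
have ww : W 1 (\prod_(z <- y :: w) z) by apply: word_span_word.
by rewrite word_aug // scale0r subr0.
Qed.

Lemma word_aug_long v : W 0 v -> eps (p v) = 0 -> W 1 v.
Proof. by move=> /word_augB + e; rewrite e scale0r subr0. Qed.

Lemma Delta_image v : W 0 v -> image_tensor G (Delta (p v)).
Proof.
have sI := image_tensor_subspace G.
apply: (word_span_min (U := fun v => image_tensor G (Delta (p v)))).
  exact: (subspace_preim (@Delta K A \o p : {linear E -> (A ⊗ A)%type})).
move=> w wG _; elim: w wG => [|y w IHw] wG.
  rewrite big_nil !rmorph1; apply: image_tensor_tens; try exact: image1;
  by exists false; apply: deg_1.
rewrite big_cons !rmorphM; apply: image_tensorM.
  by case: adG => _ _; apply; apply/wG/mem_head.
by apply: IHw => z zw; apply: wG; rewrite inE zw orbT.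
Qed.

Lemma image_component i a : letter_image G a -> letter_image G (component i a).
Proof.
move=> [v vW <-]; exists (component i v); first exact: word_span_component.
exact: trivial_extension_component.
Qed.

(** A linear section of [p] on the algebra generated by [G], averaged over the grading. *)
Lemma exists_section : exists g : {linear A -> E}, [/\ even_map g,
  forall a, letter_image G a -> W 0 (g a) & forall a, letter_image G a -> p (g a) = a].
Proof.
have sW := word_span_subspace G (long 0).
have [s [sWs ps]] := exists_linear_section p sW.
exists (evening s); split; first exact: evening_even.
  move=> a _; rewrite /= /evening; apply: subspaceD => //;
  exact: word_span_component.
move=> a aI; rewrite /= /evening linearD /= !trivial_extension_component.
have h i : p (s (component i a)) = component i a.
  by have [v vW <-] := image_component i aI; apply: ps.
have hc i : component i (component i a) = component i a.
  by rewrite (component_id _ (component_deg i a)) eqxx.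
by rewrite !h !hc -componentD.
Qed.

End Admissible.
End TrivialExtensionTheory.

(** * Lifted derivations *)

Section LiftedDerivation.
Variables (K : fieldType) (A : comHopfSuperAlgType K) (E : comSuperAlgType K).
Variable p : {lrmorphism E -> A}.
Hypothesis tp : trivial_extension p.
Variable G : seq E.
Hypothesis adG : admissible p G.
Local Notation W n := (word_span G (long n)).
Local Notation im := (letter_image p G).

Variable g : {linear A -> E}.
Hypothesis g_even : even_map g.
Hypothesis gW : forall a, im a -> W 0 (g a).
Hypothesis pg : forall a, im a -> p (g a) = a.

Variable q : {linear A -> A}.
Hypothesis q_even : even_map q.
Hypothesis q_im : forall a, im a -> im (q a).
Hypothesis q_aug : forall a, im a -> eps (q a) = 0.
Hypothesis q_der : forall a b, im a -> im b ->
  q (a * b) = eps a *: q b + eps b *: q a.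

(* Lifts the left invariant derivation [a |-> \sum a1 * q a2] of the image of
   [E]; it is a derivation of [E] as the kernel of [p] is annihilated by the
   values of [q]. *)
Definition lifted_der (v : E) : E := tpair g (g \o q) (Delta (p v)).
HB.instance Definition _ :=
  GRing.Linear.copy lifted_der (tpair g (g \o q) \o (@Delta K A \o p)).
Local Notation e := lifted_der.

Lemma image_word v : W 0 v -> im (p v).
Proof. by exists v. Qed.

Lemma lifted_der_ker v : p v = 0 -> e v = 0.
Proof. by rewrite /e => ->; rewrite !linear0. Qed.

Lemma section_q_aug a : im a -> eps (p (g (q a))) = 0.
Proof. by move=> aI; rewrite pg ?q_aug //; apply: q_im. Qed.

Lemma lifted_der_ind (T : E -> Prop) v : subspace T ->
  (forall a b, im a -> im b -> T (g a * g (q b))) -> W 0 v -> T (e v).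
Proof.
move=> sT hT /(Delta_image adG)[s sP sE]; rewrite /e sE linear_sum.
by apply: subspace_sum => // x /sP[x1 x2 _ _] /=; rewrite tpair_tens; apply: hT.
Qed.

(** By the counit axiom g(q(p v)) is the sum of eps(a1) g(q a2), so the difference has g(a1) -
    eps(a1) in place of g(a1). To first order the lifted derivation is thus [q] itself, with an
    error that has one more factor in the preimage of A^+. *)
Lemma lifted_der_sub (T : E -> Prop) v : subspace T ->
  (forall a b, im a -> im b -> T ((g a - (eps a)%:A) * g (q b))) ->
  W 0 v -> T (e v - g (q (p v))).
Proof.
move=> sT hT vW; have [s sP sE] := Delta_image adG vW.
rewrite [g (q (p v))](counit_left_sum (g \o q) sE).
rewrite /e sE linear_sum -sumrB; apply: subspace_sum => // x /sP[x1 x2 _ _] /=.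
rewrite tpair_tens /= -mulr_algl -mulrBl; exact: hT.
Qed.

Lemma lifted_der_aug v : W 0 v -> W 1 (e v).
Proof.
have sW := word_span_subspace G (long 1).
apply: lifted_der_ind => // a b aI bI; apply: (word_spanMn (m := 0) (n := 1)).
  exact: gW.
by apply: (word_aug_long adG); [exact/gW/q_im|exact: section_q_aug].
Qed.

(** Replacing u and v by the sections of their images changes nothing, as the differences lie in ker
    p and meet values of [e], which lie over A^+. For the same reason [g] is multiplicative in front
    of such values. The sign from Delta (p u) * Delta (p v) disappears: in one term it comes with
    eps of the second factor of u, which is zero if that factor is odd, and in the other it is
    undone by commuting two factors. *)
Lemma lifted_derM u v : W 0 u -> W 0 v -> e (u * v) = e u * v + u * e v.
Proof.
move=> uW vW; have [s sP sE] := Delta_image adG uW.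
have [r rP rE] := Delta_image adG vW.
have ev_aug w : W 0 w -> eps (p (e w)) = 0.
  by move=> wW; apply: (word_aug adG); apply: lifted_der_aug.
have -> : e u * v = e u * g (p v).
  apply/eqP; rewrite -subr_eq0 -mulrBr (trivial_extension_mulr tp) ?ev_aug //.
  by rewrite rmorphB /= pg ?subrr //; apply: image_word.
have -> : u * e v = g (p u) * e v.
  apply/eqP; rewrite -subr_eq0 -mulrBl (trivial_extension_mull tp) ?ev_aug //.
  by rewrite rmorphB /= pg ?subrr //; apply: image_word.
have eE w (t : seq (A * A)) : Delta (p w) = \sum_(x <- t) x.1 ⊗ x.2 ->
    e w = \sum_(x <- t) g x.1 * g (q x.2).
  by move=> tE; rewrite /e tE linear_sum; apply: eq_bigr => x _; rewrite /= tpair_tens.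
rewrite (counit_right_sum g sE) (counit_right_sum g rE) (eE u s sE) (eE v r rE).
have -> : e (u * v) = tpair g (g \o q) (Delta (p u) * Delta (p v)).
  by rewrite /e !rmorphM.
rewrite sE rE !mulr_suml -big_split linear_sum /=.
rewrite big_seq [RHS]big_seq; apply: eq_bigr => x /sP[x1 x2 _ [i xi]].
rewrite !mulr_sumr -big_split linear_sum /=.
rewrite big_seq [RHS]big_seq; apply: eq_bigr => y /rP[y1 y2 [j yj] _].
rewrite (tens_mul _ _ xi yj) linearZ_LR /= tpair_tens /= q_der //.
have gM w : eps (p w) = 0 -> g (x.1 * y.1) * w = g x.1 * (g y.1 * w).
  move=> w0; apply/eqP; rewrite -subr_eq0 mulrA -mulrBl.
  rewrite (trivial_extension_mull tp) // rmorphB rmorphM /= !pg ?subrr //.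
  exact: imageM.
rewrite linearD !linearZ_LR /= mulrDr -!scalerAr !gM ?section_q_aug //.
rewrite scalerDr addrC; congr (_ + _).
  rewrite -scalerAl scalerA; congr (_ *: _).
  by case: i xi => xi; rewrite ?mul1r // eps_odd ?mulr0.
rewrite -mulrA (supermulC _ _ _ _ (g_even yj) (g_even (q_even xi))).
rewrite sign_mulE -!scalerAr !scalerA; congr (_ *: _).
by rewrite mulrAC -signr_addb andbC addbb mul1r.
Qed.

End LiftedDerivation.

Section Derivations.
Variables (K : fieldType) (E : superAlgType K) (G : seq E).
Local Notation W n := (word_span G (long n)).
Local Notation O n := (word_span G (long_odd n)).

Lemma odd_word m n x y : O m x -> W n y -> O (m + n) (x * y).
Proof.
apply: word_spanM => v w [vm [z zv z1]] wn; split.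
  by rewrite /long size_cat leq_add.
by exists z; rewrite // mem_cat zv.
Qed.

Lemma word_odd m n x y : W m x -> O n y -> O (m + n) (x * y).
Proof.
apply: word_spanM => v w vm [wn [z zw z1]]; split.
  by rewrite /long size_cat leq_add.
by exists z; rewrite // mem_cat zw orbT.
Qed.

Lemma odd_leq m n x : (m <= n)%N -> O n x -> O m x.
Proof. by move=> mn; apply: word_spanS => w [wn h]; split=> //; apply: leq_trans wn. Qed.

Lemma odd_long n x : O n x -> W n x.
Proof. by apply: word_spanS => w []. Qed.

Variable e : {linear E -> E}.
Hypothesis eM : forall u v, W 0 u -> W 0 v -> e (u * v) = e u * v + u * e v.

Lemma word_span_size w : {subset w <= G} -> W (size w) (\prod_(y <- w) y).
Proof. by move=> wG; apply: word_span_word => //; rewrite /long. Qed.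

Let cons_sub y w : {subset y :: w <= G} -> y \in G /\ {subset w <= G}.
Proof.
move=> h; split; first by apply/h/mem_head.
by move=> z zw; apply: h; rewrite inE zw orbT.
Qed.

Let W0 n u : W n u -> W 0 u. Proof. exact: word_span_leq. Qed.

Lemma der_word n u : (forall v, W 0 v -> W 1 (e v)) -> W n u -> W n (e u).
Proof.
move=> eW; have sW m := word_span_subspace G (long m).
apply: (word_span_min (U := fun u => W n (e u))); first exact: (subspace_preim e).
move=> w wG wn; apply: (word_span_leq wn) => {n wn}.
elim: w wG => [|y w IHw] /=.
  by move=> _; apply/W0/eW; rewrite big_nil; apply: word_span1.
move=> /cons_sub[yG wG]; have yW := word_span_letter yG.
have wW := word_span_size wG; rewrite big_cons eM; [|exact: W0 yW|exact: W0 wW].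
apply: subspaceD => //.
  by apply: (word_spanMn (m := 1)) => //; apply/eW/W0/yW.
by apply: (word_spanMn (m := 1)) => //; apply: IHw.
Qed.

(** By the Leibniz rule each term trades one letter for an element of [O 1], which keeps the length
    and brings in an odd letter. *)
Lemma der_odd n u : (forall v, W 0 v -> O 1 (e v)) -> (0 < n)%N -> W n u -> O n (e u).
Proof.
move=> eO n0; have sO m := word_span_subspace G (long_odd m).
apply: (word_span_min (U := fun u => O n (e u))); first exact: (subspace_preim e).
move=> w wG wn; apply: (odd_leq wn); have {n0 wn n} : (0 < size w)%N by apply: leq_trans wn.
elim: w wG => [//|y w IHw] /cons_sub[yG wG] _; have yW := word_span_letter yG.
have wW := word_span_size wG; rewrite big_cons eM; [|exact: W0 yW|exact: W0 wW].
apply: subspaceD => //.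
  by apply: (odd_word (m := 1)) => //; apply/eO/W0/yW.
case: w IHw wG wW => [|z w] IHw wG wW.
  apply: (@odd_leq 1 2) => //; apply: (word_odd (m := 1)) => //.
  exact/eO/W0/wW.
by apply: (word_odd (m := 1)) => //; apply: IHw.
Qed.

Section EulerStep.
Variable M : E -> Prop.
Hypothesis sM : subspace M.
Hypothesis Ml : forall x v, M x -> W 1 v -> x * v = 0.
Hypothesis Mr : forall x v, M x -> W 1 v -> v * x = 0.
Hypothesis eW : forall v, W 0 v -> W 1 (e v).
Hypothesis e_letter : forall y, y \in G ->
  exists w m, [/\ W 2 w, M m & e y = y + w + m].
Hypothesis eMker : forall x, M x -> e x = 0.

(** By the Leibniz rule every letter contributes the word once. A term in [M] is annihilated next to
    another letter and survives only in words of length one. *)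
Let euler_word w : {subset w <= G} -> exists2 v, W (size w).+1 v &
  exists2 m, M m & e (\prod_(y <- w) y) = (size w)%:R *: (\prod_(y <- w) y) + v + m.
Proof.
have sW m := word_span_subspace G (long m).
elim: w => [|y w IHw] wG.
  exists (e 1); first exact/eW/word_span1.
  by exists 0; [case: sM|rewrite big_nil scale0r add0r addr0].
have [yG {}wG] := cons_sub wG; have yW := word_span_letter yG.
have [v vW [m mM eE]] := IHw wG.
have [y2 [my [y2W myM yE]]] := e_letter yG.
have wW := word_span_size wG; rewrite big_cons eM; [|exact: W0 yW|exact: W0 wW].
have mwM : M (my * \prod_(z <- w) z).
  case: (w) wW => [|z r] wW; first by rewrite big_nil mulr1.
  by rewrite Ml //; [case: sM|apply: word_span_leq wW].
set P := \prod_(z <- w) z in eE wW mwM *.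
exists (y2 * P + y * v).
  apply: subspaceD => //; first exact: (word_spanMn (m := 2)).
  exact: (word_spanMn (m := 1)).
exists (my * P) => //.
rewrite eE yE !mulrDl !mulrDr (Mr mM yW) addr0 -scalerAr /=.
rewrite -[(size w).+1]addn1 natrD scalerDl scale1r.
by rewrite [LHS](AC (3*2) ((4*1)*(2*5)*3)).
Qed.

(** [e] kills u, while e - n maps [W n] into [W n.+1]: a word of length k is an eigenvector for k up
    to longer words, and for k at least 2 the terms in [M] are annihilated by neighbouring letters.
    Hence n u lies in [W n.+1]. *)
Lemma euler_step n u : (2 <= n)%N -> n%:R != 0 :> K -> W n u -> M u -> W n.+1 u.
Proof.
move=> n2 n0 uW uM; have sW m := word_span_subspace G (long m).
suff : W n.+1 (e u - n%:R *: u).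
  rewrite eMker // sub0r => h; rewrite -[u](scalerK n0).
  by apply: subspaceZ => //; rewrite -[_ *: u]opprK; apply: subspaceN.
pose f (v : E) := e v - n%:R *: v.
have f_lin : linear f.
  move=> k x y; rewrite /f linearP scalerDr opprD addrACA /=.
  by rewrite scalerA mulrC -scalerA -scalerBr.
pose fl : {linear E -> E} := HB.pack f (GRing.isLinear.Build K E E *:%R f f_lin).
move: uW; apply: (word_span_min (U := fun u => W n.+1 (fl u))).
  exact: (subspace_preim fl).
move=> w wG wn; rewrite /= /f.
have [v vW ev] : exists2 v, W (size w).+1 v &
    e (\prod_(y <- w) y) = (size w)%:R *: (\prod_(y <- w) y) + v.
  case: w wG wn => [_|y w wG wn]; first by rewrite /long leqNgt (leq_trans _ n2).
  have [yG {}wG] := cons_sub wG; have yW := word_span_letter yG.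
  have [v vW [m mM eE]] := euler_word wG.
  have [y2 [my [y2W myM yE]]] := e_letter yG.
  have wW := word_span_size wG; rewrite big_cons eM; [|exact: W0 yW|exact: W0 wW].
  set P := \prod_(z <- w) z in eE wW *.
  exists (y2 * P + y * v).
    apply: subspaceD => //; first exact: (word_spanMn (m := 2)).
    exact: (word_spanMn (m := 1)).
  have PW : W 1 P.
    by apply: word_span_leq wW; rewrite -ltnS; apply: leq_trans wn.
  rewrite eE yE !mulrDl !mulrDr (Mr mM yW) (Ml myM PW) !addr0 -scalerAr /=.
  rewrite -[(size w).+1]addn1 natrD scalerDl scale1r.
  by rewrite [LHS](AC (2*2) ((3*1)*(2*4))).
rewrite ev addrAC -scalerBl; apply: subspaceD => //; last exact: word_span_leq vW.
move: wn; rewrite /long leq_eqVlt => /orP[/eqP ->|nw].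
  by rewrite subrr scale0r; apply: (sW _).1.
by apply: subspaceZ (sW _) _; exact: word_span_word.
Qed.

End EulerStep.
End Derivations.

Section AugmentationProducts.
Variables (K : fieldType) (A : comHopfSuperAlgType K) (E : comSuperAlgType K).
Variables (p : {lrmorphism E -> A}) (G : seq E).
Hypothesis adG : admissible p G.
Local Notation im := (letter_image p G).

Lemma aug_mul (a b : A) : (a - (eps a)%:A) * (b - (eps b)%:A) =
  a * b - (eps a *: b + eps b *: a) + (eps a * eps b)%:A.
Proof.
rewrite mulrBl !mulrBr !mulr_algl !mulr_algr scalerA opprB addrA.
by rewrite opprD addrA [LHS](AC 4 (1*4*2*3)).
Qed.

Variable g : {linear A -> E}.
Hypothesis gW : forall a, im a -> word_span G (long 0) (g a).
Hypothesis pg : forall a, im a -> p (g a) = a.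

Lemma section_augW a : im a -> word_span G (long 1) (g a - (eps a)%:A).
Proof. by move=> aI; rewrite -{2}(pg aI); apply: (word_augB adG); apply: gW. Qed.

Lemma image_aug_mul a b : im a -> im b -> exists2 v, word_span G (long 2) v &
  p v = (a - (eps a)%:A) * (b - (eps b)%:A).
Proof.
move=> aI bI; exists ((g a - (eps a)%:A) * (g b - (eps b)%:A)).
  by apply: (word_spanMn (m := 1) (n := 1)); apply: section_augW.
by rewrite rmorphM !rmorphB /= !pg // !linearZ_LR /= rmorph1.
Qed.

End AugmentationProducts.

Lemma exists_admissible_words (K : fieldType) (A : comHopfSuperAlgType K)
    (E : comSuperAlgType K) (p : {lrmorphism E -> A}) (l : seq E) :
  trivial_extension p ->
  exists2 G, admissible p G & forall y, y \in l -> word_span G (long 0) y.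
Proof.
move=> tp; pose r y := y - (eps (p y))%:A.
pose l' := [seq component false (r y) | y <- l] ++ [seq component true (r y) | y <- l].
have eps_r y : eps (p (r y)) = 0.
  by rewrite linearB linearZ_LR rmorph1 /= epsB epsZ eps1 mulr1 subrr.
have [y|y|G lG adG] := exists_admissible tp (G0 := l').
- rewrite mem_cat => /orP[]/mapP[z _ ->];
  by [exists false; apply: component_deg|exists true; apply: component_deg].
- by rewrite mem_cat => /orP[]/mapP[z _ ->];
    rewrite (trivial_extension_component tp) eps_component.
have sW := word_span_subspace G (long 0).
have rW i y : y \in l -> word_span G (long 0) (component i (r y)).
  move=> yl; apply: (@word_span_leq _ _ _ 0 1) => //; apply: word_span_letter.
  by apply: lG; rewrite mem_cat; apply/orP; case: i; [right|left]; apply/mapP; exists y.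
exists G => // y yl; rewrite -[y](subrK (eps (p y))%:A) -/(r y) [r y]componentD.
apply: subspaceD => //; first by apply: subspaceD => //; apply: rW.
by apply: subspaceZ => //; apply: word_span1.
Qed.

(** * Characteristic 0: the Euler derivation *)

Section CharacteristicZero.
Variables (K : fieldType) (A : comHopfSuperAlgType K) (E : comSuperAlgType K).
Variable p : {lrmorphism E -> A}.
Hypothesis tp : trivial_extension p.

Section Euler.
Variable G : seq E.
Hypothesis adG : admissible p G.
Local Notation W n := (word_span G (long n)).
Local Notation im := (letter_image p G).

Let Gh : all_homogeneous G. Proof. by case: adG. Qed.
Let sW n : subspace (W n). Proof. exact: word_span_subspace. Qed.
Let im2 (a : A) : Prop := exists2 v, W 2 v & p v = a.
Let im2_subspace : subspace im2. Proof. exact: (subspace_im p (sW 2)). Qed.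

Lemma exists_even_projection : exists pi : {linear A -> A},
  [/\ even_map pi, forall a, im2 (pi a) & forall a, im2 a -> pi a = a].
Proof.
have [|pi [piT pi1 _]] := @exists_projection K A _ _ (subspace0 A) im2_subspace.
  by move=> x ->.
have im2c i a : im2 a -> im2 (component i a).
  move=> [v vW <-]; exists (component i v); first exact: word_span_component.
  exact: trivial_extension_component.
exists (evening pi); split=> [|a|a aI]; first exact: evening_even.
  by apply: (subspaceD im2_subspace); [apply/im2c/piT|apply/im2c/piT].
rewrite /= /evening !(pi1 _ (im2c _ _ aI)).
by rewrite !(component_id _ (component_deg _ _)) !eqxx -componentD.
Qed.

(** [pi] will project onto the image of [W 2], the square of the augmentation ideal of the image of
    the letters. The map then takes the linear part of a at the unit; it vanishes at 1 and on that
    square, and is therefore a derivation over the counit. *)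
Definition complementary (pi : {linear A -> A}) (a : A) : A :=
  (a - (eps a)%:A) - pi (a - (eps a)%:A).

Lemma complementary_is_linear pi : linear (complementary pi).
Proof.
move=> k x y; rewrite /complementary.
have -> : k *: x + y - (eps (k *: x + y))%:A =
    k *: (x - (eps x)%:A) + (y - (eps y)%:A).
  rewrite epsD epsZ scalerDl -scalerA opprD addrACA.
  by rewrite -scalerBr.
by rewrite linearP opprD addrACA -scalerBr.
Qed.
HB.instance Definition _ pi :=
  GRing.isLinear.Build K A A *:%R (complementary pi) (complementary_is_linear pi).

Lemma euler_derivation : exists e : {linear E -> E},
  [/\ forall u v, W 0 u -> W 0 v -> e (u * v) = e u * v + u * e v,
      forall v, W 0 v -> W 1 (e v), forall v, p v = 0 -> e v = 0 &
      forall y, y \in G -> exists w m, [/\ W 2 w, p m = 0 & e y = y + w + m]].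
Proof.
have [pi [pi_even piT pi1]] := exists_even_projection.
have [g [g_even gW pg]] := exists_section tp adG.
have aug_im a : im a -> im (a - (eps a)%:A).
  move=> aI; apply: subspaceB => //; first exact: image_subspace.
  by apply: subspaceZ; [exact: image_subspace|exact: image1].
have im2W a : im2 a -> im a /\ eps a = 0.
  move=> [v vW <-]; split; first by exists v => //; apply: word_span_leq vW.
  by apply: (word_aug adG); apply: word_span_leq vW.
have eps_aug (a : A) : eps (a - (eps a)%:A) = 0.
  by rewrite epsB epsZ eps1 mulr1 subrr.
have augW a : im a -> W 1 (g a - (eps a)%:A) by apply: (section_augW adG).
pose q : {linear A -> A} := complementary pi.
have q_even : even_map q.
  move=> i a ai; have h : a - (eps a)%:A \in deg i.
    case: i ai => ai; first by rewrite eps_odd // scale0r subr0.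
    by rewrite rpredB ?deg_Z ?deg_1.
  by rewrite /= /complementary rpredB //; apply: pi_even.
have q_im a : im a -> im (q a).
  move=> aI; apply: subspaceB; first exact: image_subspace.
    exact: aug_im.
  by have [] := im2W _ (piT (a - (eps a)%:A)).
have q_aug a : im a -> eps (q a) = 0.
  move=> aI; rewrite /= /complementary epsB eps_aug.
  by have [_ ->] := im2W _ (piT (a - (eps a)%:A)); rewrite subrr.
have q_der a b : im a -> im b -> q (a * b) = eps a *: q b + eps b *: q a.
  move=> aI bI; rewrite -!linearZ_LR -linearD /=.
  apply/eqP; rewrite -subr_eq0 -linearB /=; apply/eqP.
  rewrite /complementary; set c := (X in X - pi X).
  suff cI : im2 c by rewrite (pi1 _ cI) subrr.
  have -> : c = (a - (eps a)%:A) * (b - (eps b)%:A).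
    have -> : c = a * b - (eps a *: b + eps b *: a) + (eps a * eps b)%:A.
      rewrite /c -scaleNr; congr (_ + _ *: _); rewrite epsB epsD !epsZ epsM [eps b * _]mulrC.
      by rewrite opprB addrK.
    exact/esym/aug_mul.
  exact: (image_aug_mul adG gW pg).
exists (lifted_der p g q); split.
- by move=> u v uW vW; apply: (lifted_derM tp adG).
- by move=> v vW; apply: (lifted_der_aug adG).
- by move=> v; apply: lifted_der_ker.
move=> y yG; have yW := word_span_letter yG.
have yW0 : W 0 y by apply: word_span_leq yW.
have yI : im (p y) by exists y.
have [v vW pv] := piT (p y).
pose d := lifted_der p g q y; pose h := g (q (p y)).
have dh : W 2 (d - h).
  apply: (lifted_der_sub adG) => // a b aI bI.
  apply: (word_spanMn (m := 1) (n := 1)); first exact: augW.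
  apply: (word_aug_long adG); first exact/gW/q_im.
  by rewrite pg ?q_aug //; apply: q_im.
(* The lift [d] agrees with [h] up to [W 2], and v in [W 2] lifts pi (p y). The image of h - y + v
   is q (p y) - p y + pi (p y), which is 0. *)
exists (d - h - v), (h - y + v); split.
- exact: subspaceB.
- rewrite rmorphD rmorphB /= pv /h pg; last exact: q_im.
  rewrite /= /complementary (word_aug adG yW) scale0r subr0.
  by rewrite addrAC subrK subrr.
rewrite -/d [RHS](AC (1*3*3) (2*((1*6)*((3*5)*(4*7))))) /=.
by rewrite subrr !addNr !addr0.
Qed.

End Euler.

Hypothesis charK0 : [pchar K] =i pred0.

Lemma char0_trivial_extension (s : seq (E * E)) :
  (forall t, t \in s -> eps (p t.1) = 0 /\ eps (p t.2) = 0) ->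
  p (\sum_(t <- s) t.1 * t.2) = 0 -> \sum_(t <- s) t.1 * t.2 = 0.
Proof.
move=> sP; set u := \sum_(t <- s) _ => pu.
have n_neq0 n : n.+1%:R != 0 :> K.
  by have /pcharf0P -> := charK0.
have [G adG lW] := exists_admissible_words ([seq t.1 | t <- s] ++ [seq t.2 | t <- s]) tp.
have sW n := word_span_subspace G (long n).
have tW t : t \in s -> word_span G (long 1) t.1 /\ word_span G (long 1) t.2.
  move=> ts; have [t1 t2] := sP t ts.
  by split; apply: (word_aug_long adG) => //; apply: lW; rewrite mem_cat map_f ?orbT.
have uW : word_span G (long 2) u.
  apply: subspace_sum => // t /tW[t1 t2].
  exact: (word_spanMn (m := 1) (n := 1)).
have [e [eM eW eker e_letter]] := euler_derivation adG.
have [Gh Geps _] := adG.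
have kill x v : p x = 0 -> word_span G (long 1) v -> x * v = 0 /\ v * x = 0.
  move=> px /(word_aug adG) pv; split.
    exact: (trivial_extension_mull tp).
  exact: (trivial_extension_mulr tp).
apply: (krull_intersection (n_neq0 1) Gh).
  by move=> b bG _; have [] := kill u b pu (word_span_letter bG).
have uWn n : word_span G (long n.+2) u.
  elim: n => // n IHn.
  apply: (euler_step (M := fun x => p x = 0) eM) => //.
  + exact: (subspace_ker p).
  + by move=> x v /kill h /h[].
  + by move=> x v /kill h /h[].
by move=> n; apply: (@word_span_leq _ _ _ n n.+2); rewrite // ltnW.
Qed.

End CharacteristicZero.

Lemma char0_smooth_at_identity (K : fieldType) (A : comHopfSuperAlgType K) :
  [pchar K] =i pred0 -> smooth_at_identity A.
Proof. by move=> charK0 E p tp s sP; apply: char0_trivial_extension. Qed.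

(** * Characteristic not 2: odd coordinates *)

Section OddSandwich.
Variables (K : fieldType) (E : comSuperAlgType K).
Hypothesis two_neq0 : 2%:R != 0 :> K.

Lemma odd_sandwich (x d : E) : x \in deg true -> x * (d * x) = 0.
Proof.
move=> x1; rewrite [d]componentD mulrDl mulrDr.
have h i : x * (component i d * x) = 0.
  rewrite (supermulC _ _ _ _ (component_deg i d) x1) sign_mulE -scalerAr mulrA.
  by rewrite (odd_sq0 two_neq0 x1) mul0r scaler0.
by rewrite !h addr0.
Qed.

End OddSandwich.

Section RankOne.
Variables (K : fieldType) (V : lmodType K) (x : V) (om : {linear V -> K^o}).
Definition rank_one (a : V) : V := (om a : K) *: x.
Lemma rank_one_is_linear : linear rank_one.
Proof. by move=> k a b; rewrite /rank_one linearP /= scalerDl scalerA. Qed.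
HB.instance Definition _ := GRing.isLinear.Build K V V *:%R rank_one rank_one_is_linear.
End RankOne.

Section OddStep.
Variables (K : fieldType) (A : comHopfSuperAlgType K) (E : comSuperAlgType K).
Hypothesis two_neq0 : 2%:R != 0 :> K.
Variable p : {lrmorphism E -> A}.
Hypothesis tp : trivial_extension p.
Variable G : seq E.
Hypothesis adG : admissible p G.
Local Notation W n := (word_span G (long n)).
Local Notation O n := (word_span G (long_odd n)).
Local Notation im := (letter_image p G).

Let Gh : all_homogeneous G. Proof. by case: adG. Qed.
Let sW n : subspace (W n). Proof. exact: word_span_subspace. Qed.
Let sO n : subspace (O n). Proof. exact: word_span_subspace. Qed.

(** A functional that vanishes on these elements kills the even part and, by [word_degenerate], the
    image of [W 2]. On the image of the letters it is thus an odd derivation at the unit. *)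
Definition degenerate (a : A) : Prop :=
  exists b v, [/\ b \in deg false, O 2 v & a = b + p v].

Lemma degenerate_subspace : subspace degenerate.
Proof.
split; first by exists 0, 0; rewrite rpred0 linear0 addr0; split=> //; case: (sO 2).
move=> k _ _ [b [v [b0 vO ->]]] [c [w [c0 wO ->]]].
exists (k *: b + c), (k *: v + w); split; first by rewrite rpredD ?deg_Z.
  by case: (sO 2) => _; apply.
by rewrite linearP scalerDr addrACA.
Qed.

Lemma word_degenerate v : W 2 v -> degenerate (p v).
Proof.
move=> vW; exists (component false (p v)), (component true v); split.
- exact: component_deg.
- exact: word_span_odd.
by rewrite (trivial_extension_component tp) -componentD.
Qed.

Lemma odd_nonempty x : O 0 x -> O 1 x.
Proof. by apply: word_spanS => -[|y w] [_ [z]] //; split=> //; exists z. Qed.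

(* [e] lifts [x * d/dx]. *)
Definition odd_coordinate (x : E) (e : {linear E -> E}) :=
  [/\ O 1 x, forall v, W 0 v -> O 1 (e v),
      forall u v, W 0 u -> W 0 v -> e (u * v) = e u * v + u * e v,
      forall v, W 0 v -> x * e v = 0 & forall v, p v = 0 -> e v = 0].

(** Take a dual basis of the images of the odd letters modulo [degenerate]. The map a |-> om_i(a)
    x_i is a derivation over the counit, even because om_i and x_i are both odd, and e_i is its
    lift. Every term of e_i v ends in the lift x of x_i, and x d x = 0 for all d, whence the product
    of x with e_i v is zero. *)
Lemma exists_odd_coordinates : exists n (x : 'I_n -> E) (e : 'I_n -> {linear E -> E}),
  [/\ forall i, odd_coordinate (x i) (e i),
      forall i j, O 2 (e i (x j) - (i == j)%:R *: x i) &
      forall y, y \in G -> y \in deg true -> exists (c : 'I_n -> K) z,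
        O 2 z /\ p (y - \sum_i c i *: x i - z) = 0].
Proof.
have [g [g_even gW pg]] := exists_section tp adG.
pose s := [seq p y | y <- G & `[< y \in deg true >]].
have sP (T : A -> Prop) : (forall y, y \in G -> y \in deg true -> T (p y)) ->
    forall a, a \in s -> T a.
  by move=> h a /mapP[y]; rewrite mem_filter => /andP[/asboolP y1 yG] ->; apply: h.
have [n [x [om [omx omU xs sU]]]] := exists_dual_basis degenerate_subspace s.
have x1 i : x i \in deg true.
  apply: (xs i (fun a => a \in deg true)).
    by split=> [|k a b a1 b1]; rewrite ?rpred0 // rpredD ?deg_Z.
  by apply: sP => y _ y1; case: tp => pe _ _; apply: pe.
have xI i : im (x i).
  apply: xs; first exact: image_subspace.
  by apply: sP => y yG _; exists y => //; apply: (@word_span_leq _ _ _ 0 1) => //;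
    apply: word_span_letter.
pose q i : {linear A -> A} := rank_one (x i) (om i).
have om0 i a : a \in deg false -> om i a = 0.
  move=> a0; apply: omU; exists a, 0; split=> //; first by case: (sO 2).
  by rewrite linear0 addr0.
have q_even i : even_map (q i).
  move=> [] a ai; rewrite /= /rank_one; first exact: deg_Z.
  by rewrite om0 // scale0r rpred0.
have q_im i a : im a -> im (q i a).
  by move=> _; apply: subspaceZ; [exact: image_subspace|exact: xI].
have eps_x i : eps (x i) = 0 by apply: eps_odd.
have q_aug i a : im a -> eps (q i a) = 0.
  by rewrite /= /rank_one epsZ eps_x mulr0.
have om_der i a b : im a -> im b ->
    (om i (a * b) : K) = eps a * (om i b : K) + eps b * (om i a : K).
  move=> aI bI; have [v vW pv] := image_aug_mul adG gW pg aI bI.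
  have := omU i _ (word_degenerate vW); rewrite pv aug_mul.
  rewrite linearD linearB linearD !linearZ_LR /= [om i 1]om0 ?deg_1 // scaler0 addr0.
  by move/eqP; rewrite subr_eq0 => /eqP.
have q_der i a b : im a -> im b -> q i (a * b) = eps a *: q i b + eps b *: q i a.
  by move=> aI bI; rewrite /= /rank_one om_der // scalerDl !scalerA.
pose e i : {linear E -> E} := lifted_der p g (q i).
have gx1 i : g (x i) \in deg true by apply: g_even.
have gxO i : O 1 (g (x i)).
  apply: odd_nonempty; have <- : component true (g (x i)) = g (x i).
    by rewrite (component_id _ (gx1 i)) eqxx.
  by apply: word_span_odd => //; apply: gW.
have gqO i a : O 1 (g (q i a)) by rewrite /= /rank_one linearZ_LR; apply: subspaceZ.
exists n, (fun i => g (x i)), e; split.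
- move=> i; split=> //.
  + move=> v; apply: (lifted_der_ind adG) => // a b aI bI.
    by apply: (odd_leq (n := 0 + 1)) => //; apply: word_odd => //; apply: gW.
  + by move=> u v uW vW; apply: (lifted_derM tp adG g_even gW pg (q_even i) (q_im i) (q_aug i) (q_der i)).
  + move=> v; apply: (lifted_der_ind adG (T := fun w => g (x i) * w = 0)).
      split=> [|k a b ea eb]; first by rewrite mulr0.
      by rewrite mulrDr -scalerAr ea eb scaler0 addr0.
    move=> a b _ _; rewrite /= /rank_one linearZ_LR /= -!scalerAr.
    by rewrite odd_sandwich // scaler0.
  + by move=> v; apply: lifted_der_ker.
- move=> i j; have -> : (i == j)%:R *: g (x i) = g (q i (p (g (x j)))).
    by rewrite pg // /= /rank_one omx linearZ_LR.
  apply: (lifted_der_sub adG) => //; last exact: gW.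
  move=> a b aI bI; apply: (word_odd (m := 1) (n := 1)) => //.
  exact: (section_augW adG).
move=> y yG y1.
have [b [v [b0 vO yE]]] : degenerate (p y - \sum_i om i (p y) *: x i).
  by apply: sU; rewrite map_f // mem_filter yG andbT; apply/asboolP.
exists (fun i => om i (p y)), (component true v); split.
  by apply: word_span_odd => //; apply: odd_long.
rewrite !linearB /= linear_sum /=.
have -> : \sum_i p ((om i (p y) : K) *: g (x i)) = \sum_i (om i (p y) : K) *: x i.
  by apply: eq_bigr => i _; rewrite linearZ_LR /= pg.
have e1 z : z \in deg true -> component true z = z.
  by move=> z1; rewrite (component_id _ z1) eqxx.
have := congr1 (component true) yE; rewrite e1; last first.
  rewrite rpredB //; first by case: tp => pe _ _; apply: pe.
  by rewrite rpred_sum // => i _; apply: deg_Z.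
move=> ->; rewrite linearD /= (component_id _ b0) /= add0r.
by rewrite (trivial_extension_component tp) subrr.
Qed.

Section Elimination.
Variables (n : nat) (x : 'I_n -> E) (e : 'I_n -> {linear E -> E}).
Hypothesis xe : forall i, odd_coordinate (x i) (e i).
Hypothesis ex : forall i j, O 2 (e i (x j) - (i == j)%:R *: x i).
Variable m : nat.
Hypothesis m0 : (0 < m)%N.

(** The coefficients are only required to lie in [W m], so that eliminating one coordinate is free
    to change those of the others. *)
Let in_coordinates (J : seq 'I_n) (u : E) : Prop := exists2 v : 'I_n -> E,
  forall i, W m (v i) & O m.+2 (u - \sum_(i <- J) x i * v i).

Let in_coordinates_subspace J : subspace (in_coordinates J).
Proof.
split=> [|k u w [a aW uO] [b bW wO]].
  exists (fun=> 0) => [i|]; first by case: (sW m).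
  by rewrite big1 => [|i _]; rewrite ?mulr0 // subr0; case: (sO m.+2).
exists (fun i => k *: a i + b i) => [i|]; first by case: (sW m) => _; apply.
have -> : \sum_(i <- J) x i * (k *: a i + b i) =
    k *: (\sum_(i <- J) x i * a i) + \sum_(i <- J) x i * b i.
  rewrite scaler_sumr -big_split; apply: eq_bigr => i _.
  by rewrite mulrDr -scalerAr.
by rewrite opprD addrACA -scalerBr; case: (sO m.+2) => _; apply.
Qed.

(* [e i] kills [u], so that [u = u - e i u], and [1 - e i] removes the term of
   index [i]. *)
Let eliminate J u : uniq J -> p u = 0 -> in_coordinates J u -> O m.+2 u.
Proof.
move=> + pu; elim: J => [_ [v _]|i J IHJ /= /andP[iJ uJ] [v vW uO]].
  by rewrite big_nil subr0.
apply: (IHJ uJ); have [xO eO eM xe0 ep] := xe i.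
have W0 k w : W k w -> W 0 w by apply: word_span_leq.
have eW w : W 0 w -> W 1 (e i w) by move=> wW; apply/odd_long/eO.
have xW j : W 0 (x j) by have [h _ _ _ _] := xe j; apply: (W0 1); apply: odd_long.
exists (fun j => v j - e i (v j)) => [j|].
  by apply: subspaceB => //; apply: der_word.
set z := u - _ in uO; have uE : u = z + \sum_(j <- i :: J) x j * v j by rewrite subrK.
(* Subtracting e i u = 0 from u leaves this remainder. It lies in [O m.+2]: z does by choice, [e i]
   preserves the length, and e i (x j) differs from its expected value by an element of [O 2], which
   is multiplied by v j in [W m]. *)
have -> : u - \sum_(j <- J) x j * (v j - e i (v j)) =
    (z - e i z) - \sum_(j <- i :: J) (e i (x j) - (i == j)%:R *: x i) * v j.
  rewrite !big_cons eqxx scale1r mulrBl /=.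
  have -> : \sum_(j <- J) x j * (v j - e i (v j)) =
      \sum_(j <- J) x j * v j - \sum_(j <- J) x j * e i (v j).
    by rewrite -sumrB; apply: eq_bigr => j _; rewrite mulrBr.
  have -> : \sum_(j <- J) (e i (x j) - (i == j)%:R *: x i) * v j =
      \sum_(j <- J) e i (x j) * v j.
    rewrite big_seq [RHS]big_seq; apply: eq_bigr => j jJ.
    by rewrite eq_sym (negPf (memPn iJ j jJ)) scale0r subr0.
  have eu : e i z + (e i (x i) * v i + (\sum_(j <- J) e i (x j) * v j +
      \sum_(j <- J) x j * e i (v j))) = 0.
    transitivity (e i u); last exact: ep.
    rewrite [in RHS]uE big_cons !linearD linear_sum /= eM //; last exact: W0 (vW i).
    rewrite xe0 ?addr0; last exact: W0 (vW i).
    rewrite -big_split; congr (_ + (_ + _)).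
    by rewrite linear_sum; apply: eq_bigr => j _; rewrite /= eM //; apply: W0 (vW j).
  apply/eqP; rewrite subr_eq -[u]subr0 -[X in u - X]eu {1}uE big_cons.
  by rewrite !opprD !opprK !addrA [X in X == _](AC 7 (1*4*5*2*6*3*7)).
apply: subspaceB => //; first apply: subspaceB => //.
  by apply: der_odd => //; apply: odd_long.
by apply: subspace_sum => // j _; apply: (odd_word (m := 2) (n := m)).
Qed.

Hypothesis letterP : forall y, y \in G -> y \in deg true ->
  exists (c : 'I_n -> K) z, O 2 z /\ p (y - \sum_i c i *: x i - z) = 0.

(** An odd letter of each word is moved to the front and written in the coordinates, up to [O 2] and
    ker p. The remaining word has length at least m > 0 and so annihilates the part in ker p. The
    coordinates are then eliminated one by one. *)
Lemma odd_step u : O m.+1 u -> p u = 0 -> O m.+2 u.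
Proof.
move=> uO pu; apply: (@eliminate (index_enum 'I_n)) => //; first exact: index_enum_uniq.
move: uO; apply: word_span_min; first exact: in_coordinates_subspace.
move=> w wG [wm [y yw y1]]; have yG := wG y yw.
have wh : all_homogeneous w by move=> z /wG; apply: Gh.
have [b ->] := prod_rem wh yw; rewrite sign_mulE.
apply: subspaceZ; first exact: in_coordinates_subspace.
have rW : W m (\prod_(z <- rem y w) z).
  apply: word_span_word; first by move=> z /mem_rem; apply: wG.
  by rewrite /long size_rem //; move: wm; rewrite /long; case: size.
set r := \prod_(z <- _) z in rW *.
have [c [z [zO pz]]] := letterP yG y1.
exists (fun i => c i *: r) => [i|]; first exact: subspaceZ.
suff -> : y * r - \sum_i x i * (c i *: r) = z * r.
  exact: (odd_word (m := 2) (n := m)).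
apply/eqP; rewrite -subr_eq0; apply/eqP.
transitivity ((y - \sum_i c i *: x i - z) * r); last first.
  apply: (trivial_extension_mull tp pz); apply: (word_aug adG).
  exact: word_span_leq rW.
rewrite !mulrBl mulr_suml; congr (_ - _ - _); apply: eq_bigr => i _.
by rewrite -scalerAr -scalerAl.
Qed.

End Elimination.

Lemma odd_trivial_extension u : O 2 u -> p u = 0 -> u = 0.
Proof.
move=> uO pu; have [n [x [e [xe ex letterP]]]] := exists_odd_coordinates.
apply: (krull_intersection two_neq0 Gh).
  move=> b bG _; apply: (trivial_extension_mulr tp pu).
  by apply: (word_aug adG); apply: word_span_letter.
have uOn k : O k.+2 u.
  by elim: k => // k IHk; apply: (odd_step xe ex (m := k.+1)).
by move=> k; apply: (@word_span_leq _ _ _ k k.+2); [rewrite ltnW|apply: odd_long].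
Qed.

End OddStep.

(** * From the bosonic quotient to the identity *)

Section SmoothSection.
Variables (K : fieldType) (R B : comAlgType K) (p : {lrmorphism B -> R}).
Hypothesis p_surj : forall a, exists b, p b = a.

Definition lr_ker : {pred B} := [pred b | p b == 0].

Lemma lr_kerP b : reflect (p b = 0) (b \in lr_ker). Proof. exact: eqP. Qed.

Lemma lr_ker_zmod : zmod_closed lr_ker.
Proof.
split=> [|x y /lr_kerP px /lr_kerP py]; apply/lr_kerP; first exact: linear0.
by rewrite linearB /= px py subrr.
Qed.
HB.instance Definition _ := GRing.isZmodClosed.Build B lr_ker lr_ker_zmod.

Lemma lr_ker1 : 1 \notin lr_ker.
Proof. by apply/lr_kerP/eqP; rewrite rmorph1 oner_eq0. Qed.
Lemma lr_kerMl a x : x \in lr_ker -> a * x \in lr_ker.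
Proof. by move=> /lr_kerP px; apply/lr_kerP; rewrite rmorphM /= px mulr0. Qed.
Lemma lr_kerMr a x : x \in lr_ker -> x * a \in lr_ker.
Proof. by move=> /lr_kerP px; apply/lr_kerP; rewrite rmorphM /= px mul0r. Qed.
HB.instance Definition _ := isTwoSidedIdeal.Build B lr_ker lr_ker1 lr_kerMl lr_kerMr.

Definition ker_inverse (a : R) : algquot lr_ker := algproj lr_ker (sval (cid (p_surj a))).

Lemma ker_inverseE b : ker_inverse (p b) = algproj lr_ker b.
Proof.
by apply/algproj_eq/lr_kerP; rewrite linearB /=; case: cid => c /= ->; rewrite subrr.
Qed.

Lemma ker_inverse_is_linear : linear ker_inverse.
Proof.
move=> k x y; have [a <-] := p_surj x; have [b <-] := p_surj y.
by rewrite -linearP !ker_inverseE linearP.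
Qed.
HB.instance Definition _ :=
  GRing.isLinear.Build K R (algquot lr_ker) *:%R ker_inverse ker_inverse_is_linear.
Lemma ker_inverse_is_monoid_morphism : monoid_morphism ker_inverse.
Proof.
split=> [|x y]; first by rewrite -(rmorph1 p) ker_inverseE rmorph1.
have [a <-] := p_surj x; have [b <-] := p_surj y.
by rewrite -rmorphM !ker_inverseE rmorphM.
Qed.
HB.instance Definition _ :=
  GRing.isMonoidMorphism.Build R (algquot lr_ker) ker_inverse ker_inverse_is_monoid_morphism.

Lemma smooth_section : smooth R -> nilpotent lr_ker ->
  exists g : {lrmorphism R -> B}, forall a, p (g a) = a.
Proof.
move=> smR nilp; have [g gE] := smR B lr_ker nilp ker_inverse.
exists g => a; have [b <-] := p_surj a; have := gE (p b).
rewrite /= ker_inverseE => /algproj_eq/lr_kerP.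
by rewrite linearB /= => /eqP; rewrite subr_eq0 => /eqP.
Qed.

End SmoothSection.

(** The difference of t and g(r t) lies in ker r, which annihilates both factors and itself. So each
    product t1 t2 equals g(r t1) g(r t2), and the sum is the image under [g] of 0. *)
Lemma sum_section0 (K : fieldType) (R B : comAlgType K) (r : {lrmorphism B -> R})
    (g : {lrmorphism R -> B}) (s : seq (B * B)) :
    (forall a, r (g a) = a) ->
    (forall t y, t \in s -> r y = 0 -> y * t.1 = 0 /\ y * t.2 = 0) ->
    (forall y z, r y = 0 -> r z = 0 -> y * z = 0) ->
  r (\sum_(t <- s) t.1 * t.2) = 0 -> \sum_(t <- s) t.1 * t.2 = 0.
Proof.
move=> rg sK kerM u0; transitivity (g (r (\sum_(t <- s) t.1 * t.2))); last first.
  by rewrite u0 linear0.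
rewrite !linear_sum big_seq [RHS]big_seq; apply: eq_bigr => t ts /=.
have ker x : r (x - g (r x)) = 0 by rewrite linearB /= rg subrr.
rewrite !rmorphM /=; set b := g (r t.1); set c := g (r t.2).
have [h1 h2] := (sK t _ ts (ker t.1), sK t _ ts (ker t.2)).
have h3 := kerM _ _ (ker t.1) (ker t.2).
move: h2.1 => /eqP; rewrite mulrBl subr_eq0 mulrC => /eqP ->; rewrite mulrC.
by move: h3 => /eqP; rewrite mulrBr h1.2 sub0r oppr_eq0 mulrBl subr_eq0 => /eqP.
Qed.

Section BosonicPart.
Variables (K : fieldType) (A : comHopfSuperAlgType K) (E : comSuperAlgType K).
Variable p : {lrmorphism E -> A}.
Hypothesis tp : trivial_extension p.

Let p_even : even_map p. Proof. by case: tp. Qed.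
Let p_surj a : exists x, p x = a. Proof. by case: tp. Qed.

Lemma odd_ideal_image x : x \in odd_ideal E -> p x \in odd_ideal A.
Proof.
case/odd_idealP=> s sP ->; apply/odd_idealP.
exists [seq (p t.1.1, p t.1.2, p t.2) | t <- s] => [_ /mapP[t ts ->]|].
  exact: p_even (sP t ts).
by rewrite rmorph_sum big_map; apply: eq_bigr => t _; rewrite !rmorphM.
Qed.

Lemma odd_ideal_preimage a : a \in odd_ideal A -> exists2 x, x \in odd_ideal E & p x = a.
Proof.
pose I : {pred A} := [pred a | `[< exists2 x, x \in odd_ideal E & p x = a >]].
move=> aO; suff /asboolP : a \in I by []; move: a aO; apply: odd_ideal_min.
- split=> [|_ _ /asboolP[x xO <-] /asboolP[y yO <-]]; apply/asboolP.
    by exists 0; rewrite ?rpred0 ?linear0.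
  by exists (x - y); rewrite ?rpredB ?linearB.
- move=> a b _ /asboolP[x xO <-]; apply/asboolP.
  have [[a' <-] [b' <-]] := (p_surj a, p_surj b).
  by exists (a' * x * b'); rewrite ?rmorphM //; apply/odd_idealMr/odd_idealMl.
move=> a a1; apply/asboolP; have [x px] := p_surj a.
exists (component true x); first exact/odd_ideal_deg/component_deg.
by rewrite (trivial_extension_component tp) px (component_id _ a1) eqxx.
Qed.

Lemma odd_ideal_proper : 1 \notin odd_ideal E.
Proof. by apply/negP => /odd_ideal_image; rewrite rmorph1; apply/negP/odd_ideal1. Qed.

Definition odd_tsideal : tsideal E :=
  HB.pack_for (tsideal E) (odd_ideal E)
    (isTwoSidedIdeal.Build E (odd_ideal E) odd_ideal_proper (@odd_idealMl K E) (@odd_idealMr K E)).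

Definition bosonic_part : Type := algquot odd_tsideal.
HB.instance Definition _ := GRing.Algebra.on bosonic_part.

Lemma bosonic_part_mulC : commutative (@GRing.mul bosonic_part).
Proof.
move=> x y; case: (algproj_surj x) (algproj_surj y) => a <- [b <-].
have even (c : E) : algproj odd_tsideal c = algproj odd_tsideal (component false c).
  apply/algproj_eq; rewrite {1}[c]componentD addrAC subrr add0r.
  exact/odd_ideal_deg/component_deg.
rewrite [_ a]even [_ b]even /GRing.mul /= !aq_mulE; congr algproj.
by rewrite (supermulC _ _ _ _ (component_deg false a) (component_deg false b)) mul1r.
Qed.
HB.instance Definition _ :=
  GRing.PzRing_hasCommutativeMul.Build bosonic_part bosonic_part_mulC.

Definition to_bosonic : {lrmorphism E -> bosonic A} := algproj (odd_ideal A) \o p.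

Lemma to_bosonic_odd x : x \in odd_tsideal -> to_bosonic x = 0.
Proof. by move=> xO; apply/algproj_eq0/odd_ideal_image. Qed.

Definition bosonic_map : {lrmorphism bosonic_part -> bosonic A} :=
  aq_lift to_bosonic_odd.

Local Notation pr := (algproj odd_tsideal).

Lemma bosonic_mapE x : bosonic_map (pr x) = algproj (odd_ideal A) (p x).
Proof. exact: aq_liftE. Qed.

Lemma bosonic_map_surj a : exists x, bosonic_map x = a.
Proof.
have [b <-] := algproj_surj a; have [x <-] := p_surj b.
by exists (pr x); rewrite bosonic_mapE.
Qed.

(** As (E_1) maps onto (A_1), a representative can be corrected by an element of (E_1) to lie in ker
    p. This transfers the annihilation properties of ker p to the kernel of the bosonic map. *)
Lemma bosonic_map_ker y : bosonic_map y = 0 -> exists2 x, p x = 0 & pr x = y.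
Proof.
have [x <-] := algproj_surj y; rewrite bosonic_mapE => /algproj_eq0/odd_ideal_preimage.
move=> [z zO pz]; exists (x - z); first by rewrite linearB /= pz subrr.
by apply/algproj_eq; rewrite addrAC subrr add0r rpredN.
Qed.

Lemma bosonic_map_kerM (y : bosonic_part) x :
  bosonic_map y = 0 -> eps (p x) = 0 -> y * pr x = 0.
Proof.
move=> /bosonic_map_ker[z pz <-] ex; rewrite -[LHS]rmorphM.
by rewrite (trivial_extension_mull tp pz ex); apply: linear0.
Qed.

Lemma bosonic_map_ker2 (y z : bosonic_part) :
  bosonic_map y = 0 -> bosonic_map z = 0 -> y * z = 0.
Proof.
move=> y0 /bosonic_map_ker[x px <-]; apply: bosonic_map_kerM => //.
by rewrite px eps0.
Qed.

Lemma smooth_bosonic_odd (s : seq (E * E)) : smooth (bosonic A) ->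
  (forall t, t \in s -> eps (p t.1) = 0 /\ eps (p t.2) = 0) ->
  p (\sum_(t <- s) t.1 * t.2) = 0 -> \sum_(t <- s) t.1 * t.2 \in odd_ideal E.
Proof.
move=> smA sP pu.
have [|g gE] := @smooth_section K (bosonic A) bosonic_part bosonic_map bosonic_map_surj smA.
  exists 2%N => -[|x [|y []]] // _ sK.
  rewrite !big_cons big_nil mulr1; apply: bosonic_map_ker2; apply/lr_kerP/sK;
  by rewrite !inE eqxx ?orbT.
apply/(algproj_eq0 odd_tsideal); rewrite linear_sum.
have -> : \sum_(t <- s) pr (t.1 * t.2) =
    \sum_(t <- [seq (pr t.1 : bosonic_part, pr t.2 : bosonic_part) | t <- s]) t.1 * t.2.
  by rewrite big_map; apply: eq_bigr => t _; exact: rmorphM.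
apply: (sum_section0 gE).
- move=> _ y /mapP[t /sP[e1 e2] ->] y0; split; exact: bosonic_map_kerM.
- exact: bosonic_map_ker2.
have e : bosonic_map (pr (\sum_(t <- s) t.1 * t.2)) = 0.
  by rewrite bosonic_mapE pu; exact: linear0.
rewrite -[RHS]e; congr (bosonic_map _); rewrite big_map linear_sum.
by apply: eq_bigr => t _; apply/esym; exact: rmorphM.
Qed.

End BosonicPart.

(** Lying in (E_1) yields one odd letter per word, whereas [odd_trivial_extension] asks for words of
    length two with an odd letter. The letters are chosen to generate not only the factors of the
    given sum but also the elements that witness its membership in (E_1). *)
Lemma smooth_bosonic_smooth_at_identity (K : fieldType) (A : comHopfSuperAlgType K) :
  2%:R != 0 :> K -> smooth (bosonic A) -> smooth_at_identity A.
Proof.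
move=> two_neq0 smA E p tp s sP; set u := \sum_(t <- s) _ => pu.
have /odd_idealP[r rP uE] := smooth_bosonic_odd tp smA sP pu.
have [G adG lW] := exists_admissible_words
  ([seq t.1 | t <- s] ++ [seq t.2 | t <- s] ++ [seq t.1.1 | t <- r] ++
   [seq t.1.2 | t <- r] ++ [seq t.2 | t <- r]) tp.
have [Gh _ _] := adG.
have sO := word_span_subspace G (long_odd 2).
have oddO x : word_span G (long 0) x -> word_span G (long_odd 1) (component true x).
  by move=> xW; apply: odd_nonempty; apply: word_span_odd.
apply: (odd_trivial_extension two_neq0 tp adG) => //.
(* The odd component is handled by u in [W 2]. In the even component of a x b with x odd, either a
   or b contributes a second odd factor, which supplies the missing length. *)
rewrite [u]componentD; apply: subspaceD => //; last first.
  apply: word_span_odd => //; apply: subspace_sum => [|t ts].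
    exact: word_span_subspace.
  have [e1 e2] := sP t ts.
  apply: (word_spanMn (m := 1) (n := 1)); apply: (word_aug_long adG) => //;
  by apply: lW; rewrite !mem_cat map_f ?orbT.
rewrite /u uE linear_sum; apply: subspace_sum => // t tr /=.
have [aW xW bW] : [/\ word_span G (long 0) t.1.1, word_span G (long 0) t.1.2 &
    word_span G (long 0) t.2].
  split; apply: lW; rewrite !mem_cat;
    by rewrite ?(map_f (fun t => t.1.1) tr) ?(map_f (fun t => t.1.2) tr)
      ?(map_f (fun t => t.2) tr) ?orbT.
have x1 := rP t tr; have xO := oddO _ xW.
rewrite (component_id _ x1) eqxx in xO.
set a := t.1.1 in aW *; set b := t.2 in bW *; set x := t.1.2 in xW x1 xO *.
have cW i y : word_span G (long 0) y -> word_span G (long 0) (component i y).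
  exact: word_span_component.
have -> : component false (a * x * b) =
    component true a * x * component false b + component false a * x * component true b.
  rewrite {1}[a]componentD {1}[b]componentD !mulrDl !mulrDr !linearD /=.
  have h i j : component i a * x * component j b \in deg (i (+) true (+) j).
    by rewrite !deg_M ?component_deg.
  by rewrite !(component_id _ (h _ _)) /= add0r addr0 addrC.
apply: subspaceD => //; rewrite -?mulrA.
  apply: (odd_word (m := 1) (n := 1)); first exact: oddO.
  by apply: odd_long; apply: (odd_word (m := 1) (n := 0)) => //; apply: cW.
apply: (word_odd (m := 0) (n := 2)); first exact: cW.
by apply: (odd_word (m := 1) (n := 1)) => //; apply/odd_long/oddO.
Qed.

Theorem propositionA3 (K : fieldType) (charK : 2%N \notin [pchar K])
    (A : comHopfSuperAlgType K) :
  (super_smooth A <-> smooth (bosonic A)) /\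
  ([pchar K] =i pred0 -> finitely_generated (bosonic A) ->
     super_smooth A /\ smooth (bosonic A)).
Proof.
have two_neq0 : 2%:R != 0 :> K by move: charK; rewrite inE.
split=> [|charK0 _].
  split=> [|smA]; first exact: super_smooth_smooth_bosonic.
  exact/smooth_at_identity_super_smooth/smooth_bosonic_smooth_at_identity.
have smA : super_smooth A.
  exact/smooth_at_identity_super_smooth/char0_smooth_at_identity.
by split=> //; apply: super_smooth_smooth_bosonic.
Qed.
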